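(* Fix $n$. There is an algorithm which, given a set $\mathcal{F}$ of $s$ homogeneous polynomials in $\mathbb{K}[x_1,\dots,x_n]$, each having at most $m$ monomials and total degree at most $d$, solves the SAGBI basis detection problem for $\mathcal{F}$ (decide whether there exists a term order with respect to which $\mathcal{F}$ is a SAGBI basis of $\mathbb{K}[\mathcal{F}]$) using $$O\left(\binom{s+s^2d^n}{s}\cdot m^{2n-1}\cdot s^{4n^2+11n+4}\cdot d^{2n^3+8n^2+5n+1}\right)$$ arithmetic operations.
   Context: $\mathbb{K}$ is a field and $\mathbb{K}[\mathcal{F}]$ is the $\mathbb{K}$-subalgebra of $\mathbb{K}[x_1,\dots,x_n]$ generated by $\mathcal{F}$. For a term order $\succ$, $\mathrm{in}_\succ(f)$ denotes the leading monomial of $f\neq 0$, and the initial algebra of a subalgebra $S$ is $\mathrm{in}_\succ(S)=\mathbb{K}[\mathrm{in}_\succ(f)\mid 0\ne f\in S]$. A set $\mathcal{F}\subset S$ is a SAGBI basis of $S$ with respect to $\succ$ if the monomials $\mathrm{in}_\succ(f)$, $f\in\mathcal{F}$, generate $\mathrm{in}_\succ(S)$ as a $\mathbb{K}$-algebra. Complexity is measured in the unit-cost model, counting arithmetic operations; the implied constant may depend on $n$, which is fixed. *)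

(* Defs.v *)
From HB Require Import structures.
From mathcomp Require Import all_boot all_order all_algebra.
From mathcomp Require Export mpoly.
Set Implicit Arguments.
Unset Strict Implicit.
Unset Printing Implicit Defensive.
Import GRing.Theory.
Local Open Scope ring_scope.

(** * SAGBI bases *)

Definition term_order (n : nat) (le : rel 'X_{1..n}) : Prop :=
  [/\ total le, antisymmetric le, transitive le,
      (forall u, le 0%MM u) &
      (forall u v w, le u v -> le (u + w)%MM (v + w)%MM)].

(* The largest monomial of the support. Starting the fold at [0%MM] is harmless
   for a term order, where it is the least monomial; the value is meaningful
   for [f != 0] only. *)
Definition in_mon (n : nat) (K : fieldType) (le : rel 'X_{1..n})
    (f : {mpoly K[n]}) : 'X_{1..n} :=
  foldr (fun u v => if le u v then v else u) 0%MM (msupp f).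

(* [subalg G] is the K-subalgebra K[G] generated by a set [G]. *)
Inductive subalg (n : nat) (K : fieldType) (G : {mpoly K[n]} -> Prop) :
    {mpoly K[n]} -> Prop :=
| subalg_gen f : G f -> subalg G f
| subalg_const (c : K) : subalg G c%:MP
| subalg_add f g : subalg G f -> subalg G g -> subalg G (f + g)
| subalg_mul f g : subalg G f -> subalg G g -> subalg G (f * g).

Definition initials (n : nat) (K : fieldType) (le : rel 'X_{1..n})
    (S : {mpoly K[n]} -> Prop) : {mpoly K[n]} -> Prop :=
  fun g => exists f, [/\ S f, f != 0 & g = 'X_[in_mon le f]].

Definition initial_algebra (n : nat) (K : fieldType) (le : rel 'X_{1..n})
    (S : {mpoly K[n]} -> Prop) : {mpoly K[n]} -> Prop :=
  subalg (initials le S).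

(* The zero polynomial has no leading monomial: if it belongs to [F], it
   contributes nothing to [initials le F]. *)
Definition sagbi_basis (n : nat) (K : fieldType) (le : rel 'X_{1..n})
    (F S : {mpoly K[n]} -> Prop) : Prop :=
  (forall f, F f -> S f) /\
  (forall g, subalg (initials le F) g <-> initial_algebra le S g).

Definition sagbi_detectable (n : nat) (K : fieldType)
    (F : seq {mpoly K[n]}) : Prop :=
  exists le : rel 'X_{1..n},
    term_order le /\
    sagbi_basis le (fun f => f \in F) (subalg (fun f => f \in F)).

(** * The unit-cost model

   A structured unit-cost random access machine over a field K.  The memory
   consists of arrays of natural numbers and arrays of elements of K, with
   indirect addressing.  Programs are finite syntax which mentions neither K nor
   the size of the input, and which can access K only through 0, 1, the field
   operations and equality tests.  Natural numbers are handled with +,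
   truncated -, * and comparisons (no integer division).  Every operation,
   memory access, constant, assignment, test and jump costs one unit, so that
   the cost bounds the number of arithmetic operations. *)

Inductive nexp : Type :=
| NConst of nat
| NLoad of nat & nexp               (* array name, index *)
| NAdd of nexp & nexp
| NSub of nexp & nexp
| NMul of nexp & nexp.

Inductive kexp : Type :=
| KZero
| KOne
| KLoad of nat & nexp
| KAdd of kexp & kexp
| KSub of kexp & kexp
| KMul of kexp & kexp
| KDiv of kexp & kexp.

Inductive bexp : Type :=
| BNle of nexp & nexp
| BNeq of nexp & nexp
| BKeq of kexp & kexp
| BNot of bexp
| BAnd of bexp & bexp.

Inductive cmd : Type :=
| Skip
| NStore of nat & nexp & nexp       (* array name, index, value *)
| KStore of nat & nexp & kexp
| Seq of cmd & cmd
| If of bexp & cmd & cmd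
| While of bexp & cmd.

Record state (K : fieldType) : Type := State {
  nmem : nat -> nat -> nat;
  kmem : nat -> nat -> K
}.

Definition upd (V : Type) (mem : nat -> nat -> V) (a i : nat) (v : V) :
    nat -> nat -> V :=
  fun a' i' => if (a' == a) && (i' == i) then v else mem a' i'.

Fixpoint neval (K : fieldType) (st : state K) (e : nexp) : nat :=
  match e with
  | NConst k => k
  | NLoad a i => nmem st a (neval st i)
  | NAdd e1 e2 => (neval st e1 + neval st e2)%N
  | NSub e1 e2 => (neval st e1 - neval st e2)%N
  | NMul e1 e2 => (neval st e1 * neval st e2)%N
  end.

Fixpoint keval (K : fieldType) (st : state K) (e : kexp) : K :=
  match e with
  | KZero => 0
  | KOne => 1
  | KLoad a i => kmem st a (neval st i)
  | KAdd e1 e2 => keval st e1 + keval st e2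
  | KSub e1 e2 => keval st e1 - keval st e2
  | KMul e1 e2 => keval st e1 * keval st e2
  | KDiv e1 e2 => keval st e1 / keval st e2
  end.

Fixpoint beval (K : fieldType) (st : state K) (b : bexp) : bool :=
  match b with
  | BNle e1 e2 => (neval st e1 <= neval st e2)%N
  | BNeq e1 e2 => neval st e1 == neval st e2
  | BKeq e1 e2 => keval st e1 == keval st e2
  | BNot b1 => ~~ beval st b1
  | BAnd b1 b2 => beval st b1 && beval st b2
  end.

Fixpoint ncost (e : nexp) : nat :=
  match e with
  | NConst _ => 1
  | NLoad _ i => (ncost i).+1
  | NAdd e1 e2 | NSub e1 e2 | NMul e1 e2 => (ncost e1 + ncost e2).+1
  end.

Fixpoint kcost (e : kexp) : nat :=
  match e with
  | KZero | KOne => 1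
  | KLoad _ i => (ncost i).+1
  | KAdd e1 e2 | KSub e1 e2 | KMul e1 e2 | KDiv e1 e2 =>
      (kcost e1 + kcost e2).+1
  end.

Fixpoint bcost (b : bexp) : nat :=
  match b with
  | BNle e1 e2 | BNeq e1 e2 => (ncost e1 + ncost e2).+1
  | BKeq e1 e2 => (kcost e1 + kcost e2).+1
  | BNot b1 => (bcost b1).+1
  | BAnd b1 b2 => (bcost b1 + bcost b2).+1
  end.

(* [exec c st st' t]: started in [st], [c] halts in [st'] at total cost [t]. *)
Inductive exec (K : fieldType) : cmd -> state K -> state K -> nat -> Prop :=
| exec_skip st : exec Skip st st 1
| exec_nstore st a i e :
    exec (NStore a i e) st
      (State (upd (nmem st) a (neval st i) (neval st e)) (kmem st))
      (ncost i + ncost e).+1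
| exec_kstore st a i e :
    exec (KStore a i e) st
      (State (nmem st) (upd (kmem st) a (neval st i) (keval st e)))
      (ncost i + kcost e).+1
| exec_seq c1 c2 st1 st2 st3 t1 t2 :
    exec c1 st1 st2 t1 -> exec c2 st2 st3 t2 ->
    exec (Seq c1 c2) st1 st3 (t1 + t2)
| exec_if b c1 c2 st st' t :
    exec (if beval st b then c1 else c2) st st' t ->
    exec (If b c1 c2) st st' (bcost b + t).+1
| exec_while_false b c st :
    ~~ beval st b -> exec (While b c) st st (bcost b).+1
| exec_while_true b c st1 st2 st3 t1 t2 :
    beval st1 b -> exec c st1 st2 t1 -> exec (While b c) st2 st3 t2 ->
    exec (While b c) st1 st3 (bcost b + t1 + t2).+1.

Lemma exec_det (K : fieldType) c (st st1 st2 : state K) t1 t2 :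
  exec c st st1 t1 -> exec c st st2 t2 -> st1 = st2 /\ t1 = t2.
Proof.
move=> H; elim: H st2 t2 => {c st st1 t1}.
- by move=> st st2 t2 H; inversion H; subst.
- by move=> st a i e st2 t2 H; inversion H; subst.
- by move=> st a i e st2 t2 H; inversion H; subst.
- move=> c1 c2 st1 st2 st3 t1 t2 _ IH1 _ IH2 st' t' H.
  inversion H as [| | |? ? ? ? ? ? ? E1 E2| | |]; subst.
  by case: (IH1 _ _ E1) => ? ?; subst; case: (IH2 _ _ E2) => ? ?; subst.
- move=> b c1 c2 st st' t _ IH st2 t2 H.
  inversion H as [| | | |? ? ? ? ? ? E| |]; subst.
  by case: (IH _ _ E) => ? ?; subst.
- move=> b c st Hb st2 t2 H.
  inversion H as [| | | | | |? ? ? ? ? ? ? Hb']; subst => //.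
  by rewrite Hb' in Hb.
- move=> b c st1 st2 st3 t1 t2 Hb _ IH1 _ IH2 st' t' H.
  inversion H as [| | | | |? ? ? Hb'|? ? ? ? ? ? ? _ E1 E2]; subst.
    by rewrite Hb in Hb'.
  by case: (IH1 _ _ E1) => ? ?; subst; case: (IH2 _ _ E2) => ? ?; subst.
Qed.

(** * Input and output *)

(* A sparse polynomial is a list of pairs (coefficient, exponent vector). [L]
   lists the terms of each polynomial of [F], in an arbitrary order, with
   nonzero coefficients and without repetition of monomials. *)
Definition sparse_repr (n : nat) (K : fieldType) (F : seq {mpoly K[n]})
    (L : seq (seq (K * 'X_{1..n}))) : Prop :=
  all2 (fun f l => perm_eq l [seq (f@_u, u) | u <- msupp f]) F L.

(* Initial memory (everything not listed is zero):
   - array 0 of naturals: the number of polynomials;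
   - array 1 of naturals: the numbers of terms of the polynomials;
   - array 2 of naturals: the exponent vectors of all the terms, n entries each;
   - array 0 of K: the coefficients of all the terms. *)
Definition init_state (n : nat) (K : fieldType)
    (L : seq (seq (K * 'X_{1..n}))) : state K :=
  State
    (fun a i => match a with
      | 0%N => nth 0%N [:: size L] i
      | 1%N => nth 0%N [seq size l | l <- L] i
      | 2%N => nth 0%N (flatten
                 [seq [seq p.2 k | k <- enum 'I_n] | p : K * 'X_{1..n} <- flatten L]) i
      | _ => 0%N
      end)
    (fun a i => match a with
      | 0%N => nth 0 [seq p.1 | p <- flatten L] i
      | _ => 0
      end).

Definition accepts (K : fieldType) (st : state K) : Prop := nmem st 0 0 = 1%N.
Definition rejects (K : fieldType) (st : state K) : Prop := nmem st 0 0 = 0%N.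

(* Main.v *)
Require Import Defs.
From mathcomp Require Import all_boot all_order all_algebra all_fingroup.
From mathcomp Require Import zify ring lra.
From Stdlib Require Import Classical.
Set Implicit Arguments.
Unset Strict Implicit.
Unset Printing Implicit Defensive.
Import Order.TTheory GRing.Theory Num.Theory.

(** For a term order, the finite set F is a SAGBI basis of the algebra it
    generates exactly when every initial monomial of the algebra is a sum (in
    the monoid of exponents) of initial monomials of elements of F
    ([sagbi_basisP]). The generators are homogeneous, so this can be examined
    degree by degree. Up to a degree E, the algebra is spanned by the products
    of generators of degree at most E. Such products with distinct initial
    monomials are independent, hence the truncation of the algebra of initial
    monomials has at most the dimension of the truncation of the algebra of F,
    with equality exactly when no other initial monomial occurs up to degree E
    ([dimension_criterion]).

    Two bounds turn this into a finite test. First, it is enough to look at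
    degrees up to some E of order D^(n+1), where D bounds the degrees of the
    generators ([generated_beyond_bound]). The only obstructions are pairs of
    words in the generators with the same sum of initial monomials, and a pair
    of long words splits into two pairs of shorter ones ([split_words]). This
    is a statement on integer vectors with sum zero: they can be ordered so
    that the partial sums stay in a box of radius n D, and two partial sums
    coincide when there are many vectors ([zero_sum_subset]).

    Second, on the monomials of degree at most D a term order is given by a
    weight vector with entries at most n! D^(n-1) ([term_order_weight]). A
    rational weight exists by Fourier-Motzkin elimination
    ([positive_functional]), and Cramer's rule bounds a vertex of the
    polyhedron of such weights ([bounded_weight]). Conversely, every weight,
    with ties broken lexicographically, comes from a term order.

    The program therefore computes the dimension of the truncated algebra of
    F, then that of the truncated algebra of the leading terms for each weight
    vector in the box, and accepts if the two agree once ([detect_spec]). To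
    compute a dimension it starts from the polynomial 1 and multiplies the
    members of a growing basis by the generators, reducing each product by
    Gaussian elimination ([dimension_spec]). Polynomials are dense rows
    indexed by the base-Q codes of monomials, with Q = E + 1; as no degree
    exceeds E, multiplying monomials adds their codes.

    There are Q^n codes and as many weights, and F has at most s Q^n terms. So
    every loop makes at most s Q^n iterations, where Q^n is of order
    d^(n(n+1)), and the loops are nested at most five deep. The cost is of
    order s^5 d^(5n(n+1)), which is below the bound of the theorem. *)

(** * Hoare logic with a syntactic cost bound *)

Fixpoint nwrites (c : cmd) : seq nat :=
  match c with
  | NStore a _ _ => [:: a]
  | Seq c1 c2 | If _ c1 c2 => nwrites c1 ++ nwrites c2
  | While _ c1 => nwrites c1
  | Skip | KStore _ _ _ => [::]
  end.

Fixpoint kwrites (c : cmd) : seq nat :=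
  match c with
  | KStore a _ _ => [:: a]
  | Seq c1 c2 | If _ c1 c2 => kwrites c1 ++ kwrites c2
  | While _ c1 => kwrites c1
  | Skip | NStore _ _ _ => [::]
  end.

(** The factor [B] of a loop stands for a bound on the number of its iterations;
    branches are added rather than maximized, which only affects constants. *)
Fixpoint cost_bound (B : nat) (c : cmd) : nat :=
  match c with
  | Skip => 1
  | NStore _ i e => (ncost i + ncost e).+1
  | KStore _ i e => (ncost i + kcost e).+1
  | Seq c1 c2 => cost_bound B c1 + cost_bound B c2
  | If b c1 c2 => (bcost b + (cost_bound B c1 + cost_bound B c2)).+1
  | While b c1 => B * (bcost b + cost_bound B c1).+1 + (bcost b).+1
  end.

Fixpoint loop_depth (c : cmd) : nat :=
  match c with
  | Skip | NStore _ _ _ | KStore _ _ _ => 0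
  | Seq c1 c2 | If _ c1 c2 => maxn (loop_depth c1) (loop_depth c2)
  | While _ c1 => (loop_depth c1).+1
  end.

(** Only the nesting of loops produces powers of [B], so the exponent can be
    read off the program text. *)
Lemma cost_bound_poly c :
  exists C, forall B, cost_bound B c <= C * B.+1 ^ loop_depth c.
Proof.
have up B k l : k <= l -> B.+1 ^ k <= B.+1 ^ l by move=> ?; rewrite leq_pexp2l.
elim: c => [|a i e|a i e|c1 [C1 H1] c2 [C2 H2]|b c1 [C1 H1] c2 [C2 H2]
           |b c1 [C1 H1]] /=.
- by exists 1 => B; rewrite expn0.
- by exists (ncost i + ncost e).+1 => B; rewrite expn0 muln1.
- by exists (ncost i + kcost e).+1 => B; rewrite expn0 muln1.
- exists (C1 + C2) => B; rewrite mulnDl leq_add //.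
    by rewrite (leq_trans (H1 B)) // leq_mul // up // leq_maxl.
  by rewrite (leq_trans (H2 B)) // leq_mul // up // leq_maxr.
- exists ((bcost b).+1 + (C1 + C2)) => B; rewrite -addSn !mulnDl !leq_add //.
  + by rewrite leq_pmulr // expn_gt0.
  + by rewrite (leq_trans (H1 B)) // leq_mul // up // leq_maxl.
  + by rewrite (leq_trans (H2 B)) // leq_mul // up // leq_maxr.
- exists ((bcost b).+1 + C1 + (bcost b).+1) => B; rewrite !mulnDl.
  have p0 : 0 < B.+1 ^ loop_depth c1 by rewrite expn_gt0.
  rewrite expnS -addSn mulnDr; apply: leq_add; first apply: leq_add.
  + rewrite mulnC leq_mul // (leq_trans (leqnSn B)) //.
    by rewrite leq_pmulr.
  + rewrite (leq_trans (leq_mul (leqnSn B) (H1 B))) //.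
    by rewrite mulnCA.
  + by rewrite leq_pmulr // muln_gt0.
Qed.

Section Hoare.
Variables (K : fieldType) (B : nat).
Implicit Types (st : state K) (c : cmd) (Q : state K -> Prop).

(** What a run leaves alone is read off the program text; this replaces
    invariants about the arrays that a loop does not write. *)
Definition frame c st st' : Prop :=
  (forall a i, a \notin nwrites c -> nmem st' a i = nmem st a i) /\
  (forall a i, a \notin kwrites c -> kmem st' a i = kmem st a i).

Lemma frame_refl c st : frame c st st.
Proof. by split. Qed.

Lemma frame_trans c st1 st2 st3 :
  frame c st1 st2 -> frame c st2 st3 -> frame c st1 st3.
Proof.
move=> [n1 k1] [n2 k2]; split=> a i ha.
  by rewrite n2 // n1.
by rewrite k2 // k1.
Qed.

Lemma frame_sub c c' st st' :
  {subset nwrites c <= nwrites c'} -> {subset kwrites c <= kwrites c'} ->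
  frame c st st' -> frame c' st st'.
Proof.
by move=> sn sk [n k]; split=> a i ha; [apply: n|apply: k];
  apply: contra ha; [apply: sn|apply: sk].
Qed.

Lemma exec_frame c st st' t : exec c st st' t -> frame c st st'.
Proof.
elim=> {c st st' t} /=.
- by move=> st; apply: frame_refl.
- move=> st a i e; split=> //= b j; rewrite inE => /negbTE hb.
  by rewrite /upd hb.
- move=> st a i e; split=> //= b j; rewrite inE => /negbTE hb.
  by rewrite /upd hb.
- move=> c1 c2 st1 st2 st3 _ _ _ h1 _ h2; apply: frame_trans.
    by apply: frame_sub h1 => a /=; rewrite mem_cat => ->.
  by apply: frame_sub h2 => a /=; rewrite mem_cat orbC => ->.
- move=> b c1 c2 st st' _ _; case: ifP => _ h.
    by apply: frame_sub h => a /=; rewrite mem_cat => ->.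
  by apply: frame_sub h => a /=; rewrite mem_cat orbC => ->.
- by move=> b c st _; apply: frame_refl.
- by move=> b c st1 st2 st3 _ _ _ _ h1 _ h2; apply: frame_trans h2.
Qed.

(** The initial state is fixed rather than described by a precondition, so that
    a specification can refer to its contents. The cost is always compared with
    the syntactic bound, so that costs need no bookkeeping in the proofs: it is
    enough that every loop makes at most [B] iterations. *)
Definition triple st c Q : Prop :=
  exists st' t, [/\ exec c st st' t, Q st' & t <= cost_bound B c].

Lemma triple_post st c Q Q' :
  triple st c Q -> (forall st', frame c st st' -> Q st' -> Q' st') ->
  triple st c Q'.
Proof.
move=> [st' [t [e q l]]] h; exists st', t; split=> //.
by apply: h => //; apply: exec_frame e.
Qed.

Lemma triple_skip st Q : Q st -> triple st Skip Q.
Proof. by move=> q; exists st, 1; split=> //; constructor. Qed.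

Lemma triple_nstore st a i e Q :
  Q (State (upd (nmem st) a (neval st i) (neval st e)) (kmem st)) ->
  triple st (NStore a i e) Q.
Proof.
by move=> q; eexists _, _; split; [apply: exec_nstore|exact: q|].
Qed.

Lemma triple_kstore st a i e Q :
  Q (State (nmem st) (upd (kmem st) a (neval st i) (keval st e))) ->
  triple st (KStore a i e) Q.
Proof.
by move=> q; eexists _, _; split; [apply: exec_kstore|exact: q|].
Qed.

Lemma triple_seq st c1 c2 Q :
  triple st c1 (fun st1 => triple st1 c2 Q) -> triple st (Seq c1 c2) Q.
Proof.
move=> [st1 [t1 [e1 [st2 [t2 [e2 q l2]]] l1]]].
exists st2, (t1 + t2); split=> //=; first exact: exec_seq e1 e2.
exact: leq_add.
Qed.

Lemma triple_if st b c1 c2 Q :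
  (beval st b -> triple st c1 Q) -> (~~ beval st b -> triple st c2 Q) ->
  triple st (If b c1 c2) Q.
Proof.
move=> h1 h2.
have [st' [t [e q l]]] : exists st' t,
    [/\ exec (if beval st b then c1 else c2) st st' t, Q st'
      & t <= cost_bound B c1 + cost_bound B c2].
  case: ifP => hb.
    have [st' [t [e q l]]] := h1 hb; exists st', t; split=> //.
    by rewrite (leq_trans l) // leq_addr.
  have [st' [t [e q l]]] := h2 (negbT hb); exists st', t; split=> //.
  by rewrite (leq_trans l) // leq_addl.
exists st', (bcost b + t).+1; split=> //=; first exact: exec_if.
by rewrite ltnS leq_add2l.
Qed.
End Hoare.

(** Scalars are kept at index 0 of an array of their own. *)
Notation var a := (NLoad a (NConst 0)).

Definition For (x : nat) (hi : nexp) (c : cmd) : cmd :=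
  Seq (NStore x (NConst 0) (NConst 0))
      (While (BNot (BNle hi (var x)))
             (Seq c (NStore x (NConst 0) (NAdd (var x) (NConst 1))))).

Definition set_var (K : fieldType) (st : state K) x v : state K :=
  State (upd (nmem st) x 0 v) (kmem st).

(** The invariant is asked to ignore the loop variable, so that it survives
    both the initialization and the increments of that variable. It has to
    describe only the arrays that the body writes: the frame gives the others. *)
Lemma triple_for (K : fieldType) B (st : state K) x hi c hv
    (I : nat -> state K -> Prop) :
  hv <= B -> x \notin nwrites c ->
  (forall st', frame (For x hi c) st st' -> neval st' hi = hv) ->
  (forall j st' v, I j st' -> I j (set_var st' x v)) ->
  I 0 st ->
  (forall j st', j < hv -> frame (For x hi c) st st' -> nmem st' x 0 = j ->
     I j st' -> triple B st' c (I j.+1)) ->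
  triple B st (For x hi c) (I hv).
Proof.
move=> leB hx hhi stab I0 step; set W := For x hi c.
have fset st' v : frame W st st' -> frame W st (set_var st' x v).
  move=> [fn fk]; split=> //= a i ha; rewrite /upd.
  rewrite ifF ?fn //; apply: contraNF ha => /andP[/eqP-> _].
  by rewrite inE eqxx.
apply: triple_seq; apply: triple_nstore => /=.
set st0 := State _ _; rewrite -/(set_var st x 0) in st0 *.
set b0 := BNot _; set inc := NStore x _ (NAdd _ _).
have main : forall k j st', j + k = hv -> frame W st st' -> nmem st' x 0 = j ->
    I j st' -> exists st'' t,
  [/\ exec (While b0 (Seq c inc)) st' st'' t, I hv st'' &
      t <= k * (bcost b0 + cost_bound B (Seq c inc)).+1 + (bcost b0).+1].
  elim=> [|k IH] j st' hjk hf hj hI.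
    exists st', (bcost b0).+1; split=> //.
      by apply: exec_while_false; rewrite /= negbK hhi // hj -hjk addn0.
    by rewrite -hjk addn0.
  have ltj : j < hv by rewrite -hjk addnS ltnS leq_addr.
  have [st1 [t1 [e1 I1 l1]]] := step _ _ ltj hf hj hI.
  have hj1 : nmem st1 x 0 = j by have [-> //] := exec_frame e1.
  have hf1 : frame W st st1.
    apply: frame_trans hf _; apply: frame_sub (exec_frame e1) => a /=.
      by rewrite inE mem_cat => ->; rewrite orbT.
    by rewrite cats0.
  have [|||st2 [t2 [e2 I2 l2]]] := IH j.+1 (set_var st1 x j.+1) _ (fset _ _ hf1).
  - by rewrite addSnnS.
  - by rewrite /= /upd !eqxx.
  - exact: stab.
  exists st2, (bcost b0 + (t1 + cost_bound B inc) + t2).+1; split=> //.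
    apply: exec_while_true (exec_seq e1 (exec_nstore _ _ _ _)) _.
      by rewrite /= -ltnNge hhi // hj.
    by rewrite /= hj1 addn1.
  by move: l1 l2 => /=; lia.
have [|||st1 [t [e I1 l]]] := main hv 0 st0 (add0n _).
- by apply: fset; apply: frame_refl.
- by rewrite /= /upd !eqxx.
- exact: stab.
exists st1, t; split=> //; apply: leq_trans l _ => /=.
by rewrite leq_add2r leq_mul2r leB orbT.
Qed.

(** * Vertices of polyhedra *)

Section Vertex.
Local Open Scope ring_scope.
Variable R : realFieldType.

(** While the tight constraints leave a direction free, moving along it until
    a new constraint becomes tight keeps the old ones tight; such a step
    exists because the polyhedron contains no line. *)
Lemma polyhedron_vertex p N (G : 'M[R]_(p, N)) (h : 'cV[R]_p) (w : 'cV[R]_N) :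
  (forall v : 'cV[R]_N, G *m v = 0 -> v = 0) ->
  (forall i, h i 0 <= (G *m w) i 0) ->
  exists w' : 'cV[R]_N, (forall i, h i 0 <= (G *m w') i 0) /\
    forall v : 'cV[R]_N,
      (forall i, (G *m w') i 0 = h i 0 -> (G *m v) i 0 = 0) -> v = 0.
Proof.
move=> noline.
have [k] := ubnP #|[set i | (G *m w) i 0 != h i 0]|.
elim: k w => // k IH w; rewrite ltnS => hk feas.
(* The tight rows of [G], the others being zeroed. *)
pose T := \matrix_(i, j) (if (G *m w) i 0 == h i 0 then G i j else 0).
have Tv (v : 'cV[R]_N) i :
    (T *m v) i 0 = if (G *m w) i 0 == h i 0 then (G *m v) i 0 else 0.
  rewrite !mxE; case: ifP => ti.
    by apply: eq_bigr => j _; rewrite mxE !mxE in ti *; rewrite ti.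
  by apply: big1 => j _; rewrite mxE !mxE in ti *; rewrite ti mul0r.
have [k0|] := eqVneq (kermx T^T) 0.
  exists w; split=> // v hv.
  suff: (v^T <= kermx T^T)%MS.
    by rewrite k0 submx0 => /eqP/(congr1 trmx); rewrite trmxK trmx0.
  apply/sub_kermxP; rewrite -trmx_mul; apply/matrixP => i j.
  by rewrite mxE ord1 Tv [RHS]mxE; case: eqP => // ti; apply: hv.
case/rowV0Pn => u /sub_kermxP uT u0.
have [v v0 Tv0] : exists2 v : 'cV[R]_N, v != 0 & T *m v = 0.
  exists u^T; first by apply: contra u0 => /eqP/(congr1 trmx); rewrite trmxK trmx0 => ->.
  by apply: trmx_inj; rewrite trmx_mul trmxK uT trmx0.
have tight (x : 'cV[R]_N) (hx : T *m x = 0) i : (G *m w) i 0 = h i 0 -> (G *m x) i 0 = 0.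
  by move=> /eqP ti; have := Tv x i; rewrite hx ti mxE => <-.
have [x [Tx [i0 xi0]]] : exists x : 'cV[R]_N, T *m x = 0 /\ exists i, (G *m x) i 0 < 0.
  have /existsP[i gi] : [exists i, (G *m v) i 0 != 0].
    apply: contraR v0; rewrite negb_exists => /forallP h0.
    apply/eqP/noline/matrixP => i j; rewrite ord1 [RHS]mxE.
    by apply/eqP; have := h0 i; rewrite negbK.
  case: (ltgtP ((G *m v) i 0) 0) gi => // gi _; first by exists v; split=> //; exists i.
  exists (- v); split; first by rewrite mulmxN Tv0 oppr0.
  by exists i; rewrite mulmxN mxE oppr_lt0.
(* Along [x], constraint [i] becomes tight after a step of length [F i]. *)
pose F i := ((G *m w) i 0 - h i 0) / - (G *m x) i 0.
case: (@Order.TotalTheory.arg_minP _ _ _ i0 (fun i => (G *m x) i 0 < 0) F xi0).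
move=> i1 xi1 min1.
have F0 : 0 <= F i1 by rewrite divr_ge0 ?subr_ge0 ?oppr_ge0 // ltW.
have Gw' i : (G *m (w + F i1 *: x)) i 0 = (G *m w) i 0 + F i1 * (G *m x) i 0.
  by rewrite mulmxDr -scalemxAr !mxE.
apply: (IH (w + F i1 *: x)) => [|i].
  apply: leq_trans hk; apply: proper_card; apply/properP; split.
    apply/subsetP => i; rewrite !inE Gw'; apply: contra => /eqP ti.
    by rewrite (tight x Tx i ti) mulr0 addr0 ti.
  exists i1; rewrite !inE.
    by apply/eqP => /(tight x Tx) z; rewrite z ltxx in xi1.
  rewrite negbK Gw' /F; apply/eqP.
  have : (G *m x) i1 0 != 0 by rewrite lt_eqF.
  by move=> nz; field.
rewrite Gw'; case: (ltP ((G *m x) i 0) 0) => gi.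
  have := min1 _ gi; rewrite {2}/F ler_pdivlMr ?oppr_gt0 // mulrN.
  lra.
by have := feas i; have := mulr_ge0 F0 gi; lra.
Qed.
End Vertex.

(** * Short zero-sum subfamilies *)

Section Steinitz.
Local Open Scope ring_scope.
Variable R : realFieldType.

(** Basic feasible solutions: at a vertex of the polytope, the fractional
    coordinates are linearly independent modulo the [q] equations. *)
Lemma few_fractional q N (E : 'M[R]_(q, N)) (b : 'cV[R]_q) (ub x : 'cV[R]_N) :
  (forall i, 0 <= x i 0 <= ub i 0) -> E *m x = b ->
  exists y : 'cV[R]_N, [/\ forall i, 0 <= y i 0 <= ub i 0, E *m y = b
    & (#|[set i | (0 < y i 0 < ub i 0)%R]| <= q)%N].
Proof.
move=> xb xE.
(* The rows say [0 <= x], [- ub <= - x], [b <= E x] and [- b <= - E x]. *)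
pose G := col_mx 1%:M (col_mx (- 1%:M) (col_mx E (- E))).
pose h := col_mx (0 : 'cV[R]_N) (col_mx (- ub) (col_mx b (- b))).
have Gv (v : 'cV[R]_N) : G *m v = col_mx v (col_mx (- v) (col_mx (E *m v) (- (E *m v)))).
  by rewrite !mul_col_mx !mulNmx !mul1mx.
have [|i|y [yf yv]] := @polyhedron_vertex R _ _ G h x.
- by move=> v; rewrite Gv -[RHS]col_mx0 => /eq_col_mx[].
- rewrite Gv /h -xE; case: (split_ordP i) => {}i ->; rewrite ?(col_mxEu, col_mxEd).
    by rewrite mxE; case/andP: (xb i).
  case: (split_ordP i) => {}i ->; rewrite ?(col_mxEu, col_mxEd).
    by rewrite !mxE lerN2; case/andP: (xb i).
  exact: lexx.
have yE : E *m y = b.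
  apply/matrixP => i j; rewrite ord1; apply/le_anti/andP; split.
    have := yf (rshift _ (rshift _ (rshift _ i))).
    by rewrite Gv /h !col_mxEd mxE [leRHS]mxE lerN2.
  have := yf (rshift _ (rshift _ (lshift _ i))).
  by rewrite Gv /h !col_mxEd !col_mxEu.
exists y; split=> //.
  move=> i; have := yf (lshift _ i); rewrite Gv /h !col_mxEu mxE => ->.
  have := yf (rshift _ (lshift _ i)).
  by rewrite Gv /h !col_mxEd !col_mxEu mxE [leRHS]mxE lerN2.
(* Otherwise the equations have a nonzero solution [v] supported on the
   fractional coordinates, and all tight constraints vanish on it. *)
rewrite leqNgt; apply/negP => ltq; set Fr := [set i | _] in ltq.
pose Z := \matrix_(k < #|Fr|, r < q) E r (enum_val k).
have : kermx Z != 0.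
  by rewrite -mxrank_eq0 mxrank_ker subn_eq0 -ltnNge (leq_ltn_trans _ ltq) // rank_leq_col.
case/rowV0Pn => u /sub_kermxP uZ /negP[].
pose v : 'cV[R]_N := \col_i \sum_(k < #|Fr|) (if enum_val k == i then u 0 k else 0).
have vF i : i \notin Fr -> v i 0 = 0.
  move=> hi; rewrite mxE big1 // => k _; case: eqP => // ki.
  by rewrite -ki enum_valP in hi.
have vk k : v (enum_val k) 0 = u 0 k.
  rewrite mxE (bigD1 k) //= eqxx big1 ?addr0 // => k' nk.
  by rewrite (inj_eq enum_val_inj) (negbTE nk).
have Ev : E *m v = 0.
  apply/matrixP => r j; rewrite ord1 mxE [RHS]mxE.
  transitivity ((u *m Z) 0 r); last by rewrite uZ mxE.
  rewrite mxE (bigID [in Fr]) /= [X in _ + X]big1 => [|i hi]; last by rewrite vF ?mulr0.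
  rewrite addr0 big_enum_val; apply: eq_bigr => k _.
  by rewrite vk mulrC !mxE.
suff v0 : v = 0.
  by apply/eqP/matrixP => i k; rewrite ord1 -vk v0 !mxE.
apply: yv => i; rewrite !Gv Ev /h.
case: (split_ordP i) => {}i ->; rewrite ?(col_mxEu, col_mxEd).
  rewrite [_ 0 i 0]mxE => y0; apply: vF; by rewrite inE y0 ltxx.
case: (split_ordP i) => {}i ->; rewrite ?(col_mxEu, col_mxEd).
  rewrite mxE [RHS]mxE => /oppr_inj y0.
  by rewrite mxE vF ?oppr0 // inE y0 ltxx andbF.
move=> _; case: (split_ordP i) => {}i ->; rewrite ?(col_mxEu, col_mxEd) !mxE //.
by rewrite oppr0.
Qed.

Variables (n N : nat) (V : 'M[R]_(n, N)).
Hypothesis V0 : V *m (const_mx 1 : 'cV[R]_N) = 0.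

(** In a good set [J], the family summed over [J] is as small as if [J] had at
    most [n] elements: it is also the sum with the weights [1 - x i], whose
    total is [n]. *)
Definition good (J : {set 'I_N}) : Prop :=
  (#|J| <= n)%N \/ exists x : 'cV[R]_N,
    [/\ forall i, 0 <= x i 0 <= (i \in J)%:R, V *m x = 0
      & \sum_i x i 0 = #|J|%:R - n%:R].

(** The family has sum zero, so constant weights do. *)
Lemma good_setT : good setT.
Proof.
case: (leqP #|[set: 'I_N]| n) => hn; first by left.
have N0 : (0 < N)%N by rewrite cardsT card_ord in hn; apply: leq_trans hn.
right; exists (const_mx (1 - n%:R / N%:R)); split.
- move=> i; rewrite mxE inE subr_ge0 ler_pdivrMr ?ltr0n // mul1r ler_nat.
  rewrite cardsT card_ord in hn; rewrite ltnW //=.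
  by rewrite gerBl divr_ge0.
- have -> : const_mx (1 - n%:R / N%:R) = (1 - n%:R / N%:R) *: (const_mx 1 : 'cV[R]_N).
    by apply/matrixP => i j; rewrite !mxE mulr1.
  by rewrite -scalemxAr V0 scaler0.
- under eq_bigr do rewrite mxE.
  rewrite sumr_const cardsT !card_ord -[LHS]mulr_natr mulrBl mul1r divfK //.
  by rewrite pnatr_eq0 -lt0n.
Qed.

(** Shrink the weights so that their total drops by one. At a vertex at most
    [n.+1] of them are fractional, so all of them being positive would make
    the total too large; an element of weight zero can be removed. *)
Lemma good_step (J : {set 'I_N}) :
  good J -> J != set0 -> exists2 i, i \in J & good (J :\ i).
Proof.
move=> gJ J0; have cJ i : i \in J -> #|J| = #|J :\ i|.+1 by move=> iJ; rewrite (cardsD1 i J) iJ.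
have /set0Pn[i0 i0J] := J0.
case: (leqP #|J| n.+1) => hn.
  by exists i0 => //; left; rewrite -ltnS -cJ.
case: gJ => [|[x [xb Vx sx]]]; first by rewrite leqNgt (leq_trans _ hn).
pose k : R := #|J|%:R - n%:R.
have k1 : 1 < k by rewrite ltrBrDl natr1 ltr_nat.
pose E := col_mx V (const_mx 1 : 'rV[R]_N).
pose ub : 'cV[R]_N := \col_i (i \in J)%:R.
have ubE i : ub i 0 = (i \in J)%:R by rewrite mxE.
have Ex (y : 'cV[R]_N) : E *m y = col_mx (V *m y) (const_mx (\sum_i y i 0)).
  rewrite mul_col_mx; congr col_mx; apply/matrixP => i j; rewrite mxE [RHS]mxE.
  by rewrite !ord1; apply: eq_bigr => l _; rewrite mxE mul1r.
have [||y [yb yE hF]] := @few_fractional _ _ E (col_mx 0 (const_mx (k - 1))) ub (((k - 1) / k) *: x).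
- move=> i; rewrite ubE mxE; have /andP[x0 x1] := xb i.
  have c0 : 0 <= (k - 1) / k by rewrite divr_ge0 //; lra.
  have c1 : (k - 1) / k <= 1 by rewrite ler_pdivrMr; lra.
  by rewrite mulr_ge0 //= (le_trans _ x1) // ler_piMl.
- rewrite Ex -scalemxAr Vx scaler0; congr col_mx; congr const_mx.
  under eq_bigr do rewrite mxE.
  by rewrite -mulr_sumr sx -/k divfK //; apply/eqP; lra.
move: yE; rewrite Ex => /eq_col_mx[Vy /(congr1 (fun A : 'M_1 => A 0 0))].
rewrite !mxE => sy.
have [i iJ yi] : exists2 i, i \in J & y i 0 = 0.
  have [/exists_inP[i iJ /eqP yi]|] := boolP [exists i in J, y i 0 == 0]; first by exists i.
  rewrite negb_exists_in => /forall_inP pos0.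
  have pos i : i \in J -> 0 < y i 0.
    by move=> iJ; rewrite lt_neqAle eq_sym pos0 //=; case/andP: (yb i).
  set Fr := [set i | _] in hF.
  have FJ i : i \in Fr -> i \in J.
    by rewrite inE ubE; case: (i \in J) => //= /andP[/lt_trans h/h]; rewrite ltxx.
  have sF : \sum_(i in Fr) y i 0 = #|Fr|%:R - n.+1%:R.
    have : \sum_i y i 0 = \sum_(i in Fr) y i 0 + (#|J|%:R - #|Fr|%:R).
      rewrite (bigID [in Fr]) /=; congr +%R.
      rewrite (bigID [in J]) /= [X in _ + X]big1 => [|i /andP[_ niJ]]; last first.
        by apply/le_anti; have := yb i; rewrite ubE (negbTE niJ) andbC.
      rewrite addr0 (eq_bigr (fun=> 1)) => [|i /andP[iF iJ]]; last first.
        apply/le_anti; have := yb i; rewrite ubE iJ => /andP[_ ->] /=.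
        by move: iF; rewrite inE ubE iJ pos //= -leNgt.
      rewrite sumr_const -natrB; last by apply: subset_leq_card; apply/subsetP.
      congr (_%:R); rewrite -cardsDS; last exact/subsetP.
      by apply: eq_card => i; rewrite [RHS]in_setD.
    by rewrite sy /k -(natr1 n); lra.
  have s0 : \sum_(i in Fr) y i 0 = 0.
    apply/le_anti; rewrite {1}sF subr_le0 ler_nat -[n.+1]addn1 hF /=.
    by apply: sumr_ge0 => i _; case/andP: (yb i).
  have [F0|[i iF]] := set_0Vmem Fr.
    move: sF; rewrite F0 big_set0 cards0 => /eqP; rewrite eq_sym sub0r oppr_eq0.
    by rewrite pnatr_eq0.
  have /(_ i iF)/eqP := psumr_eq0P (fun i _ => proj1 (andP (yb i))) s0.
  by rewrite gt_eqF // pos // FJ.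
exists i => //; right; exists y; split=> //.
- move=> j; have := yb j; rewrite ubE !inE; case: eqP => [->|] //.
  by rewrite yi lexx.
- by rewrite sy /k (cJ _ iJ) -natr1; lra.
Qed.

Lemma good_bound (d : R) (J : {set 'I_N}) :
  0 <= d -> (forall r i, `|V r i| <= d) -> good J ->
  forall r, `|\sum_(i in J) V r i| <= n%:R * d.
Proof.
move=> d0 Vd [hJ|[x [xb Vx sx]]] r.
  apply: le_trans (ler_norm_sum _ _ _) _.
  apply: le_trans (ler_sum _ (fun i _ => Vd r i)) _.
  by rewrite sumr_const -[leLHS]mulr_natl ler_wpM2r // ler_nat.
have x0 i : i \notin J -> x i 0 = 0.
  by move=> niJ; apply/le_anti; have := xb i; rewrite (negbTE niJ) andbC.
have -> : \sum_(i in J) V r i = \sum_(i in J) V r i * (1 - x i 0).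
  under [RHS]eq_bigr do rewrite mulrBr mulr1.
  rewrite sumrB; suff -> : \sum_(i in J) V r i * x i 0 = 0 by rewrite subr0.
  transitivity ((V *m x) r 0); last by rewrite Vx mxE.
  rewrite mxE [RHS](bigID [in J]) /= [X in _ + X]big1 ?addr0 // => i /x0 ->.
  by rewrite mulr0.
apply: le_trans (ler_norm_sum _ _ _) _.
have le1 i : i \in J -> `|V r i * (1 - x i 0)| <= d * (1 - x i 0).
  move=> iJ; have := xb i; rewrite iJ => /andP[_ x1].
  by rewrite normrM [X in _ * X]ger0_norm ?subr_ge0 // ler_wpM2r ?subr_ge0.
apply: le_trans (ler_sum _ le1) _.
rewrite -mulr_sumr mulrC ler_wpM2r // sumrB sumr_const.
move: sx; rewrite [X in X = _](bigID [in J]) /= [X in _ + X]big1 ?addr0 => [->|i /x0 //].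
by rewrite subKr.
Qed.
End Steinitz.

(** This is the argument of Steinitz: removing the elements one at a time gives
    a chain of good sets. It has more members than there are vectors in the box
    of radius [n * d], so two members have the same sum; their difference sums
    to zero. *)
Lemma zero_sum_subset (n N d : nat) (v : 'I_N -> 'I_n -> int) :
  ((2 * n * d).+1 ^ n < N)%N ->
  (forall i k, `|v i k| <= d)%N -> (forall k, \sum_i v i k = 0)%R ->
  exists J : {set 'I_N}, [/\ J != set0, J != setT &
    forall k, (\sum_(i in J) v i k = 0)%R].
Proof.
move=> hN vd v0.
pose V : 'M[rat]_(n, N) := (\matrix_(k, i) (v i k)%:~R)%R.
have V0 : (V *m (const_mx 1 : 'cV[rat]_N) = 0)%R.
  apply/matrixP => k j; rewrite !mxE.
  under eq_bigr do rewrite !mxE mulr1.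
  by rewrite -rmorph_sum /= v0.
have sV (J : {set 'I_N}) k : (\sum_(i in J) V k i = (\sum_(i in J) v i k)%:~R)%R.
  by rewrite rmorph_sum /=; apply: eq_bigr => i _; rewrite mxE.
have bound J : good V J -> forall k, (`|\sum_(i in J) v i k| <= (n * d)%N%:Z)%R.
  move=> gJ k; have := @good_bound _ _ _ V d%:R J (ler0n _ _) _ gJ k.
  rewrite sV -natrM -intr_norm -[(_ * _)%:R%R]/((n * d)%N%:Z%:~R)%R ler_int; apply.
  by move=> r i; rewrite mxE -intr_norm -[d%:R%R]/(d%:Z%:~R)%R ler_int -abszE lez_nat.
have chain k : k <= N -> exists J : nat -> {set 'I_N},
    (forall l, l <= k -> #|J l| = N - l /\ good V (J l)) /\
    (forall l, l < k -> J l.+1 \subset J l).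
  elim: k => [_|k IH ltk].
    exists (fun=> setT); split=> // l; rewrite leqn0 => /eqP->.
    by rewrite cardsT card_ord subn0; split=> //; apply: good_setT.
  have [J [gJ sJ]] := IH (ltnW ltk); have [cJk gJk] := gJ k (leqnn k).
  have [|i iJ gJi] := good_step gJk.
    by rewrite -card_gt0 cJk subn_gt0.
  exists (fun l => if l == k.+1 then J k :\ i else J l); split=> l.
    rewrite leq_eqVlt; case: eqP => /= [-> _|_ /gJ //]; split=> //.
    by have := cardsD1 i (J k); rewrite iJ cJk subnS add1n => ->.
  rewrite ltnS leq_eqVlt eqSS; case: eqP => /= [->|_ lk].
    by move=> _; rewrite ltn_eqF // subsetDl.
  by rewrite ltn_eqF ?sJ // ltnW.
have [J [gJ sJ]] := chain N (leqnn N).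
have sub l l' : l <= l' -> l' <= N -> J l' \subset J l.
  move=> /subnKC <-; elim: (l' - l) => [|e IH]; rewrite ?addn0 ?addnS // => h.
  by apply: subset_trans (IH (ltnW h)); apply: sJ.
pose f (l : 'I_N) : {ffun 'I_n -> 'I_(2 * n * d).+1} :=
  [ffun k => inord `|(\sum_(i in J l) v i k + (n * d)%:Z)%R|].
have /injectivePn[l1 [l2 nl fl]] : ~~ injectiveb f.
  apply/negP => /injectiveP/leq_card.
  by rewrite card_ffun !card_ord leqNgt hN.
have eqs k : (\sum_(i in J l1) v i k = \sum_(i in J l2) v i k)%R.
  have b1 := bound _ (proj2 (gJ l1 (ltnW (ltn_ord _)))) k.
  have b2 := bound _ (proj2 (gJ l2 (ltnW (ltn_ord _)))) k.
  have := congr1 (fun g : {ffun _ -> _} => val (g k)) fl.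
  rewrite !ffunE /=; move: b1 b2; rewrite -mulnA.
  move: (\sum_(i in J l1) _)%R (\sum_(i in J l2) _)%R (n * d)%N => x y e.
  by rewrite !ler_norml => /andP[? ?] /andP[? ?]; rewrite !inordK; lia.
wlog lt12 : l1 l2 nl eqs {fl} / l1 < l2.
  move=> H; case: (ltngtP l1 l2) (nl) => [lt _|lt _|/val_inj->]; first exact: (H l1 l2).
    by apply: (H l2 l1) => //; rewrite eq_sym.
  by rewrite eqxx.
have s21 := sub _ _ (ltnW lt12) (ltnW (ltn_ord l2)).
have [c1 _] := gJ l1 (ltnW (ltn_ord _)); have [c2 _] := gJ l2 (ltnW (ltn_ord _)).
exists (J l1 :\: J l2); split.
- rewrite -card_gt0 cardsDS // c1 c2; have := ltn_ord l2; lia.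
- apply/eqP => e; have : J l2 != set0 by rewrite -card_gt0 c2 subn_gt0.
  by case/set0Pn => i i2; have := in_setT i; rewrite -e inE i2.
- move=> k; rewrite (eq_bigl (fun i => (i \in J l1) && (i \notin J l2))); last first.
    by move=> i; rewrite inE andbC.
  have e : (\sum_(i in J l1 | i \in J l2) v i k = \sum_(i in J l2) v i k)%R.
    by apply: eq_bigl => i; case i2: (i \in J l2); rewrite ?andbF // (subsetP s21).
  have := eqs k; rewrite (bigID [in J l2]) /= e => /eqP.
  by rewrite -subr_eq0 addrAC subrr add0r => /eqP.
Qed.

(** * Small weight vectors *)

Section Weights.
Local Open Scope ring_scope.

Lemma between (R : realFieldType) (L U : seq R) :
  (forall l u, l \in L -> u \in U -> l < u) ->
  exists x, (forall l, l \in L -> l < x) /\ (forall u, u \in U -> x < u).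
Proof.
have above l : (forall u, u \in U -> l < u) ->
    exists2 x, l < x & forall u, u \in U -> x < u.
  elim: U => [_|u U IH lU]; first by exists (l + 1); [lra|].
  have [x lx xU] := IH (fun u' h => lU u' (mem_behead (s := u :: U) h)).
  have lu := lU u (mem_head _ _).
  exists (Num.min x ((l + u) / 2)); first by rewrite lt_min lx; lra.
  move=> u'; rewrite inE gt_min => /predU1P[->|/xU->//].
  by apply/orP; right; lra.
elim: L => [_|l L IH LU].
  elim: U {above} => [|u U [x [_ xU]]]; first by exists 0.
  exists (Num.min x (u - 1)); split=> // u'; rewrite inE gt_min.
  by case/predU1P=> [->|/xU->//]; apply/orP; right; lra.
have [x [Lx xU]] : exists x, (forall l', l' \in L -> l' < x) /\ (forall u, u \in U -> x < u).
  by apply: IH => l' u hl; apply: LU; rewrite inE hl orbT.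
case: (ltP l x) => lx.
  by exists x; split=> // l'; rewrite inE => /predU1P[->|/Lx].
have [u hu|y ly yU] := above l; first exact: LU (mem_head _ _) hu.
exists y; split=> // l'; rewrite inE => /predU1P[->//|/Lx l'x].
exact: lt_trans l'x (le_lt_trans lx ly).
Qed.

(** Fourier-Motzkin elimination of the [m]-th coordinate: each pair of vectors
    with opposite signs there is replaced by its positive combination that
    vanishes there. *)
Lemma positive_functional n m (Pos : {ffun 'I_n -> int} -> Prop)
    (A : seq {ffun 'I_n -> int}) :
  (m <= n)%N ->
  (forall a b, Pos a -> Pos b -> Pos (a + b)) ->
  (forall a, Pos a -> exists2 k : 'I_n, (k < m)%N & a k != 0) ->
  (forall a, a \in A -> Pos a) ->
  exists w : 'I_n -> rat, forall a, a \in A -> 0 < \sum_k w k * (a k)%:~R.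
Proof.
elim: m Pos A => [|m IH] Pos A lemn addP nzP AP.
  by exists (fun=> 0) => a /AP/nzP[].
have mulP a k : Pos a -> (0 < k)%N -> Pos (a *+ k).
  move=> aP; elim: k => // -[_ _|k IHk _]; first by rewrite mulr1n.
  by rewrite mulrS; apply: addP => //; apply: IHk.
pose k0 := Ordinal lemn.
(* positive multiples of [a] and [b], as [a k0] and [- b k0] are positive *)
pose comb (a b : {ffun 'I_n -> int}) : {ffun 'I_n -> int} :=
  [ffun k => a k0 * b k - b k0 * a k].
pose A0 := [seq a : {ffun 'I_n -> int} <- A | a k0 == 0].
pose Ap := [seq a : {ffun 'I_n -> int} <- A | 0 < a k0].
pose An := [seq a : {ffun 'I_n -> int} <- A | a k0 < 0].
pose A' := A0 ++ allpairs comb Ap An.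
have ffE (a : {ffun 'I_n -> int}) p k : (a *+ p) k = a k *+ p.
  by elim: p => [|p IHp]; rewrite ?ffunE // !mulrS ffunE IHp.
have mE (x : int) p : x *+ p = p%:Z * x by rewrite -mulr_natl natz.
have combE (a b : {ffun 'I_n -> int}) : 0 < a k0 -> b k0 < 0 -> comb a b = b *+ `|a k0|%N + a *+ `|b k0|%N.
  move=> a0 b0; apply/ffunP => k; rewrite [RHS]ffunE !ffE ffunE !mE.
  by rewrite gtz0_abs // ltz0_abs // mulNr.
have [|a b [Pa a0] [Pb b0]|a []|a ha|w hw] := IH (fun a => Pos a /\ a k0 = 0) A'.
- exact: ltnW.
- by rewrite ffunE a0 b0; split=> //; apply: addP.
- move=> /nzP[k]; rewrite ltnS leq_eqVlt => /predU1P[km|km] ak a0.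
    by move: ak; rewrite (_ : k = k0) ?a0 //; apply: val_inj.
  by exists k.
- move: ha; rewrite mem_cat => /orP[|].
    by rewrite mem_filter => /andP[/eqP-> /AP].
  case/allpairsP=> -[x y] /=; rewrite !mem_filter => -[/andP[x0 /AP xP] /andP[y0 /AP yP] ->].
  split; last by rewrite ffunE mulrC subrr.
  by rewrite combE //; apply: addP; apply: mulP => //; rewrite absz_gt0 ?(gt_eqF x0) ?(lt_eqF y0).
pose r (a : {ffun 'I_n -> int}) : rat := \sum_(k | k != k0) w k * (a k)%:~R.
pose w' x k := if k == k0 then x else w k.
have w'E x (a : {ffun 'I_n -> int}) : \sum_k w' x k * (a k)%:~R = x * (a k0)%:~R + r a.
  rewrite (bigD1 k0) //= /w' eqxx; congr +%R; apply: eq_bigr => k /negbTE nk.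
  by rewrite nk.
have rw (a : {ffun 'I_n -> int}) : a k0 = 0 -> \sum_k w k * (a k)%:~R = r a.
  by move=> a0; rewrite (bigD1 k0) //= a0 mulr0 add0r.
have [l u|x [xL xU]] := @between _ [seq - r a / (a k0)%:~R | a : {ffun 'I_n -> int} <- Ap]
  [seq - r a / (a k0)%:~R | a : {ffun 'I_n -> int} <- An].
  case/mapP=> a; rewrite mem_filter => /andP[a0 aA] ->.
  case/mapP=> b; rewrite mem_filter => /andP[b0 bA] ->.
  have cA : comb a b \in A'.
    by rewrite mem_cat; apply/orP; right; apply: allpairs_f; rewrite mem_filter ?a0 ?b0.
  have := hw _ cA; rewrite rw; last by rewrite ffunE mulrC subrr.
  have -> : r (comb a b) = r b * (a k0)%:~R - r a * (b k0)%:~R.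
    rewrite /r !mulr_suml -sumrB; apply: eq_bigr => k _.
    by rewrite ffunE rmorphB !rmorphM /=; ring.
  have a0' : 0 < (a k0)%:~R :> rat by rewrite ltr0z.
  have b0' : (b k0)%:~R < 0 :> rat by rewrite ltrz0.
  rewrite ltr_pdivrMr // mulrAC ltr_ndivlMr //; lra.
exists (w' x) => a aA; rewrite w'E; case: (ltgtP (a k0) 0) => a0.
- have /xU : - r a / (a k0)%:~R \in [seq - r a / (a k0)%:~R | a : {ffun 'I_n -> int} <- An].
    by apply: map_f; rewrite mem_filter a0.
  by rewrite ltr_ndivlMr ?ltrz0 //; lra.
- have /xL : - r a / (a k0)%:~R \in [seq - r a / (a k0)%:~R | a : {ffun 'I_n -> int} <- Ap].
    by apply: map_f; rewrite mem_filter a0.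
  by rewrite ltr_pdivrMr ?ltr0z //; lra.
- by rewrite a0 mulr0 add0r -rw //; apply: hw; rewrite mem_cat mem_filter a0 eqxx aA.
Qed.

Lemma det_bound n (A : 'M[int]_n) (d : nat) :
  (forall i j, (`|A i j| <= d)%N) -> (`|\det A| <= n`! * d ^ n)%N.
Proof.
move=> Ad; rewrite -lez_nat abszE /determinant.
apply: le_trans (ler_norm_sum _ _ _) _.
apply: (@le_trans _ _ (\sum_(s : 'S_n) (d ^ n)%N%:Z)).
  apply: ler_sum => s _; rewrite normrM normrX normrN1 expr1n mul1r normr_prod.
  apply: (@le_trans _ _ (\prod_(i < n) d%:Z)).
    by apply: ler_prod => i _; rewrite normr_ge0 -abszE lez_nat Ad.
  by rewrite prodr_const card_ord -natz -natrX natz.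
by rewrite sumr_const card_Sn -mulr_natl natz -PoszM.
Qed.

(** The constraints that are tight at a vertex have full column rank, so [n] of
    them determine the vertex. *)
Lemma tight_square p n (G : 'M[rat]_(p, n)) (w : 'cV[rat]_n) :
  (forall v : 'cV[rat]_n,
      (forall i, (G *m w) i 0 = 1 -> (G *m v) i 0 = 0) -> v = 0) ->
  exists f : 'I_n -> 'I_p,
    rowsub f G \in unitmx /\ rowsub f G *m w = const_mx 1.
Proof.
move=> triv.
pose T := \matrix_(i, j) (if (G *m w) i 0 == 1 then G i j else 0).
have fT : row_full T.
  rewrite /row_full -mxrank_tr -/(row_free _) -kermx_eq0; apply: contraT => /rowV0Pn[u /sub_kermxP uT /negP[]].
  suff u0 : u^T = 0 by rewrite -[u]trmxK u0 trmx0.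
  apply: triv => i ti.
  transitivity ((u *m T^T) 0 i); last by rewrite uT mxE.
  rewrite mxE [RHS]mxE; apply: eq_bigr => j _.
  by rewrite mulrC !mxE; rewrite mxE in ti; rewrite ti eqxx.
pose f := fullrankfun fT; have uf : rowsub f T \in unitmx by apply: fullrowsub_unit.
have tight j : (G *m w) (f j) 0 = 1.
  apply/eqP; apply: contraT => nt.
  have := mulmxV uf => /matrixP/(_ j j); rewrite mxE big1 => [|k _].
    by rewrite mxE eqxx => /eqP; rewrite eq_sym oner_eq0.
  by rewrite mxE mxE (negbTE nt) mul0r.
exists f; split.
  rewrite (_ : rowsub f G = rowsub f T) //; apply/matrixP => i j.
  by rewrite !mxE; have := tight i; rewrite mxE => ->; rewrite eqxx.
apply/matrixP => i j; rewrite !mxE ord1 -(tight i) mxE.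
by apply: eq_bigr => k _; rewrite mxE.
Qed.

(** A system of strict inequalities solvable over the rationals has a solution
    with right-hand sides 1, hence one at a vertex; Cramer's rule bounds it. *)
Lemma bounded_weight n d (A : seq {ffun 'I_n -> int}) (w : 'I_n -> rat) :
  (forall a : {ffun 'I_n -> int}, a \in A -> forall k, (`|a k| <= d)%N) ->
  (forall k, [ffun j => (j == k)%:R] \in A) ->
  (forall a : {ffun 'I_n -> int}, a \in A -> 0 < \sum_k w k * (a k)%:~R) ->
  exists W : 'I_n -> nat, (forall k, (W k <= n`! * d ^ n.-1)%N) /\
    forall a : {ffun 'I_n -> int}, a \in A -> 0 < \sum_k (W k)%:Z * a k.
Proof.
move=> Ad unitA wA.
pose dot (a : {ffun 'I_n -> int}) := \sum_k w k * (a k)%:~R.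
(* a factor that raises all values of the functional to at least 1 *)
pose c := \sum_(a <- A) (dot a)^-1.
have c1 (a : {ffun 'I_n -> int}) : a \in A -> 1 <= c * dot a.
  move=> aA; rewrite -ler_pdivrMr ?wA // mul1r /c (big_rem a) //= lerDl.
  rewrite big_seq; apply: sumr_ge0 => b /mem_rem/wA.
  by rewrite invr_ge0 => /ltW.
pose a_ i := tnth (in_tuple A) i.
pose Gz := \matrix_(i < size A, k < n) (a_ i k).
pose G : 'M[rat]_(size A, n) := map_mx intr Gz.
have Gdot i (v : 'cV[rat]_n) : (G *m v) i 0 = \sum_k v k 0 * (a_ i k)%:~R.
  by rewrite mxE; apply: eq_bigr => k _; rewrite !mxE mulrC.
have idx (a : {ffun 'I_n -> int}) : a \in A -> exists i, a_ i = a.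
  by move=> /(tnthP (in_tuple A))[i ->]; exists i.
have unitE k (v : 'cV[rat]_n) :
    \sum_j v j 0 * ([ffun j => (j == k)%:R] j : int)%:~R = v k 0.
  rewrite (bigD1 k) //= ffunE eqxx mulr1 big1 ?addr0 // => j /negbTE nj.
  by rewrite ffunE nj mulr0.
have [v Gv|i|y [yf ytriv]] := @polyhedron_vertex _ _ _ G (const_mx 1) (\col_k (c * w k)).
- apply/matrixP => k j; rewrite ord1 [RHS]mxE -(unitE k v).
  by have [i <-] := idx _ (unitA k); rewrite -Gdot Gv mxE.
- rewrite Gdot mxE (le_trans (c1 _ (mem_tnth i (in_tuple A)))) //.
  by rewrite mulr_sumr ler_sum // => k _; rewrite mxE mulrA.
have [f [uf fy]] : exists f : 'I_n -> _,
    rowsub f G \in unitmx /\ rowsub f G *m y = const_mx 1.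
  by apply: tight_square => v hv; apply: ytriv => i; rewrite [RHS]mxE => /hv.
pose S := rowsub f Gz; pose z := \adj S *m const_mx 1 : 'cV[int]_n.
have SG : rowsub f G = map_mx intr S by apply/matrixP => i j; rewrite !mxE.
have zy k : (z k 0)%:~R = (\det S)%:~R * y k 0 :> rat.
  have : map_mx intr z = (\det S)%:~R *: y :> 'cV[rat]_n.
    rewrite /z map_mxM /= map_const_mx /= rmorph1 -fy SG mulmxA map_mx_adj.
    by rewrite mul_adj_mx mul_scalar_mx det_map_mx.
  by move/matrixP/(_ k 0); rewrite !mxE.
have y1 k : 1 <= y k 0.
  have [i ik] := idx _ (unitA k).
  by have := yf i; rewrite Gdot ik unitE mxE.
have det0 : \det S != 0.
  by move: uf; rewrite unitmxE SG det_map_mx unitfE intr_eq0.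
have zabs k : (absz (z k 0))%:Z%:~R = (absz (\det S))%:Z%:~R * y k 0 :> rat.
  by rewrite !abszE !intr_norm zy normrM [X in _ * X]ger0_norm // (le_trans ler01).
(* [z] is the determinant times the vertex, whose coordinates are positive. *)
exists (fun k => absz (z k 0)); split=> [k|a aA].
  have zk : (absz (z k 0%R) <= \sum_j absz (\adj S k j))%N.
    rewrite mxE; elim/big_ind2: _ => // [x p x' p' h h'|j _].
      by lia.
    by rewrite [const_mx _ _ _]mxE mulr1.
  apply: leq_trans zk _.
  have n0 : (0 < n)%N by apply: leq_trans (ltn_ord k).
  apply: (@leq_trans (\sum_(j < n) n.-1`! * d ^ n.-1)).
    apply: leq_sum => j _; rewrite mxE abszM abszX exp1n mul1n.
    by apply: det_bound => i l; rewrite !mxE Ad // mem_tnth.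
  rewrite sum_nat_const card_ord mulnA leq_mul2r; apply/orP; right.
  by case: (n) n0 => // n1 _; rewrite factS.
rewrite -(ltr_int rat) rmorph_sum /=.
under eq_bigr do rewrite rmorphM /= zabs -mulrA.
rewrite -mulr_sumr mulr_gt0 //.
  by rewrite ltr0z ltz_nat absz_gt0.
have [i <-] := idx _ aA; rewrite -Gdot (lt_le_trans ltr01) //.
by have := yf i; rewrite mxE.
Qed.
End Weights.

(** * Spans and dimensions *)

Section Span.
Local Open Scope ring_scope.
Variables (K : fieldType) (V : lmodType K).

Inductive lin_span (T : Type) (v : T -> V) (P : T -> Prop) : V -> Prop :=
| lin_span0 : lin_span v P 0
| lin_span_cons c t h : P t -> lin_span v P h -> lin_span v P (c *: v t + h).

Lemma lin_span_gen T (v : T -> V) (P : T -> Prop) t : P t -> lin_span v P (v t).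
Proof. by move=> Pt; have := lin_span_cons 1 Pt (lin_span0 v P); rewrite scale1r addr0. Qed.

Lemma lin_spanD T (v : T -> V) P h1 h2 : lin_span v P h1 -> lin_span v P h2 -> lin_span v P (h1 + h2).
Proof.
elim=> [|c t h Pt _ IH] h2P; first by rewrite add0r.
by rewrite -addrA; apply: lin_span_cons => //; apply: IH.
Qed.

Lemma lin_spanZ T (v : T -> V) P c h : lin_span v P h -> lin_span v P (c *: h).
Proof.
elim=> [|c' t h' Pt _ IH]; first by rewrite scaler0; apply: lin_span0.
by rewrite scalerDr scalerA; apply: lin_span_cons.
Qed.

Lemma lin_spanB T (v : T -> V) P h1 h2 : lin_span v P h1 -> lin_span v P h2 -> lin_span v P (h1 - h2).
Proof. by move=> p1 p2; apply: lin_spanD => //; rewrite -scaleN1r; apply: lin_spanZ. Qed.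

Lemma lin_span_trans T T' (v : T -> V) (v' : T' -> V) P P' h :
  (forall t, P t -> lin_span v' P' (v t)) -> lin_span v P h -> lin_span v' P' h.
Proof.
move=> sub; elim=> [|c t h' Pt _ IH]; first exact: lin_span0.
by apply: lin_spanD => //; apply/lin_spanZ/sub.
Qed.

Lemma lin_span_mono T (v : T -> V) (P P' : T -> Prop) h :
  (forall t, P t -> P' t) -> lin_span v P h -> lin_span v P' h.
Proof. by move=> sub; apply: lin_span_trans => t /sub; apply: lin_span_gen. Qed.

Lemma lin_span_sum T (v : T -> V) P (I : Type) (r : seq I) (Q : pred I) (F : I -> V) :
  (forall i, Q i -> lin_span v P (F i)) -> lin_span v P (\sum_(i <- r | Q i) F i).
Proof. by move=> h; elim/big_ind: _ => //; [apply: lin_span0|apply: lin_spanD]. Qed.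

Definition free_family r (bs : 'I_r -> V) : Prop :=
  forall x : 'I_r -> K, \sum_q x q *: bs q = 0 -> forall q, x q = 0.

Definition spanning r (bs : 'I_r -> V) (S : V -> Prop) : Prop :=
  forall h, S h -> exists x : 'I_r -> K, h = \sum_q x q *: bs q.

Definition has_dim (S : V -> Prop) (r : nat) : Prop :=
  exists bs : 'I_r -> V, [/\ forall q, S (bs q), spanning bs S & free_family bs].

(** The coordinates of the free family form a matrix with independent rows. *)
Lemma free_le_spanning (S : V -> Prop) r r' (bs : 'I_r -> V) (cs : 'I_r' -> V) :
  spanning bs S -> (forall j, S (cs j)) -> free_family cs -> (r' <= r)%N.
Proof.
move=> sp Scs fr.
have [x xE] := fin_all_exists (fun j => sp _ (Scs j)).
pose A := \matrix_(j, i) x j i.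
have : row_free A.
  rewrite -kermx_eq0; apply/rowV0P => u /sub_kermxP uA.
  apply/matrixP => i j; rewrite ord1 [RHS]mxE; apply: (fr (u 0)).
  under eq_bigr => k _ do rewrite xE scaler_sumr.
  rewrite exchange_big big1 //= => k _.
  under eq_bigr do rewrite scalerA.
  rewrite -scaler_suml; suff -> : \sum_l u 0 l * x l k = 0 by rewrite scale0r.
  transitivity ((u *m A) 0 k); last by rewrite uA mxE.
  by rewrite mxE; apply: eq_bigr => l _; rewrite mxE.
by move=> /eqP <-; apply: rank_leq_col.
Qed.

Lemma has_dim_unique S r r' : has_dim S r -> has_dim S r' -> r = r'.
Proof.
move=> [bs [Sb spb frb]] [cs [Sc spc frc]]; apply/anti_leq/andP; split.
  exact: free_le_spanning spc Sb frb.
exact: free_le_spanning spb Sc frc.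
Qed.

Lemma has_dim_ext (S S' : V -> Prop) r :
  (forall h, S h <-> S' h) -> has_dim S r -> has_dim S' r.
Proof.
move=> e [bs [Sb sp fr]]; exists bs; split=> // [q|h /e]; first exact/e.
exact: sp.
Qed.
End Span.

Lemma lin_span_mul (K : fieldType) (A : comAlgType K) (T1 T2 T3 : Type)
    (v1 : T1 -> A) (v2 : T2 -> A) (v3 : T3 -> A) P1 P2 P3 h1 h2 :
  (forall t1 t2, P1 t1 -> P2 t2 -> lin_span v3 P3 (v1 t1 * v2 t2)%R) ->
  lin_span v1 P1 h1 -> lin_span v2 P2 h2 -> lin_span v3 P3 (h1 * h2)%R.
Proof.
move=> mul s1 s2; elim: s1 => [|c t h Pt _ IH]; first by rewrite mul0r; apply: lin_span0.
rewrite mulrDl -scalerAl; apply: lin_spanD => //; apply: lin_spanZ.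
elim: s2 {IH} => [|c2 t2 h2' Pt2 _ IH]; first by rewrite mulr0; apply: lin_span0.
by rewrite mulrDr -scalerAr; apply: lin_spanD => //; apply/lin_spanZ/mul.
Qed.

(** * Term orders and initial monomials *)

Section TermOrder.
Local Open Scope ring_scope.
Variables (n : nat) (le : rel 'X_{1..n}).
Hypothesis tord : term_order le.

Definition lt_of (u v : 'X_{1..n}) : bool := le u v && (u != v).
Local Notation lt := lt_of.

Lemma to_refl u : le u u.
Proof. by have [tot _ _ _ _] := tord; have := tot u u; rewrite orbb. Qed.

Lemma to_anti u v : le u v -> le v u -> u = v.
Proof. by have [_ anti _ _ _] := tord => h1 h2; apply: anti; rewrite h1. Qed.

Lemma to_trans u v w : le u v -> le v w -> le u w.
Proof. by have [_ _ tr _ _] := tord; apply: tr. Qed.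

Lemma to_ltNle u v : lt u v = ~~ le v u.
Proof.
rewrite /lt; have [tot _ _ _ _] := tord.
case vu: (le v u); last by have := tot u v; rewrite vu orbF => -> /=; apply: contraFneq vu => ->; apply: to_refl.
by apply/negbTE; rewrite negb_and negbK; case uv: (le u v) => //=; rewrite (to_anti uv vu) eqxx.
Qed.

Lemma to_ltW u v : lt u v -> le u v.
Proof. by case/andP. Qed.

Lemma to_lt_trans u v w : lt u v -> le v w -> lt u w.
Proof.
rewrite !to_ltNle => uv vw; apply: contra uv => wu; exact: to_trans vw wu.
Qed.

Lemma to_le_trans u v w : le u v -> lt v w -> lt u w.
Proof.
rewrite !to_ltNle => uv vw; apply: contra vw => wu; exact: to_trans wu uv.
Qed.

Lemma to_le_eqVlt u v : le u v -> u = v \/ lt u v.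
Proof. by rewrite /lt => ->; case: eqP; [left|right]. Qed.

Lemma to_leD u u' v v' : le u u' -> le v v' -> le (u + v)%MM (u' + v')%MM.
Proof.
have [_ _ _ _ add] := tord => h1 h2; apply: to_trans (add _ _ v h1) _.
by rewrite addmC [(u' + _)%MM]addmC; apply: add.
Qed.

Lemma to_ltD2r w u v : lt u v -> lt (u + w)%MM (v + w)%MM.
Proof.
move=> /andP[h1 h2]; rewrite /lt eqm_add2r h2 andbT.
by apply: to_leD => //; apply: to_refl.
Qed.

Lemma to_lt_leD u u' v v' : lt u u' -> le v v' -> lt (u + v)%MM (u' + v')%MM.
Proof.
move=> h1 h2; apply: to_lt_trans (to_ltD2r v h1) _.
by apply: to_leD => //; apply: to_refl.
Qed.

Variable K : fieldType.
Implicit Types f g h : {mpoly K[n]}.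

Lemma in_mon_ge f u : u \in msupp f -> le u (in_mon le f).
Proof.
rewrite /in_mon; elim: (msupp f) => //= v s IH; rewrite inE => /predU1P[->|/IH us].
  case: ifP => // _; exact: to_refl.
case: ifP => // /negbT; rewrite -to_ltNle => lv.
exact: to_trans us (to_ltW lv).
Qed.

Lemma in_mon_supp f : f != 0 -> in_mon le f \in msupp f.
Proof.
rewrite -msupp_eq0 /in_mon; elim: (msupp f) => //= v s IH _.
case: (eqVneq s [::]) => [->|/IH us] /=; last first.
  by case: ifP => _; rewrite inE ?us ?orbT ?eqxx.
have [_ _ _ le0 _] := tord; rewrite inE; case: ifP => // v0.
by rewrite (to_anti v0 (le0 v)).
Qed.

Lemma in_mon_coef f : f != 0 -> f@_(in_mon le f) != 0.
Proof. by move=> /in_mon_supp; rewrite mcoeff_msupp. Qed.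

Lemma in_mon_eq f u :
  f@_u != 0 -> (forall v, f@_v != 0 -> le v u) -> in_mon le f = u.
Proof.
move=> fu max; have f0 : f != 0 by apply: contraNneq fu => ->; rewrite mcoeff0.
apply: to_anti; first by apply: max; apply: in_mon_coef.
by apply: in_mon_ge; rewrite mcoeff_msupp.
Qed.

Lemma coef_gt_in_mon f u : lt (in_mon le f) u -> f@_u = 0.
Proof.
rewrite to_ltNle => h; apply: memN_msupp_eq0; apply: contra h.
exact: in_mon_ge.
Qed.

(** Only the pair of the largest monomials contributes to this coefficient. *)
Lemma mcoeffM_max f g a b :
  (forall v, f@_v != 0 -> le v a) -> (forall v, g@_v != 0 -> le v b) ->
  (f * g)@_(a + b) = f@_a * g@_b.
Proof.
move=> fa gb; rewrite mcoeffM.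
have da : (mdeg a < (mdeg (a + b)%MM).+1)%N by rewrite mdegD ltnS leq_addr.
have db : (mdeg b < (mdeg (a + b)%MM).+1)%N by rewrite mdegD ltnS leq_addl.
rewrite (bigD1 (BMultinom da, BMultinom db)) //= big1 ?addr0 // => -[u v] /=.
move=> /andP[/eqP e ne]; apply/eqP; rewrite mulf_eq0.
case: (eqVneq f@_u 0) => //= fu; case: (eqVneq g@_v 0) => //= gv.
have [ua|ua] := to_le_eqVlt (fa _ fu).
  case/eqP: ne; congr pair; apply: val_inj => //=.
  by move: e; rewrite ua => /addmI.
by case/andP: (to_lt_leD ua (gb _ gv)) => _ /eqP[]; exact: esym e.
Qed.

Lemma in_monM f g : f != 0 -> g != 0 ->
  f * g != 0 /\ in_mon le (f * g) = (in_mon le f + in_mon le g)%MM.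
Proof.
move=> f0 g0.
have fm v : f@_v != 0 -> le v (in_mon le f).
  by rewrite -mcoeff_msupp; apply: in_mon_ge.
have gm v : g@_v != 0 -> le v (in_mon le g).
  by rewrite -mcoeff_msupp; apply: in_mon_ge.
have c : (f * g)@_(in_mon le f + in_mon le g) != 0.
  by rewrite mcoeffM_max // mulf_neq0 // in_mon_coef.
split; first by apply: contraNneq c => ->; rewrite mcoeff0.
apply: in_mon_eq => // v; rewrite -mcoeff_msupp => /msuppM_le/allpairsP[[a b] /= [ha hb ->]].
by apply: to_leD; apply: in_mon_ge.
Qed.

Lemma in_monX u : in_mon le ('X_[u] : {mpoly K[n]}) = u.
Proof.
apply: in_mon_eq => [|v]; rewrite mcoeffX; first by rewrite eqxx oner_eq0.
by case: (eqVneq u v) => [-> _|_]; [apply: to_refl|rewrite eqxx].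
Qed.

(** In a vanishing combination, the largest initial monomial that occurs with a
    nonzero coefficient cannot cancel. *)
Lemma distinct_in_mon_free r (bs : 'I_r -> {mpoly K[n]}) :
  (forall q, bs q != 0) -> injective (fun q => in_mon le (bs q)) ->
  free_family bs.
Proof.
move=> nz inj x sx q; apply/eqP; apply: contraT => xq.
have [p xp maxp] : exists2 p, x p != 0 &
    forall p', x p' != 0 -> le (in_mon le (bs p')) (in_mon le (bs p)).
  have [s us] : exists s : seq 'I_r, forall p, p \in s = (x p != 0).
    by exists [seq p <- enum 'I_r | x p != 0] => p; rewrite mem_filter mem_enum andbT.
  have : q \in s by rewrite us.
  suff: forall s : seq 'I_r, q \in s -> exists2 p, p \in s &
      forall p', p' \in s -> le (in_mon le (bs p')) (in_mon le (bs p)).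
    move=> H /H[p ps pm]; exists p; first by rewrite -us.
    by move=> p' xp'; apply: pm; rewrite us.
  move=> {}s {us}; case: s => // a s _.
  elim: s a => [|b s IH] a.
    by exists a; rewrite ?mem_head // => p'; rewrite inE => /eqP->; apply: to_refl.
  have [p ps pm] := IH b; have [tot _ _ _ _] := tord.
  case/orP: (tot (in_mon le (bs a)) (in_mon le (bs p))) => ap.
    by exists p; [rewrite inE ps orbT|move=> p'; rewrite inE => /predU1P[->|/pm]].
  exists a; first exact: mem_head.
  move=> p'; rewrite inE => /predU1P[->|/pm p'p]; first exact: to_refl.
  exact: to_trans p'p ap.
move/(congr1 (mcoeff (in_mon le (bs p)))): sx.
rewrite raddf_sum (bigD1 p) //= mcoeff0 big1 => [|p' np].
  by rewrite addr0 mcoeffZ => /eqP; rewrite mulf_eq0 (negbTE xp) (negbTE (in_mon_coef (nz p))).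
rewrite mcoeffZ; case: (eqVneq (x p') 0) => [->|/maxp h]; first by rewrite mul0r.
by rewrite coef_gt_in_mon ?mulr0 // /lt h (inj_eq inj).
Qed.
End TermOrder.

(** * Words in the generators *)

Section Words.
Local Open Scope ring_scope.
Variables (n : nat) (K : fieldType) (act : pred nat) (delta : nat -> nat).
Implicit Types (g : nat -> {mpoly K[n]}) (l : seq nat) (h : {mpoly K[n]}).

Definition wprod g l : {mpoly K[n]} := \prod_(i <- l) g i.
Definition wdeg l : nat := (\sum_(i <- l) delta i)%N.
Definition mon_sum (a : nat -> 'X_{1..n}) l : 'X_{1..n} := (\sum_(i <- l) a i)%MM.

(** The part of degree at most [E] of the algebra of the generators. *)
Definition truncated g E : {mpoly K[n]} -> Prop :=
  lin_span (wprod g) (fun l => all act l /\ (wdeg l <= E)%N).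

Lemma wprod_cat g l1 l2 : wprod g (l1 ++ l2) = wprod g l1 * wprod g l2.
Proof. exact: big_cat. Qed.

Lemma wprod_perm g l1 l2 : perm_eq l1 l2 -> wprod g l1 = wprod g l2.
Proof. exact: perm_big. Qed.

Lemma wdeg_cat l1 l2 : wdeg (l1 ++ l2) = (wdeg l1 + wdeg l2)%N.
Proof. exact: big_cat. Qed.

Lemma mon_sum_cat a l1 l2 : mon_sum a (l1 ++ l2) = (mon_sum a l1 + mon_sum a l2)%MM.
Proof. exact: big_cat. Qed.

Lemma mon_sum_perm a l1 l2 : perm_eq l1 l2 -> mon_sum a l1 = mon_sum a l2.
Proof. exact: perm_big. Qed.

Lemma truncated_mono g E E' h : (E <= E')%N -> truncated g E h -> truncated g E' h.
Proof. by move=> leE; apply: lin_span_mono => l [al dl]; split=> //; apply: leq_trans dl leE. Qed.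

Variable g : nat -> {mpoly K[n]}.
Hypothesis homog_g : forall i, act i -> g i \is (delta i).-homog.

Lemma wprod_homog l : all act l -> wprod g l \is (wdeg l).-homog.
Proof.
rewrite /wprod /wdeg; elim: l => [_|i l IH /= /andP[ai al]].
  by rewrite !big_nil dhomog1.
by rewrite !big_cons dhomogM ?homog_g ?IH.
Qed.

Lemma truncated_mdeg E h u : truncated g E h -> h@_u != 0 -> (mdeg u <= E)%N.
Proof.
elim=> [|c l h' [al dl] _ IH]; first by rewrite mcoeff0 eqxx.
rewrite mcoeffD mcoeffZ; case: (eqVneq h'@_u 0) => [->|/IH //]; rewrite addr0.
case: (eqVneq (wprod g l)@_u 0) => [->|]; first by rewrite mulr0 eqxx.
by rewrite -mcoeff_msupp => /(dhomogP _ _ _ (wprod_homog al)) ->.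
Qed.

Lemma truncated_of_span h :
  lin_span (wprod g) (fun l => all act l) h -> exists E, truncated g E h.
Proof.
elim=> [|c l h' al _ [E hE]]; first by exists 0%N; apply: lin_span0.
exists (maxn E (wdeg l)); apply: lin_span_cons; first by rewrite leq_maxr.
exact: truncated_mono (leq_maxl _ _) hE.
Qed.

Hypothesis nz_g : forall i, act i -> g i != 0.
Variable le : rel 'X_{1..n}.
Hypothesis tord : term_order le.
Local Notation lt := (lt_of le).

Definition wmon l : 'X_{1..n} := mon_sum (fun i => in_mon le (g i)) l.

Lemma wprod_in l : all act l -> wprod g l != 0 /\ in_mon le (wprod g l) = wmon l.
Proof.
rewrite /wprod /wmon /mon_sum; elim: l => [_|i l IH /= /andP[ai al]].
  by rewrite !big_nil oner_eq0 -mpolyX0 in_monX.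
rewrite !big_cons; have [h1 h2] := IH al.
by have [h3 ->] := in_monM tord (nz_g ai) h1; rewrite h2.
Qed.

Lemma mdeg_wmon l : all act l -> mdeg (wmon l) = wdeg l.
Proof.
move=> al; have [nz <-] := wprod_in al.
exact: dhomogP _ _ _ (wprod_homog al) _ (in_mon_supp tord nz).
Qed.

Lemma wprod_coef_le l u : all act l -> (wprod g l)@_u != 0 -> le u (wmon l).
Proof.
move=> al; have [nz <-] := wprod_in al.
by rewrite -mcoeff_msupp; apply: in_mon_ge.
Qed.

Lemma wprod_coef_wmon l : all act l -> (wprod g l)@_(wmon l) != 0.
Proof. by move=> al; have [nz <-] := wprod_in al; apply: in_mon_coef. Qed.

Definition initials_generated (S : {mpoly K[n]} -> Prop) : Prop :=
  forall h, S h -> h != 0 -> exists2 l, all act l & in_mon le h = wmon l.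

(** * The dimension criterion *)

(** [g'] generates the algebra of the initial monomials of the [g i]; the
    scalars [c'] make it possible to take the leading terms themselves. *)
Variables (g' : nat -> {mpoly K[n]}) (c' : nat -> K).
Hypothesis nz_c' : forall i, act i -> c' i != 0.
Hypothesis g'E : forall i, act i -> g' i = c' i *: 'X_[in_mon le (g i)].

Lemma wprod_monomials l : all act l ->
  exists2 c : K, c != 0 & wprod g' l = c *: 'X_[wmon l].
Proof.
rewrite /wprod /wmon /mon_sum; elim: l => [_|i l IH /= /andP[ai al]].
  by exists 1; rewrite ?oner_eq0 // !big_nil mpolyX0 scale1r.
have [c c0 e] := IH al; exists (c' i * c); first by rewrite mulf_neq0 ?nz_c'.
by rewrite !big_cons e g'E // mpolyXD -scalerAl -scalerAr scalerA.
Qed.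

(** Being a sum of initial monomials is a proposition; a classical case
    distinction for each element turns it into a list. *)
Lemma filter_prop (T : eqType) (P : T -> Prop) (s : seq T) :
  exists s', subseq s' s /\ forall x, x \in s' <-> (x \in s /\ P x).
Proof.
elim: s => [|y s [s' [sub hs']]]; first by exists [::]; split=> // x; split=> [|[]].
have [Py|nPy] := classic (P y).
  exists (y :: s'); split; first by rewrite /= eqxx.
  move=> x; rewrite !inE; split.
    by move=> /predU1P[->|/hs'[-> Px]]; rewrite ?eqxx ?orbT.
  by move=> [/predU1P[->|xs] Px]; rewrite ?eqxx //; apply/orP; right; apply/hs'.
exists s'; split; first exact: subseq_trans sub (subseq_cons _ _).
move=> x; rewrite inE; split=> [/hs'[-> Px]|]; first by rewrite orbT.
by move=> [/predU1P[->//|xs] Px]; apply/hs'.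
Qed.

Lemma exists_monomials E : exists ms : seq 'X_{1..n}, uniq ms /\
  forall u, u \in ms <-> exists2 l, all act l /\ (wdeg l <= E)%N & u = wmon l.
Proof.
pose P u := exists2 l, all act l /\ (wdeg l <= E)%N & u = wmon l.
have [ms [sub hms]] := filter_prop P [seq val u | u : 'X_{1..n < E.+1}].
exists ms; split.
  by apply: subseq_uniq sub _; rewrite map_inj_uniq ?enum_uniq //; apply: val_inj.
move=> u; split=> [/hms[]//|Pu]; apply/hms; split=> //.
have [l [al dl] ul] := Pu; have du : (mdeg u < E.+1)%N by rewrite ul mdeg_wmon.
by apply/mapP; exists (BMultinom du); rewrite ?mem_enum.
Qed.

(** Products of generators with pairwise distinct initial monomials are
    independent, so the truncated initial algebra is never the larger one; it
    has the same dimension exactly when no new initial monomial appears. *)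
Lemma dimension_criterion E r r' :
  has_dim (truncated g E) r -> has_dim (truncated g' E) r' ->
  (r = r' <-> initials_generated (truncated g E)).
Proof.
move=> [bs [Sb spb frb]] dim'.
have [ms [ums hms]] := exists_monomials E; pose N := size ms.
pose m (j : 'I_N) := nth 0%MM ms j.
have mj j : m j \in ms by apply: mem_nth.
have m_inj : injective m.
  by move=> i j /eqP; rewrite nth_uniq // => /eqP/val_inj.
have [w wP] := fin_all_exists (fun j => let: ex_intro2 l p q := proj1 (hms (m j)) (mj j)
  in ex_intro (fun l => (all act l /\ (wdeg l <= E)%N) /\ m j = wmon l) l (conj p q)).
have idx u : u \in ms -> exists j, m j = u.
  by move=> hu; have lt := hu; rewrite -index_mem in lt; exists (Ordinal lt); rewrite /m nth_index.
(* The listed monomials are a basis of the truncated initial algebra. *)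
have r'N : r' = N.
  apply: has_dim_unique dim' _; exists (fun j => 'X_[m j]); split.
  - move=> j; have [[al dl] ->] := wP j; have [c c0 e] := wprod_monomials al.
    have -> : 'X_[wmon (w j)] = c^-1 *: wprod g' (w j) by rewrite e scalerA mulVf ?scale1r.
    by apply/lin_spanZ/lin_span_gen.
  - move=> h; elim=> [|c l h' [al dl] _ [x xE]].
      by exists (fun=> 0); rewrite big1 // => q _; rewrite scale0r.
    have [c0 _ ->] := wprod_monomials al.
    have [j mjl] := idx (wmon l) (proj2 (hms _) (ex_intro2 _ _ l (conj al dl) erefl)).
    exists (fun q => (if q == j then c * c0 else 0) + x q).
    under eq_bigr do rewrite scalerDl; rewrite big_split -xE /=; congr +%R.
    rewrite (bigD1 j) //= eqxx big1 ?addr0 ?mjl ?scalerA // => q /negbTE->.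
    by rewrite scale0r.
  - apply: (distinct_in_mon_free tord) => [j|i j].
      by rewrite -msupp_eq0 msuppX.
    by rewrite !in_monX //; apply: m_inj.
have inw j : in_mon le (wprod g (w j)) = m j.
  by have [[al _] ->] := wP j; have [_ ->] := wprod_in al.
have nzw j : wprod g (w j) != 0 by have [[al _] _] := wP j; have [] := wprod_in al.
have Sw j : truncated g E (wprod g (w j)) by have [aldl _] := wP j; apply: lin_span_gen.
have leNr : (N <= r)%N.
  apply: (free_le_spanning spb Sw); apply: (distinct_in_mon_free tord) => // i j.
  by rewrite !inw; apply: m_inj.
rewrite r'N; split=> [rN h Sh h0|gen].
  apply: NNPP => notgen.
  (* A new initial monomial would give one more independent element. *)
  pose cs (j : 'I_N.+1) := oapp (fun j => wprod g (w j)) h (unlift ord_max j).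
  suff : (N.+1 <= r)%N by rewrite rN ltnn.
  have csj i : cs (lift ord_max i) = wprod g (w i) by rewrite /cs liftK.
  have csm : cs ord_max = h by rewrite /cs unlift_none.
  apply: (free_le_spanning spb (cs := cs)) => [j|].
    by case: (unliftP ord_max j) => [i|] ->; rewrite ?csj ?csm.
  apply: (distinct_in_mon_free tord) => [j|].
    by case: (unliftP ord_max j) => [i|] ->; rewrite ?csj ?csm.
  have nm i : in_mon le h <> in_mon le (wprod g (w i)).
    move=> e; apply: notgen; have [[al _] mw] := wP i.
    by exists (w i) => //; rewrite e inw.
  move=> j1 j2; case: (unliftP ord_max j1) => [i1|] ->; case: (unliftP ord_max j2) => [i2|] ->; rewrite ?csj ?csm //.
  - by rewrite !inw => /m_inj->.
  - by move=> /esym/nm.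
  - by move/nm.
apply/anti_leq/andP; split=> //.
(* A nonzero element has a nonzero coefficient at one of the listed
   monomials, so the matrix of coefficients has independent rows. *)
pose A := \matrix_(q < r, j < N) (bs q)@_(m j).
suff : row_free A by move/eqP => <-; apply: rank_leq_col.
rewrite -kermx_eq0; apply/rowV0P => u /sub_kermxP uA.
pose h := \sum_q u 0 q *: bs q.
have hm j : h@_(m j) = 0.
  transitivity ((u *m A) 0 j); last by rewrite uA mxE.
  by rewrite mxE raddf_sum; apply: eq_bigr => q _; rewrite /= mcoeffZ mxE.
have Sh : truncated g E h by apply: lin_span_sum => q _; apply: lin_spanZ (Sb q).
suff h0 : h = 0 by apply/matrixP => i q; rewrite ord1 mxE (frb _ h0).
apply/eqP; apply: contraT => h0; have [l al inh] := gen h Sh h0.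
have cin := in_mon_coef tord h0.
have [j mjl] : exists j, m j = in_mon le h.
  apply/idx/hms; exists l => //; split=> //.
  by rewrite -mdeg_wmon // -inh; apply: truncated_mdeg Sh cin.
by rewrite -mjl hm eqxx in cin.
Qed.
End Words.

(** * A degree bound for subduction *)

(** Positions rather than entries are split, since entries may be repeated. *)
Lemma split_by_set p (J : pred 'I_p) (l : seq nat) : size l = p ->
  perm_eq ([seq nth 0 l i | i : 'I_p <- enum 'I_p & J i] ++
           [seq nth 0 l i | i : 'I_p <- enum 'I_p & ~~ J i]) l.
Proof.
move=> sl; rewrite -map_cat.
apply: perm_trans (perm_map _ (permEl (perm_filterC J _))) _.
rewrite -{2}(mkseq_nth 0 l) /mkseq sl -val_enum_ord -map_comp.
exact: perm_refl.
Qed.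

(** Two long words with the same sum split into strictly shorter pairs: read
    the first word with positive and the second with negative signs. *)
Lemma split_words n d (a : nat -> 'X_{1..n}) (l l' : seq nat) :
  (forall i, i \in l ++ l' -> forall k, a i k <= d) ->
  mon_sum a l = mon_sum a l' -> (2 * n * d).+1 ^ n < size l + size l' ->
  exists l1 l2 l1' l2',
    [/\ perm_eq (l1 ++ l2) l, perm_eq (l1' ++ l2') l',
        mon_sum a l1 = mon_sum a l1', mon_sum a l2 = mon_sum a l2'
      & size l1 + size l1' < size l + size l' /\
        size l2 + size l2' < size l + size l'].
Proof.
move=> ad eqs big.
set p := size l; set q := size l'.
pose v (i : 'I_(p + q)) (k : 'I_n) : int :=
  match split i with inl i => (a (nth 0 l i) k)%:Z | inr i => - (a (nth 0 l' i) k)%:Z end%R.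
have vl i k : v (lshift q i) k = ((a (nth 0 l i) k)%:Z)%R by rewrite /v (unsplitK (inl i)).
have vr i k : v (rshift p i) k = (- (a (nth 0 l' i) k)%:Z)%R by rewrite /v (unsplitK (inr i)).
(* the parts of the two words that a set of positions selects *)
pose pl (J : {set 'I_(p + q)}) := [seq nth 0 l i | i : 'I_p <- enum 'I_p & lshift q i \in J].
pose pr (J : {set 'I_(p + q)}) := [seq nth 0 l' i | i : 'I_q <- enum 'I_q & rshift p i \in J].
have sumJ (J : {set 'I_(p + q)}) k : (\sum_(i in J) v i k = (mon_sum a (pl J) k)%:Z - (mon_sum a (pr J) k)%:Z)%R.
  rewrite big_mkcond big_split_ord /= -!big_mkcond /= /mon_sum !mnm_sumE.
  rewrite !(big_morph Posz PoszD (erefl _)) !big_map !big_filter !big_enum_cond /=.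
  by rewrite -sumrN; congr +%R; apply: eq_bigr => i _; rewrite ?vl ?vr.
have cardJ (J : {set 'I_(p + q)}) : size (pl J) + size (pr J) = #|J|.
  rewrite !size_map -sum1_card big_mkcond big_split_ord /= -!big_mkcond /=.
  by rewrite !size_filter -!sum1_count !big_enum_cond.
have permJ (J : {set 'I_(p + q)}) : perm_eq (pl J ++ pl (~: J)) l /\ perm_eq (pr J ++ pr (~: J)) l'.
  split.
    rewrite (_ : pl (~: J) = [seq nth 0 l i | i : 'I_p <- enum 'I_p & ~~ (lshift q i \in J)]).
      exact: (@split_by_set p (fun i => lshift q i \in J)).
    by rewrite /pl; congr map; apply: eq_filter => i; rewrite inE.
  rewrite (_ : pr (~: J) = [seq nth 0 l' i | i : 'I_q <- enum 'I_q & ~~ (rshift p i \in J)]).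
    exact: (@split_by_set q (fun i => rshift p i \in J)).
  by rewrite /pr; congr map; apply: eq_filter => i; rewrite inE.
have [||J [J0 JT zJ]] := @zero_sum_subset n (p + q) d v big.
- move=> i k; rewrite /v; case: (split i) => j; rewrite ?abszN absz_nat ad //.
    by rewrite mem_cat mem_nth.
  by rewrite mem_cat mem_nth ?orbT.
- move=> k; transitivity (\sum_(i in setT) v i k)%R; first by apply: eq_bigl => i; rewrite inE.
  rewrite sumJ; have [pT qT] := permJ setT.
  have empty : pl (~: setT) = [::] /\ pr (~: setT) = [::].
    have := cardJ (~: setT); rewrite setCT cards0 => /eqP.
    by rewrite addn_eq0 !size_eq0 => /andP[/eqP-> /eqP->].
  move: pT qT; case: empty => -> ->; rewrite !cats0 => pT qT.
  by rewrite (mon_sum_perm a pT) (mon_sum_perm a qT) eqs subrr.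
have e1 : mon_sum a (pl J) = mon_sum a (pr J).
  by apply/mnmP => k; have := zJ k; rewrite sumJ; lia.
have [pJ qJ] := permJ J.
exists (pl J), (pl (~: J)), (pr J), (pr (~: J)); split=> //.
  have := eqs; rewrite -(mon_sum_perm a pJ) -(mon_sum_perm a qJ) !mon_sum_cat e1.
  by move/addmI.
rewrite !cardJ; have := cardsC J; rewrite card_ord => cJ.
have c0 : 0 < #|J| by rewrite card_gt0.
have c1 : 0 < #|~: J|.
  by rewrite card_gt0; apply: contra JT => /eqP/(congr1 (@setC _)); rewrite setCK setC0 => ->.
lia.
Qed.

Section Subduction.
Local Open Scope ring_scope.
Variables (n : nat) (K : fieldType) (act : pred nat) (delta : nat -> nat).
Variables (g : nat -> {mpoly K[n]}) (le : rel 'X_{1..n}).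
Hypothesis homog_g : forall i, act i -> g i \is (delta i).-homog.
Hypothesis nz_g : forall i, act i -> g i != 0.
Hypothesis tord : term_order le.
Local Notation lt := (lt_of le).
Local Notation W := (truncated act delta g).
Local Notation wm := (wmon g le).
Local Notation wd := (wdeg delta).
Local Notation generated := (initials_generated act g le).

(** In bounded degree, counting smaller monomials gives a measure for inductions
    along the term order. *)
Definition rank_below D u := #|[set v : 'X_{1..n < D.+1} | lt v u]|.

Lemma rank_below_lt D u v : (mdeg u <= D)%N -> lt u v -> (rank_below D u < rank_below D v)%N.
Proof.
move=> du uv; apply: proper_card; apply/properP; split.
  by apply/subsetP => x; rewrite !inE => /(to_lt_trans tord)-> //; apply: to_ltW.
have du' : (mdeg u < D.+1)%N by [].
by exists (BMultinom du'); rewrite inE //= /lt_of eqxx andbF.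
Qed.

Lemma rank_below_le D u v : le u v -> (rank_below D u <= rank_below D v)%N.
Proof.
move=> uv; apply: subset_leq_card; apply/subsetP => x; rewrite !inE => xu.
exact: to_lt_trans xu uv.
Qed.

Definition lower D u l : Prop := [/\ all act l, (wd l <= D)%N & lt (wm l) u].

Lemma lower_coef D u h v : lin_span (wprod g) (lower D u) h -> h@_v != 0 -> lt v u.
Proof.
elim=> [|c l h' [al dl ll] _ IH]; first by rewrite mcoeff0 eqxx.
rewrite mcoeffD mcoeffZ; case: (eqVneq h'@_v 0) => [->|/IH //]; rewrite addr0.
case: (eqVneq (wprod g l)@_v 0) => [->|]; first by rewrite mulr0 eqxx.
move/(wprod_coef_le nz_g tord al) => vl _; exact: (to_le_trans tord) vl ll.
Qed.

(** As long as its initial monomial is a sum of initial monomials of generators,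
    an element can be made smaller by subtracting a multiple of a product of
    generators. *)
Lemma subduction D h u :
  generated (W D) -> W D h -> (forall v, h@_v != 0 -> lt v u) ->
  lin_span (wprod g) (lower D u) h.
Proof.
move=> gen; have [k] := ubnP (rank_below D (in_mon le h)).
elim: k h => // k IH h; rewrite ltnS => hk Wh hu.
have [->|h0] := eqVneq h 0; first exact: lin_span0.
have [l al inh] := gen h Wh h0.
have hin := in_mon_coef tord h0.
have dl : (wd l <= D)%N.
  by rewrite -(mdeg_wmon homog_g nz_g tord al) -inh (truncated_mdeg homog_g Wh hin).
have Ll : lower D u l by split=> //; rewrite -inh; apply: hu.
have lc0 := wprod_coef_wmon nz_g tord al.
pose c := h@_(in_mon le h) / (wprod g l)@_(wm l).
suff : lin_span (wprod g) (lower D u) (h - c *: wprod g l).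
  move=> s; rewrite -[h](subrK (c *: wprod g l)); apply: lin_spanD => //.
  by apply/lin_spanZ/lin_span_gen.
have cf v : (h - c *: wprod g l)@_v != 0 -> lt v (in_mon le h).
  have [->|nv] := eqVneq v (in_mon le h).
    have e : (wprod g l)@_(in_mon le h) = (wprod g l)@_(wm l) by rewrite inh.
    by rewrite mcoeffB mcoeffZ e divfK // subrr eqxx.
  rewrite /lt_of nv andbT mcoeffB mcoeffZ.
  case: (eqVneq h@_v 0) => [->|]; last by rewrite -mcoeff_msupp => ? _; apply: in_mon_ge.
  case: (eqVneq (wprod g l)@_v 0) => [->|]; first by rewrite mulr0 subrr eqxx.
  by move=> /(wprod_coef_le nz_g tord al); rewrite -inh.
have Wh' : W D (h - c *: wprod g l).
  by apply: lin_spanB => //; apply/lin_spanZ/lin_span_gen.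
have [->|h'0] := eqVneq (h - c *: wprod g l) 0; first exact: lin_span0.
apply: IH => // [|v /cf vh].
  apply: leq_trans hk; apply: rank_below_lt; last by apply/cf/in_mon_coef.
  by rewrite (truncated_mdeg homog_g Wh') // in_mon_coef.
by apply: (to_lt_trans tord vh); apply/to_ltW/hu.
Qed.

Variables (d E : nat).
Hypothesis in_bound : forall i k, act i -> (in_mon le (g i) k <= d)%N.
Hypothesis delta_bound : forall i, act i -> (delta i <= d)%N.
Hypothesis E_bound : (d * (2 * n * d).+1 ^ n <= E)%N.
Hypothesis generated_E : generated (W E).

(** Two products with the same initial monomial differ, up to a scalar, by
    products with smaller initial monomials. In degree at most [E] this is the
    hypothesis; a pair of larger degree is split into shorter pairs. *)
Lemma tete_a_tete l l' : all act l -> all act l' -> wm l = wm l' ->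
  exists c, lin_span (wprod g) (lower (wd l) (wm l)) (wprod g l - c *: wprod g l').
Proof.
have [N] := ubnP (size l + size l').
elim: N l l' => // N IH l l'; rewrite ltnS => hN al al' eqm.
have lc' := wprod_coef_wmon nz_g tord al'.
have eqd : wd l = wd l'.
  by rewrite -(mdeg_wmon homog_g nz_g tord al) eqm (mdeg_wmon homog_g nz_g tord al').
case: (leqP (wd l) E) => hE.
  exists ((wprod g l)@_(wm l) / (wprod g l')@_(wm l')).
  set c := _ / _; apply: subduction.
  - by move=> h Wh; apply: generated_E; apply: truncated_mono hE Wh.
  - apply: lin_spanB; first by apply: lin_span_gen.
    by apply/lin_spanZ/lin_span_gen; rewrite -eqd.
  - move=> v; have [->|nv] := eqVneq v (wm l).
      by rewrite mcoeffB mcoeffZ [in X in _ * X]eqm divfK // subrr eqxx.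
    rewrite /lt_of nv andbT mcoeffB mcoeffZ.
    case: (eqVneq (wprod g l)@_v 0) => [->|/(wprod_coef_le nz_g tord al) //].
    case: (eqVneq (wprod g l')@_v 0) => [->|]; first by rewrite mulr0 subrr eqxx.
    by move=> /(wprod_coef_le nz_g tord al'); rewrite eqm.
have long : ((2 * n * d).+1 ^ n < size l + size l')%N.
  have dl : (wd l <= d * size l)%N.
    rewrite /wdeg; elim: (l) al => [|i s IHs /= /andP[ai as_]]; first by rewrite big_nil.
    by rewrite big_cons mulnS leq_add ?delta_bound ?IHs.
  apply: leq_trans (leq_addr _ _).
  have := leq_trans (leq_ltn_trans E_bound hE) dl.
  by rewrite ltn_mul2l => /andP[].
have [|l1 [l2 [l1' [l2' [p1 p2 e1 e2 [s1 s2]]]]]] :=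
  @split_words n d (fun i => in_mon le (g i)) l l' _ eqm long.
  move=> i; rewrite mem_cat => /orP[] hi k; apply: in_bound.
    exact: (allP al).
  exact: (allP al').
have [a1 a2] : all act l1 /\ all act l2.
  by apply/andP; rewrite -all_cat (perm_all _ p1).
have [a1' a2'] : all act l1' /\ all act l2'.
  by apply/andP; rewrite -all_cat (perm_all _ p2).
have [c1 S1] := IH l1 l1' (leq_trans s1 hN) a1 a1' e1.
have [c2 S2] := IH l2 l2' (leq_trans s2 hN) a2 a2' e2.
exists (c1 * c2).
rewrite -(wprod_perm g p1) -(wprod_perm g p2) !wprod_cat.
(* Replace the factors one after the other. *)
have -> : wprod g l1 * wprod g l2 - (c1 * c2) *: (wprod g l1' * wprod g l2') =
    (wprod g l1 - c1 *: wprod g l1') * wprod g l2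
    + c1 *: (wprod g l1' * (wprod g l2 - c2 *: wprod g l2')).
  rewrite mulrBl mulrBr scalerBr -scalerAl -!scalerAr scalerA.
  by rewrite addrA subrK.
have dE : wd l = (wd l1 + wd l2)%N by rewrite -wdeg_cat /wdeg (perm_big _ p1).
have mE : wm l = (wm l1 + wm l2)%MM by rewrite -mon_sum_cat /wmon (mon_sum_perm _ p1).
have d1 : wd l1' = wd l1.
  rewrite -(mdeg_wmon homog_g nz_g tord a1') -(mdeg_wmon homog_g nz_g tord a1).
  by rewrite /wmon e1.
apply: lin_spanD; last apply: lin_spanZ.
  apply: (lin_span_mul (v2 := wprod g) (P2 := fun l => l = l2)) S1 _ => [k k2 [ak dk lk] ->|].
    rewrite -wprod_cat; apply: lin_span_gen; split.
    - by rewrite all_cat ak.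
    - by rewrite wdeg_cat dE leq_add2r.
    - by rewrite mE /wmon mon_sum_cat; apply: to_ltD2r.
  exact: lin_span_gen.
apply: (lin_span_mul (v1 := wprod g) (P1 := fun l => l = l1')) S2 => [k2 k -> [ak dk lk]|].
  rewrite -wprod_cat; apply: lin_span_gen; split.
  - by rewrite all_cat a1'.
  - by rewrite wdeg_cat dE d1 leq_add2l.
  - rewrite mE /wmon mon_sum_cat e1 addmC [X in lt _ X]addmC; apply: to_ltD2r => //.
exact: lin_span_gen.
Qed.

(** Represent [h] by products of generators, and consider the products with the
    largest initial monomial. They can be traded for multiples of one of them at
    the price of smaller products. If the resulting coefficient is nonzero, then
    this largest monomial is the initial monomial of [h]; otherwise [h] has a
    representation with smaller initial monomials. *)
Theorem generated_beyond_bound :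
  generated (lin_span (wprod g) (fun l => all act l)).
Proof.
move=> h0 /(truncated_of_span delta)[D].
pose below j l := [/\ all act l, (wd l <= D)%N & (rank_below D (wm l) < j)%N].
suff main j h : lin_span (wprod g) (below j) h -> h != 0 ->
    exists2 l, all act l & in_mon le h = wm l.
  move=> Wh; apply: (main (#|{: 'X_{1..n < D.+1}}|.+1)).
  by apply: lin_span_mono Wh => l [al dl]; split=> //; rewrite ltnS max_card.
elim: j h => [|j IH] h S nz; first by case: S nz => [|c l h' []] //; rewrite eqxx.
have lower_below l : all act l -> (wd l <= D)%N -> rank_below D (wm l) = j ->
    forall k, lower (wd l) (wm l) k -> below j k.
  move=> al dl rl k [ak dk lk]; split=> //; first exact: leq_trans dl.
  by rewrite -rl; apply: rank_below_lt => //; rewrite (mdeg_wmon homog_g) // (leq_trans dk).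
have [[l [c [r [al dl rl hE Sr]]]]|] :
    (exists l c r, [/\ all act l, (wd l <= D)%N, rank_below D (wm l) = j,
       h = c *: wprod g l + r & lin_span (wprod g) (below j) r]) \/
    lin_span (wprod g) (below j) h.
  elim: S {nz} => [|c l h' [al dl rl] _ IHS]; first by right; apply: lin_span0.
  move: rl; rewrite ltnS leq_eqVlt => /predU1P[rl|rl]; last first.
    have Sl : lin_span (wprod g) (below j) (c *: wprod g l).
      by apply/lin_spanZ/lin_span_gen.
    case: IHS => [[l0 [c0 [r [al0 dl0 rl0 -> Sr]]]]|Sh']; last by right; apply: lin_spanD.
    left; exists l0, c0, (c *: wprod g l + r); split=> //; first by rewrite addrCA.
    exact: lin_spanD.
  left; case: IHS => [[l0 [c0 [r [al0 dl0 rl0 -> Sr]]]]|Sh'].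
    have eqm : wm l = wm l0.
      have no u v : (mdeg u <= D)%N -> rank_below D u = rank_below D v -> ~~ lt u v.
        by move=> du e; apply/negP => /(rank_below_lt du); rewrite e ltnn.
      apply: (to_anti tord).
        have : ~~ lt (wm l0) (wm l) by apply: no; rewrite ?rl ?rl0 ?(mdeg_wmon homog_g).
        by rewrite to_ltNle // negbK.
      have : ~~ lt (wm l) (wm l0) by apply: no; rewrite ?rl ?rl0 ?(mdeg_wmon homog_g).
      by rewrite to_ltNle // negbK.
    have [c1 S1] := tete_a_tete al al0 eqm.
    exists l0, (c * c1 + c0), (c *: (wprod g l - c1 *: wprod g l0) + r); split=> //.
      by rewrite scalerBr scalerA scalerDl; ring.
    apply: lin_spanD => //; apply: lin_spanZ.
    exact: lin_span_mono (lower_below l al dl rl) S1.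
  by exists l, c, h'.
  have [c0|c0] := eqVneq c 0.
    by move: nz; rewrite hE c0 scale0r add0r => rnz; apply: IH.
  exists l => //; have lc := wprod_coef_wmon nz_g tord al.
  have r_lt v : r@_v != 0 -> lt v (wm l).
    apply: (lower_coef (D := D)); apply: lin_span_mono Sr => k [ak dk rk]; split=> //.
    rewrite (to_ltNle tord); apply/negP => /(rank_below_le D).
    by rewrite rl leqNgt rk.
  rewrite hE; apply: (in_mon_eq tord) => [|v]; rewrite mcoeffD mcoeffZ.
    have [->|/r_lt] := eqVneq r@_(wm l) 0; first by rewrite addr0 mulf_neq0.
    by rewrite /lt_of eqxx andbF.
  case: (eqVneq r@_v 0) => [->|/r_lt/to_ltW //].
  rewrite addr0; case: (eqVneq (wprod g l)@_v 0) => [->|]; first by rewrite mulr0 eqxx.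
  by move=> /(wprod_coef_le nz_g tord al).
by move=> S'; apply: IH.
Qed.
End Subduction.

(** * SAGBI bases through sums of initial monomials *)

Section Sagbi.
Local Open Scope ring_scope.
Variables (n : nat) (K : fieldType) (F : seq {mpoly K[n]}).

Definition gens (i : nat) : {mpoly K[n]} := nth 0 F i.
Definition gens_deg (i : nat) : nat := (msize (gens i)).-1.
(** Zero and constant generators contribute only scalars to the algebra. *)
Definition active : pred nat := fun i => (i < size F)%N && (0 < gens_deg i)%N.

Lemma active_nz i : active i -> gens i != 0.
Proof.
by move=> /andP[_]; rewrite /gens_deg; apply: contraTneq => ->; rewrite msize0.
Qed.

Lemma inactive_const i : ~~ active i -> gens i = ((gens i)@_0%MM)%:MP.
Proof.
rewrite /active negb_and -leqNgt; case/orP => [h|h].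
  by rewrite /gens nth_default // mcoeff0 mpolyC0.
by apply: msize1_polyC; move: h; rewrite /gens_deg; lia.
Qed.

Lemma subalg_mono (G G' : {mpoly K[n]} -> Prop) h :
  (forall f, G f -> G' f) -> subalg G h -> subalg G' h.
Proof.
move=> sub; elim=> {h} [f /sub|c|f g _ IHf _ IHg|f g _ IHf _ IHg].
- exact: subalg_gen.
- exact: subalg_const.
- exact: subalg_add.
- exact: subalg_mul.
Qed.

Lemma subalg_words h :
  subalg (fun f => f \in F) h <-> lin_span (wprod gens) (fun l => all active l) h.
Proof.
split.
  elim=> {h} [f fF|c|f g _ IHf _ IHg|f g _ IHf _ IHg].
  - have {fF} [i _ <-] : exists2 i, (i < size F)%N & gens i = f by apply/nthP.
    have [ai|/inactive_const->] := boolP (active i).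
      have := @lin_span_gen _ _ _ (wprod gens) (fun l => all active l) [:: i].
      by rewrite /wprod big_seq1 /= ai; apply.
    rewrite -alg_mpolyC; apply: lin_spanZ.
    by have := @lin_span_gen _ _ _ (wprod gens) (fun l => all active l) [::] isT; rewrite /wprod big_nil.
  - rewrite -alg_mpolyC; apply: lin_spanZ.
    by have := @lin_span_gen _ _ _ (wprod gens) (fun l => all active l) [::] isT; rewrite /wprod big_nil.
  - exact: lin_spanD.
  - apply: (lin_span_mul (v1 := wprod gens) (v2 := wprod gens)) IHf IHg => l1 l2 a1 a2.
    by rewrite -wprod_cat; apply: lin_span_gen; rewrite all_cat a1.
elim=> [|c l h' al _ IH]; first by rewrite -mpolyC0; apply: subalg_const.
apply: subalg_add => //; rewrite -mul_mpolyC; apply: subalg_mul; first exact: subalg_const.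
rewrite /wprod; elim: l al => [_|i l IHl /= /andP[/andP[ai _] al]].
  by rewrite big_nil -mpolyC1; apply: subalg_const.
rewrite big_cons; apply: subalg_mul; last exact: IHl.
by apply: subalg_gen; apply: mem_nth.
Qed.

Variable le : rel 'X_{1..n}.

Lemma in_mon_const (c : K) : in_mon le (c%:MP : {mpoly K[n]}) = 0%MM.
Proof.
have [->|c0] := eqVneq c 0; first by rewrite mpolyC0 /in_mon msupp0.
by rewrite /in_mon msuppC (negbTE c0) /=; case: ifP.
Qed.

(** In the algebra generated by the initial monomials of [F], all supports
    consist of sums of these monomials, which gives one implication; the other
    is checked on the generators of the initial algebra. *)
Lemma sagbi_basisP :
  sagbi_basis le (fun f => f \in F) (subalg (fun f => f \in F)) <->
  initials_generated active gens le
    (lin_span (wprod gens) (fun l => all active l)).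
Proof.
split=> [[_ sag] h /subalg_words Sh h0|gen].
  suff supp p : subalg (initials le (fun f => f \in F)) p ->
      forall u, u \in msupp p -> exists2 l, all active l & u = wmon gens le l.
    apply: (supp 'X_[in_mon le h]); last by rewrite msuppX mem_head.
    by apply/sag/subalg_gen; exists h.
  elim=> {p} [p [f [fF f0 ->]]|c|p q _ IHp _ IHq|p q _ IHp _ IHq] u.
  - rewrite msuppX inE => /eqP->.
    have {fF f0} [i _ <-] : exists2 i, (i < size F)%N & gens i = f by apply/nthP.
    have [ai|/inactive_const->] := boolP (active i).
      by exists [:: i]; rewrite /= ?ai // /wmon /mon_sum big_seq1.
    by exists [::] => //; rewrite in_mon_const /wmon /mon_sum big_nil.
  - rewrite msuppC; case: ifP => // _; rewrite inE => /eqP->.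
    by exists [::] => //; rewrite /wmon /mon_sum big_nil.
  - by move=> /msuppD_le; rewrite mem_cat => /orP[/IHp|/IHq].
  - move=> /msuppM_le/allpairsP[[a b] /= [/IHp[l1 a1 ->] /IHq[l2 a2 ->] ->]].
    by exists (l1 ++ l2); rewrite ?all_cat ?a1 // /wmon mon_sum_cat.
split=> [f fF|p]; first exact: subalg_gen.
split; first by apply: subalg_mono => q [f [fF f0 ->]]; exists f; split=> //; apply: subalg_gen.
elim=> {p} [p [f [/subalg_words Sf f0 ->]]|c|p q _ IHp _ IHq|p q _ IHp _ IHq].
- have [l al ->] := gen f Sf f0; rewrite /wmon /mon_sum.
  elim: l al => [_|i l IHl /= /andP[ai al]].
    by rewrite big_nil mpolyX0 -mpolyC1; apply: subalg_const.
  rewrite big_cons mpolyXD; apply: subalg_mul; last exact: IHl.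
  apply: subalg_gen; exists (gens i); split=> //; last exact: active_nz.
  by case/andP: ai => si _; apply: mem_nth.
- exact: subalg_const.
- exact: subalg_add.
- exact: subalg_mul.
Qed.
End Sagbi.

(** * Weight orders *)

Section WeightOrder.
Variable n : nat.
Implicit Types (u v : 'X_{1..n}) (w : 'I_n -> nat).

Definition weight w u : nat := \sum_(k < n) w k * u k.

Definition weight_le w : rel 'X_{1..n} := fun u v =>
  (weight w u < weight w v) || ((weight w u == weight w v) && (u <= v)%O).

Lemma weightD w u v : weight w (u + v)%MM = weight w u + weight w v.
Proof. by rewrite -big_split; apply: eq_bigr => k _; rewrite mnmDE mulnDr. Qed.

Lemma weight_le_term_order w : term_order (weight_le w).
Proof.
split.
- move=> u v; rewrite /weight_le; case: (ltngtP (weight w u) (weight w v)) => //= _.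
  exact: Order.TotalTheory.le_total.
- move=> u v; rewrite /weight_le; case: (ltngtP (weight w u) (weight w v)) => //= _.
  exact: Order.POrderTheory.le_anti.
- move=> v u x; rewrite /weight_le.
  case: (ltngtP (weight w u) (weight w v)) => //= [h _|e].
    case: (ltngtP (weight w v) (weight w x)) => //= [h' _|<- _].
      by rewrite (ltn_trans h h').
    by rewrite h.
  by rewrite e => uv /orP[->//|/andP[-> vx]]; rewrite (Order.POrderTheory.le_trans uv vx) orbT.
- move=> u; rewrite /weight_le; have -> : weight w 0%MM = 0.
    by apply: big1 => k _; rewrite mnm0E muln0.
  by case: (weight w u) => //=; rewrite le0m.
- move=> u v x; rewrite /weight_le !weightD ltn_add2r eqn_add2r.
  by case/orP=> [->//|/andP[-> uv]]; rewrite lemc_add2l uv orbT.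
Qed.

(** The differences of comparable monomials are closed under addition and avoid
    zero, so a functional is positive on finitely many of them; including the
    unit vectors among these makes the polyhedron of such functionals pointed,
    and a vertex of it gives a small weight. *)
Lemma term_order_weight (le : rel 'X_{1..n}) (d : nat) (pairs : seq ('X_{1..n} * 'X_{1..n})) :
  term_order le -> 0 < d ->
  (forall p, p \in pairs -> [/\ lt_of le p.1 p.2, mdeg p.1 <= d & mdeg p.2 <= d]) ->
  exists w : 'X_{1..n}, (forall k, w k <= n`! * d ^ n.-1) /\
    forall p, p \in pairs -> weight w p.1 < weight w p.2.
Proof.
move=> tord d0 hp.
pose diff (p : 'X_{1..n} * 'X_{1..n}) : {ffun 'I_n -> int} := [ffun k => (p.2 k)%:Z - (p.1 k)%:Z]%R.
pose units := [seq (0%MM : 'X_{1..n}, U_(k)%MM) | k : 'I_n <- enum 'I_n].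
pose all_pairs := units ++ pairs.
have hall p : p \in all_pairs -> [/\ lt_of le p.1 p.2, mdeg p.1 <= d & mdeg p.2 <= d].
  rewrite mem_cat => /orP[/mapP[k _ ->]|/hp//]; rewrite mdeg0 mdeg1; split=> //=.
  have [_ _ _ le0 _] := tord; rewrite /lt_of le0 eq_sym mnm1_eq0 //.
have mle u k : u k <= mdeg u by rewrite mdegE (bigD1 k) //= leq_addr.
pose A := [seq diff p | p <- all_pairs].
have [||||w wA] := @positive_functional n n
  (fun a => exists2 p, lt_of le p.1 p.2 & a = diff p) A.
- exact: leqnn.
- move=> _ _ [p hp1 ->] [q hq1 ->].
  exists ((p.1 + q.1)%MM, (p.2 + q.2)%MM) => /=; first exact: to_lt_leD (to_ltW hq1).
  by apply/ffunP => k; rewrite !ffunE /= !mnmDE; lia.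
- move=> _ [p /andP[_ ne] ->].
  have /existsP[k hk] : [exists k, p.1 k != p.2 k].
    apply: contraR ne; rewrite negb_exists => /forallP h.
    by apply/eqP/mnmP => k; apply/eqP; have := h k; rewrite negbK.
  by exists k => //; rewrite ffunE subr_eq0 eqz_nat eq_sym.
- by move=> _ /mapP[p /hall[lp _ _] ->]; exists p.
have [||//|W [Wb WA]] := @bounded_weight n d A w.
- move=> _ /mapP[[u v] /hall[/= _ du dv] ->] k; rewrite ffunE /=.
  by have := mle u k; have := mle v k; lia.
- move=> k; apply/mapP; exists (0%MM, U_(k)%MM).
    by rewrite mem_cat map_f ?mem_enum.
  by apply/ffunP => j; rewrite !ffunE /= mnm0E mnm1E subr0 eq_sym; case: eqP.
exists [multinom W k | k < n]; split=> [k|p pp]; first by rewrite mnmE.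
have weightE u : weight [multinom W k | k < n] u = weight W u.
  by apply: eq_bigr => k _; rewrite mnmE.
rewrite !weightE.
have /WA : diff p \in A by apply: map_f; rewrite mem_cat pp orbT.
have wE u : ((weight W u)%:Z = \sum_(k < n) (W k * u k)%N%:Z)%R.
  exact: (big_morph Posz PoszD (erefl _)).
have -> : (\sum_k (W k)%:Z * diff p k = (weight W p.2)%:Z - (weight W p.1)%:Z)%R.
  by rewrite !wE -sumrB; apply: eq_bigr => k _; rewrite ffunE !PoszM mulrBr.
by rewrite Num.Theory.subr_gt0 ltz_nat.
Qed.
End WeightOrder.

(** * Base-[Q] codes of monomials *)

Section Codes.
Variable n : nat.
Implicit Types (u v : 'X_{1..n}) (Q p : nat).

Definition code Q u : nat := \sum_(k < n) u k * Q ^ k.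
Definition decode Q p : 'X_{1..n} := [multinom p %/ Q ^ k %% Q | k < n].

Lemma codeD Q u v : code Q (u + v)%MM = code Q u + code Q v.
Proof. by rewrite -big_split; apply: eq_bigr => k _; rewrite mnmDE mulnDl. Qed.

Lemma digits_lt Q m (f : nat -> nat) :
  (forall k, k < m -> f k < Q) -> \sum_(k < m) f k * Q ^ k < Q ^ m.
Proof.
elim: m => [_|m IH h]; first by rewrite big_ord0.
rewrite big_ord_recr /= expnS.
have := IH (fun k hk => h k (ltnW hk)); have := h m (leqnn _).
move: (\sum_(k < m) _) (Q ^ m) => x y; nia.
Qed.

Lemma digits_div Q m (f : nat -> nat) j :
  (forall k, k < m -> f k < Q) -> j < m ->
  (\sum_(k < m) f k * Q ^ k) %/ Q ^ j %% Q = f j.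
Proof.
elim: m => // m IH h; rewrite ltnS leq_eqVlt big_ord_recr /= => lj.
have Q0 : 0 < Q by apply: leq_trans (h m (leqnn _)).
have hm := digits_lt (fun k hk => h k (ltnW hk)).
case/predU1P: lj => [->|lj].
  by rewrite divnDMl ?expn_gt0 ?Q0 // divn_small // add0n modn_small ?h.
rewrite -(IH (fun k hk => h k (ltnW hk)) lj).
have -> : Q ^ m = Q ^ (m - j).-1 * Q * Q ^ j.
  by rewrite -expnSr -expnD prednK ?subn_gt0 // subnK // ltnW.
by rewrite !mulnA divnDMl ?expn_gt0 ?Q0 // addnC modnMDl.
Qed.

Lemma digits_sum Q m p : \sum_(k < m) (p %/ Q ^ k %% Q) * Q ^ k + p %/ Q ^ m * Q ^ m = p.
Proof.
elim: m => [|m IH]; first by rewrite big_ord0 expn0 divn1 muln1.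
rewrite big_ord_recr /= -addnA -[RHS]IH; congr addn.
rewrite expnSr divnMA; move: (p %/ Q ^ m) => x.
by rewrite [in RHS](divn_eq x Q) mulnDl addnC mulnCA mulnC mulnAC.
Qed.

(** Transport of the digit lemmas, which speak of functions on [nat]. *)
Lemma codeE Q u : code Q u = \sum_(k < n) nth 0 u k * Q ^ k.
Proof. by apply: eq_bigr => k _; rewrite (mnm_nth 0). Qed.

Lemma nth_mnm_lt Q u k : (forall j, u j < Q) -> k < n -> nth 0 u k < Q.
Proof. by move=> h kn; have := h (Ordinal kn); rewrite (mnm_nth 0). Qed.

Lemma code_lt Q u : (forall k, u k < Q) -> code Q u < Q ^ n.
Proof. by move=> h; rewrite codeE; apply: digits_lt => k; apply: nth_mnm_lt. Qed.

Lemma codeK Q u : (forall k, u k < Q) -> decode Q (code Q u) = u.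
Proof.
move=> h; apply/mnmP => k; rewrite mnmE codeE digits_div ?(mnm_nth 0) //.
by move=> j; apply: nth_mnm_lt.
Qed.

Lemma decodeK Q p : p < Q ^ n -> code Q (decode Q p) = p.
Proof.
move=> h; rewrite -[RHS](digits_sum Q n p) divn_small // addn0.
by apply: eq_bigr => k _; rewrite mnmE.
Qed.

Lemma decode_lt Q p k : 0 < Q -> decode Q p k < Q.
Proof. by move=> Q0; rewrite mnmE ltn_pmod. Qed.

(** Breaking the ties of a weight by the code makes all monomials with
    exponents below [Q] comparable without changing strict comparisons. *)
Definition refine Q (w : 'I_n -> nat) (k : 'I_n) : nat := w k * Q ^ n + Q ^ k.

Lemma weight_refine Q w u : weight (refine Q w) u = weight w u * Q ^ n + code Q u.
Proof.
rewrite /weight /code big_distrl -big_split; apply: eq_bigr => k _ /=.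
by rewrite /refine mulnDl mulnAC [Q ^ k * _]mulnC.
Qed.

Lemma weight_refine_lt Q w u v :
  (forall k, u k < Q) -> weight w u < weight w v ->
  weight (refine Q w) u < weight (refine Q w) v.
Proof.
move=> /code_lt cu; rewrite !weight_refine => lt.
apply: leq_trans (leq_addr _ _); apply: leq_trans (_ : (weight w u).+1 * Q ^ n <= _).
  by rewrite mulSn addnC ltn_add2r.
by rewrite leq_mul2r lt orbT.
Qed.

Lemma weight_refine_inj Q w u v :
  (forall k, u k < Q) -> (forall k, v k < Q) ->
  weight (refine Q w) u = weight (refine Q w) v -> u = v.
Proof.
move=> hu hv; rewrite !weight_refine => /(congr1 (modn^~ (Q ^ n))).
rewrite /= !modnMDl !modn_small ?code_lt // => /(congr1 (decode Q)).
by rewrite !codeK.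
Qed.
End Codes.

Lemma leq_expl a b m : a <= b -> a ^ m <= b ^ m.
Proof. by move=> h; case: m => // m; rewrite leq_exp2r. Qed.

Lemma leq_factXX m : m`! <= m ^ m.
Proof.
elim: m => // m IH; rewrite factS expnS leq_mul2l /= (leq_trans IH) //.
exact: leq_expl.
Qed.

(** * Detection by comparing dimensions *)

Section Detection.
Local Open Scope ring_scope.
Variables (n : nat) (K : fieldType) (F : seq {mpoly K[n]}) (D : nat).
Hypothesis homogF : forall f, f \in F -> exists k, f \is k.-homog.
Hypothesis D0 : (0 < D)%N.
Hypothesis degF : forall f, f \in F -> ((msize f).-1 <= D)%N.

(** One number that bounds the degree in [generated_beyond_bound], the weights
    in [term_order_weight] and the exponents of the generators, so that the same
    radix serves for coding monomials and for listing weights. *)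
Definition trunc_deg : nat := ((D * (2 * n + 1)) ^ n.+1)%N.
Definition radix : nat := trunc_deg.+1.

(** The leading terms of the generators for the weight [w], ties being broken. *)
Definition initial_gens (w : 'I_n -> nat) (i : nat) : {mpoly K[n]} :=
  let u := in_mon (weight_le (refine radix w)) (gens F i) in
  (gens F i)@_u *: 'X_[u].

Local Notation act := (active F).
Local Notation delta := (gens_deg F).

Lemma active_homog i : act i -> gens F i \is (delta i).-homog.
Proof.
case/andP=> si _; have [k hk] := homogF (mem_nth 0 si).
exact: dhomog_msize hk.
Qed.

Lemma active_mem i : act i -> gens F i \in F.
Proof. by case/andP=> si _; apply: mem_nth. Qed.

Lemma supp_deg f u : f \in F -> u \in msupp f -> (mdeg u <= D)%N.
Proof. by move=> /degF h /msize_mdeg_lt; lia. Qed.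

Lemma trunc_deg_words : (D * (2 * n * D).+1 ^ n <= trunc_deg)%N.
Proof.
rewrite /trunc_deg expnS leq_mul ?leq_pmulr ?addn1 //.
by apply: leq_expl; rewrite mulnS mulnC -addn1 addnC leq_add.
Qed.

Lemma trunc_deg_weight : (n`! * D ^ n.-1 <= trunc_deg)%N.
Proof.
rewrite /trunc_deg expnS (leq_trans (_ : _ <= (D * (2 * n + 1)) ^ n)%N) //.
  rewrite expnMn mulnC leq_mul //; first by rewrite leq_pexp2l // leq_pred.
  rewrite (leq_trans (leq_factXX n)) //.
  by apply: leq_expl; lia.
by rewrite leq_pmull // muln_gt0 D0 addn1.
Qed.

Lemma trunc_deg_ge : (D <= trunc_deg)%N.
Proof.
apply: leq_trans trunc_deg_words.
by rewrite leq_pmulr // expn_gt0.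
Qed.

Lemma mnm_le_mdeg (u : 'X_{1..n}) k : (u k <= mdeg u)%N.
Proof. by rewrite mdegE (bigD1 k) //= leq_addr. Qed.

Lemma supp_radix f u k : f \in F -> u \in msupp f -> (u k < radix)%N.
Proof.
move=> fF /(supp_deg fF) h; rewrite ltnS.
exact: leq_trans (mnm_le_mdeg u k) (leq_trans h trunc_deg_ge).
Qed.

(** A suitable term order and the weight that represents it on the supports
    choose the same initial monomials of generators, so they give the same
    truncated initial algebra. *)
Lemma detectable_dims r : sagbi_detectable F ->
  has_dim (truncated act delta (gens F) trunc_deg) r ->
  exists2 w : 'X_{1..n}, (forall k, (w k < radix)%N) &
    forall r', has_dim (truncated act delta (initial_gens w) trunc_deg) r' -> r' = r.
Proof.
move=> [le [tord /(sagbi_basisP F le) gen]] dimr.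
pose pairs := flatten [seq [seq (u, in_mon le f) | u <- msupp f & u != in_mon le f] | f <- F].
have [p|w [wb wlt]] := @term_order_weight n le D pairs tord D0.
  case/flatten_mapP=> f fF /mapP[u]; rewrite mem_filter => /andP[nu uf] -> /=.
  have f0 : f != 0 by rewrite -msupp_eq0; apply: contraL uf => /eqP->.
  by rewrite /lt_of nu (in_mon_ge tord uf) !(supp_deg fF) // (in_mon_supp tord).
exists w => [k|r' dimr'].
  by rewrite ltnS (leq_trans (wb k)) // trunc_deg_weight.
have same f : f \in F -> f != 0 -> in_mon (weight_le (refine radix w)) f = in_mon le f.
  move=> fF f0; apply: (in_mon_eq (weight_le_term_order _)).
    exact: in_mon_coef.
  move=> v; rewrite -mcoeff_msupp => vf; have [->|nv] := eqVneq v (in_mon le f).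
    exact: to_refl (weight_le_term_order _) _.
  apply/orP; left; apply: weight_refine_lt; first by move=> k; apply: supp_radix fF vf.
  apply: (wlt (v, in_mon le f)); apply/flatten_mapP; exists f => //.
  by apply: map_f; rewrite mem_filter nv.
apply/esym; have nz := @active_nz n K F.
pose c' i := (gens F i)@_(in_mon le (gens F i)).
have := dimension_criterion active_homog nz tord (g' := initial_gens w) (c' := c') _ _ dimr dimr'.
case=> [i /nz|i ai|_ ->//]; first exact: in_mon_coef.
  by rewrite /initial_gens same ?active_mem // nz.
by move=> h Sh; apply: gen; apply: lin_span_mono Sh => l [].
Qed.

(** Every weight comes from a term order, and equality of dimensions up to
    degree [trunc_deg] propagates to all degrees. *)
Lemma dims_detectable r w :
  has_dim (truncated act delta (gens F) trunc_deg) r ->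
  has_dim (truncated act delta (initial_gens w) trunc_deg) r ->
  sagbi_detectable F.
Proof.
move=> dimr dimr'; have tord := weight_le_term_order (refine radix w).
exists (weight_le (refine radix w)); split=> //; apply/sagbi_basisP.
have nz := @active_nz n K F.
apply: (generated_beyond_bound active_homog nz tord (d := D) (E := trunc_deg)).
- move=> i k ai; apply: leq_trans (mnm_le_mdeg _ _) _.
  exact: (supp_deg (active_mem ai) (in_mon_supp tord (nz _ ai))).
- by move=> i ai; apply: degF (active_mem ai).
- exact: trunc_deg_words.
pose c' i := (gens F i)@_(in_mon (weight_le (refine radix w)) (gens F i)).
have := dimension_criterion active_homog nz tord (g' := initial_gens w) (c' := c') _ _ dimr dimr'.
by case=> [i /nz|//|/(_ erefl) h _ //]; apply: in_mon_coef.
Qed.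
End Detection.

(** * The dimension subroutine *)

(* Memory layout. Input: [aS] is the number of polynomials. Derived from it:
   [aT] is the number of terms; for a term, [aOwn] is the index of its polynomial
   and [aCode] the code of its monomial; [aDeg] holds the degrees of the
   polynomials, [aD] a bound for them; [aE] is the truncation degree, [aQ] the
   radix, [aM] the number of codes. The basis under construction has [aR] rows,
   with pivots [aPiv] and degrees [aBdeg]; [aFound] and [aPv] return the result
   of the search for a pivot. The x-variables are loop counters.
   Field elements: [kCoef] are the coefficients of the terms, [kBasis] the rows
   of the basis one after the other, [kRow] the row that is being reduced and
   [kRatio] the current elimination factor. *)


Notation aS := 0 (only parsing).
Notation aT := 3 (only parsing).
Notation aOwn := 4 (only parsing).
Notation aDeg := 5 (only parsing).
Notation aD := 6 (only parsing).
Notation aQ := 7 (only parsing).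
Notation aM := 8 (only parsing).
Notation aE := 9 (only parsing).
Notation aCode := 10 (only parsing).
Notation aR := 11 (only parsing).
Notation aPiv := 12 (only parsing).
Notation aBdeg := 13 (only parsing).
Notation xI := 14 (only parsing).
Notation xJ := 15 (only parsing).
Notation xT := 16 (only parsing).
Notation xP := 17 (only parsing).
Notation xQ := 18 (only parsing).
Notation aFound := 19 (only parsing).
Notation aPv := 20 (only parsing).
Notation kCoef := 1 (only parsing).
Notation kBasis := 2 (only parsing).
Notation kRatio := 3 (only parsing).
Notation kRow := 4 (only parsing).

Definition basis_at (q p : nexp) : kexp := KLoad kBasis (NAdd (NMul q (var aM)) p).
Definition row_at (p : nexp) : kexp := KLoad kRow p.

Definition clear_row : cmd := For xP (var aM) (KStore kRow (var xP) KZero).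

Definition add_shifted : cmd :=
  For xP (var aM)
    (If (BNle (NLoad aCode (var xT)) (var xP))
        (KStore kRow (var xP)
           (KAdd (row_at (var xP))
                 (KMul (KLoad kCoef (var xT))
                       (basis_at (var xJ) (NSub (var xP) (NLoad aCode (var xT)))))))
        Skip).

(** [kRow] accumulates the product of row [xJ] and polynomial [xI], one term of
    the polynomial at a time. *)
Definition multiply : cmd :=
  For xT (var aT)
    (If (BNeq (NLoad aOwn (var xT)) (var xI)) add_shifted Skip).

Definition subtract_multiple : cmd :=
  For xP (var aM)
    (KStore kRow (var xP)
       (KSub (row_at (var xP))
             (KMul (KLoad kRatio (NConst 0)) (basis_at (var xQ) (var xP))))).

Definition reduce_row : cmd :=
  For xQ (var aR)
    (Seq (KStore kRatio (NConst 0)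
            (KDiv (row_at (NLoad aPiv (var xQ)))
                  (basis_at (var xQ) (NLoad aPiv (var xQ)))))
         subtract_multiple).

Definition find_pivot : cmd :=
  Seq (NStore aFound (NConst 0) (NConst 0))
      (For xP (var aM)
         (If (BNot (BKeq (row_at (var xP)) KZero))
             (Seq (NStore aFound (NConst 0) (NConst 1))
                  (NStore aPv (NConst 0) (var xP)))
             Skip)).

Definition append_row : cmd :=
  Seq (For xP (var aM)
         (KStore kBasis (NAdd (NMul (var aR) (var aM)) (var xP)) (row_at (var xP))))
  (Seq (NStore aPiv (var aR) (var aPv))
  (Seq (NStore aBdeg (var aR) (NAdd (NLoad aBdeg (var xJ)) (NLoad aDeg (var xI))))
       (NStore aR (NConst 0) (NAdd (var aR) (NConst 1))))).

Definition extend_basis : cmd :=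
  Seq clear_row (Seq multiply (Seq reduce_row (Seq find_pivot
    (If (BNeq (var aFound) (NConst 1)) append_row Skip)))).

(** The basis serves as a queue: rows are multiplied by all generators in the
    order in which they were appended. There are never more than [aM] rows, so a
    counted loop with a guard reaches all of them. *)
Definition close_basis : cmd :=
  For xJ (var aM)
    (If (BNle (NAdd (var xJ) (NConst 1)) (var aR))
        (For xI (var aS)
           (If (BAnd (BNle (NConst 1) (NLoad aDeg (var xI)))
                     (BNle (NAdd (NLoad aBdeg (var xJ)) (NLoad aDeg (var xI))) (var aE)))
               extend_basis Skip))
        Skip).

Definition dimension_cmd : cmd :=
  Seq (For xP (var aM) (KStore kBasis (var xP) KZero))
  (Seq (KStore kBasis (NConst 0) KOne)
  (Seq (NStore aPiv (NConst 0) (NConst 0))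
  (Seq (NStore aBdeg (NConst 0) (NConst 0))
  (Seq (NStore aR (NConst 0) (NConst 1))
       close_basis)))).

Section Dimension.
Local Open Scope ring_scope.
Variables (n : nat) (K : fieldType) (B s T E : nat).
Variables (own delta : nat -> nat) (ex : nat -> 'X_{1..n}) (kc : nat -> K).
Let Q := E.+1.
Let M := (Q ^ n)%N.
Hypothesis ex_deg : forall t, (t < T)%N -> mdeg (ex t) = delta (own t).
Hypotheses (MB : (M <= B)%N) (TB : (T <= B)%N) (sB : (s <= B)%N).

(** The polynomials as the program sees them: a list of terms with owners. *)
Definition term_gen (i : nat) : {mpoly K[n]} :=
  \sum_(t < T | own t == i) kc t *: 'X_[ex t].
Definition gen_active : pred nat := fun i => (i < s)%N && (0 < delta i)%N.

Local Notation gen := term_gen.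
Local Notation W := (truncated gen_active delta gen).
Local Notation dec := (decode n Q).
Implicit Types (st : state K) (h : {mpoly K[n]}).

Definition dim_env st : Prop :=
  [/\ [/\ nmem st aS 0 = s, nmem st aT 0 = T, nmem st aM 0 = M & nmem st aE 0 = E],
      forall t, (t < T)%N -> nmem st aOwn t = own t,
      forall t, (t < T)%N -> nmem st aCode t = code Q (ex t),
      forall i, (i < s)%N -> nmem st aDeg i = delta i
    & forall t, (t < T)%N -> kmem st kCoef t = kc t].

Lemma dim_env_frame c st st' :
  frame c st st' ->
  all (fun a => a \notin nwrites c) [:: aS; aT; aOwn; aDeg; aM; aE; aCode] ->
  kCoef \notin kwrites c -> dim_env st -> dim_env st'.
Proof.
move=> [fn fk] /= /and5P[h0 h3 h4 h5 /and4P[h8 h9 h10 _]] h1 [[e1 e2 e3 e4] e5 e6 e7 e8].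
by split; [split|..] => *; rewrite ?fn ?fk //; [apply: e5|apply: e6|apply: e7|apply: e8].
Qed.

Definition stored_row (row : nat -> K) h : Prop :=
  forall p, (p < M)%N -> row p = h@_(dec p).

Lemma homog_radix k h u : h \is k.-homog -> (k <= E)%N -> h@_u != 0 ->
  forall j, (u j < Q)%N.
Proof.
move=> hh kE; rewrite -mcoeff_msupp => /(dhomogP _ _ _ hh) du j.
by rewrite ltnS (leq_trans _ kE) // -du; apply: mnm_le_mdeg.
Qed.

Lemma homog_eq0 k h : h \is k.-homog -> (k <= E)%N ->
  (forall p, (p < M)%N -> h@_(dec p) = 0) -> h = 0.
Proof.
move=> hh kE h0; apply/mpolyP => u; rewrite mcoeff0; apply/eqP.
apply: contraT => hu; have uQ := homog_radix hh kE hu.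
by move: hu; rewrite -(codeK uQ) h0 ?eqxx // code_lt.
Qed.

(** Multiplication by a monomial shifts codes: no carry occurs, since the
    degrees stay below [Q]. *)
Lemma shifted_coef k h (e : 'X_{1..n}) p :
  h \is k.-homog -> (k + mdeg e <= E)%N -> (p < M)%N ->
  (h * 'X_[e])@_(dec p) =
  if (code Q e <= p)%N then h@_(dec (p - code Q e)) else 0.
Proof.
move=> hh kE pM.
have decQ p' j : (dec p' j < Q)%N by apply: decode_lt.
have [le|nle] := boolP (e <= dec p)%MM.
  rewrite -{1}(submK le) addmC mcoeffMX.
  have cp : code Q (dec p - e)%MM = (p - code Q e)%N.
    by rewrite -{2}(decodeK pM) -{2}(submK le) codeD addnK.
  have -> : (code Q e <= p)%N.
    by rewrite -(decodeK pM) -(submK le) codeD leq_addl.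
  rewrite -cp codeK // => j; apply: leq_ltn_trans (decQ p j).
  by rewrite mnmBE leq_subr.
have -> : (h * 'X_[e])@_(dec p) = 0.
  apply: memN_msupp_eq0; apply: contra nle => /msuppM_le/allpairsP[[a b] /= [_]].
  by rewrite msuppX inE => /eqP-> ->; apply: lem_addl.
case: leqP => // cep; apply/eqP; rewrite eq_sym; apply: contraR nle => nz.
set v := dec _ in nz.
have dv : mdeg v = k by apply: (dhomogP _ _ _ hh); rewrite mcoeff_msupp.
have vQ j : ((v + e)%MM j < Q)%N.
  by rewrite ltnS (leq_trans (mnm_le_mdeg _ j)) // mdegD dv.
suff -> : dec p = (v + e)%MM by apply: lem_addl.
rewrite -(codeK vQ) codeD decodeK ?subnK //.
by apply: leq_ltn_trans pM; apply: leq_subr.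
Qed.

(** The triangular shape, in which a pivot vanishes in all later members, is what
    reducing each row by its predecessors in order produces. *)
Definition basis_ok r (bs : nat -> {mpoly K[n]}) (pv bd : nat -> nat) : Prop :=
  forall q, (q < r)%N ->
    [/\ (pv q < M)%N, (bd q <= E)%N, bs q \is (bd q).-homog, W (bd q) (bs q)
      & (bs q)@_(dec (pv q)) != 0 /\
        forall q', (q' < q)%N -> (bs q)@_(dec (pv q')) = 0].

Definition stored_basis st r (bs : nat -> {mpoly K[n]}) (pv bd : nat -> nat) : Prop :=
  [/\ nmem st aR 0 = r, forall q, (q < r)%N -> nmem st aPiv q = pv q,
      forall q, (q < r)%N -> nmem st aBdeg q = bd q
    & forall q, (q < r)%N -> stored_row (fun p => kmem st kBasis (q * M + p)%N) (bs q)].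

Lemma stored_basis_frame c st st' r bs pv bd :
  frame c st st' -> all (fun a => a \notin nwrites c) [:: aR; aPiv; aBdeg] ->
  kBasis \notin kwrites c -> stored_basis st r bs pv bd -> stored_basis st' r bs pv bd.
Proof.
move=> [fn fk] /= /and4P[h1 h2 h3 _] h4 [e1 e2 e3 e4].
split=> [|q qr|q qr|q qr p pM]; rewrite ?fn ?fk //; [exact: e2|exact: e3|exact: e4].
Qed.

(** The first nonzero coefficient of a vanishing combination is detected by the
    pivot of its member. *)
Lemma basis_free r bs pv bd : basis_ok r bs pv bd -> free_family (fun q : 'I_r => bs q).
Proof.
move=> ok x sx q; apply/eqP; apply: contraT => xq.
case: (@arg_minnP _ q (fun q => x q != 0) val xq) => p xp minp.
have [_ _ _ _ [pp _]] := ok p (ltn_ord p).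
move/(congr1 (mcoeff (dec (pv p)))): sx; rewrite raddf_sum (bigD1 p) //= mcoeff0.
rewrite big1 => [|p' np]; first by rewrite addr0 mcoeffZ => /eqP; rewrite mulf_eq0 (negbTE xp) (negbTE pp).
rewrite mcoeffZ; case: (eqVneq (x p') 0) => [->|/minp lep]; first by rewrite mul0r.
have [_ _ _ _ [_ ->]] := ok p' (ltn_ord p'); first by rewrite mulr0.
by rewrite ltn_neqAle lep andbT; apply: contra np => /eqP/val_inj->.
Qed.

(** The pivots are pairwise distinct codes. *)
Lemma basis_size r bs pv bd : basis_ok r bs pv bd -> (r <= M)%N.
Proof.
move=> ok; pose f (q : 'I_r) := inord (pv q) : 'I_M.-1.+1.
have M0 : (0 < M)%N by rewrite expn_gt0.
rewrite -[M](prednK M0) -[r]card_ord -[X in (_ <= X)%N]card_ord; apply: (@leq_card _ _ f) => q1 q2.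
move=> /(congr1 val); rewrite /= !inordK; last 2 first.
- by rewrite prednK //; have [] := ok q2 (ltn_ord q2).
- by rewrite prednK //; have [] := ok q1 (ltn_ord q1).
move=> e; apply: val_inj => /=; case: (ltngtP q1 q2) => // lt.
  by have [_ _ _ _ [nz z]] := ok q2 (ltn_ord q2); rewrite -e z ?eqxx in nz.
by have [_ _ _ _ [nz z]] := ok q1 (ltn_ord q1); rewrite e z ?eqxx in nz.
Qed.

Definition basis_span r (bs : nat -> {mpoly K[n]}) (bd : nat -> nat) k :=
  lin_span bs (fun q => (q < r)%N /\ bd q = k).

(** By induction on words, every product of generators lies in the span of the
    members of its own degree. Keeping track of this degree is what allows the
    next factor to be applied: the members involved can be multiplied by it
    without leaving the degrees up to [E]. *)
Lemma closed_basis_dim r bs pv bd :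
  basis_ok r bs pv bd -> (0 < r)%N -> bs 0 = 1 -> bd 0 = 0%N ->
  (forall j i, (j < r)%N -> gen_active i -> (bd j + delta i <= E)%N ->
     basis_span r bs bd (bd j + delta i) (bs j * gen i)) ->
  has_dim (W E) r.
Proof.
move=> ok r0 bs0 bd0 closed; exists (fun q : 'I_r => bs q); split.
- move=> q; have [_ dE _ Wq _] := ok q (ltn_ord q).
  exact: truncated_mono dE Wq.
- have word l : all gen_active l -> (wdeg delta l <= E)%N ->
      basis_span r bs bd (wdeg delta l) (wprod gen l).
    elim: l => [_ _|i l IH /= /andP[ai al]].
      rewrite /wprod /wdeg !big_nil -bs0; apply: lin_span_gen; by [].
    rewrite /wdeg big_cons -/(wdeg delta l) => dE.
    have {IH} := IH al (leq_trans (leq_addl _ _) dE).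
    rewrite /wprod big_cons -/(wprod gen l) mulrC.
    elim=> [|c q h [qr dq] _ IHh]; first by rewrite mul0r; apply: lin_span0.
    rewrite mulrDl -scalerAl; apply: lin_spanD => //; apply: lin_spanZ.
    by rewrite addnC -dq; apply: closed => //; rewrite dq addnC.
  move=> h; elim=> [|c l h' [al dl] _ [x ->]].
    by exists (fun=> 0); rewrite big1 // => q _; rewrite scale0r.
  have [y ->] : exists y : 'I_r -> K, wprod gen l = \sum_q y q *: bs q.
    elim: (word l al dl) => [|c0 q h0 [qr _] _ [y ->]].
      by exists (fun=> 0); rewrite big1 // => q _; rewrite scale0r.
    exists (fun q' => (if q' == Ordinal qr then c0 else 0) + y q').
    under [RHS]eq_bigr do rewrite scalerDl.
    rewrite big_split /=; congr +%R; rewrite (bigD1 (Ordinal qr)) //= eqxx big1 ?addr0 //.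
    by move=> q' /negbTE->; rewrite scale0r.
  exists (fun q => c * y q + x q); under [RHS]eq_bigr do rewrite scalerDl -scalerA.
  by rewrite big_split -scaler_sumr.
- exact: basis_free ok.
Qed.
End Dimension.

Section DimensionRun.
Local Open Scope ring_scope.
Variables (n : nat) (K : fieldType) (B s T E : nat).
Variables (own delta : nat -> nat) (ex : nat -> 'X_{1..n}) (kc : nat -> K).
Let Q := E.+1.
Let M := (Q ^ n)%N.
Hypothesis ex_deg : forall t, (t < T)%N -> mdeg (ex t) = delta (own t).
Hypotheses (MB : (M <= B)%N) (TB : (T <= B)%N) (sB : (s <= B)%N).

Local Notation gen := (term_gen T own ex kc).
Local Notation gact := (gen_active s delta).
Local Notation W := (truncated gact delta gen).
Local Notation dec := (decode n Q).
Local Notation env := (dim_env s T E own delta ex kc).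
Local Notation row_is := (@stored_row n K E).
Local Notation triple := (triple B).
Implicit Types (st : state K) (h : {mpoly K[n]}).

Lemma env_M c st st' : env st -> frame c st st' -> aM \notin nwrites c ->
  neval st' (var aM) = M.
Proof. by move=> [[_ _ e _] _ _ _ _] [fn _] hM; rewrite /= fn. Qed.

Lemma clear_row_spec st : env st ->
  triple st clear_row (fun st' => row_is (kmem st' kRow) 0).
Proof.
move=> e; apply: triple_post (_ : forall st', _ -> (forall p, (p < M)%N -> kmem st' kRow p = 0) -> _).
  apply: (triple_for (hv := M)
    (I := fun j st' => forall p, (p < j)%N -> kmem st' kRow p = 0)) => //.
    by move=> st' fr; apply: env_M e fr _.
  move=> j st' jM fr hj I; apply: triple_kstore => p /=.
  rewrite /upd hj ltnS leq_eqVlt; case: eqP => //= _; exact: I.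
by move=> st' _ h p pM; rewrite mcoeff0 h.
Qed.

Lemma add_shifted_spec st t j k b acc :
  env st -> (t < T)%N -> nmem st xT 0 = t -> nmem st xJ 0 = j ->
  row_is (fun p => kmem st kBasis (j * M + p)%N) b -> b \is k.-homog ->
  (k + mdeg (ex t) <= E)%N -> row_is (kmem st kRow) acc ->
  triple st add_shifted
    (fun st' => row_is (kmem st' kRow) (acc + kc t *: (b * 'X_[ex t]))).
Proof.
move=> e tT ht hj hb homb kE hacc; set new := acc + _.
pose I q st' := forall p, (p < M)%N ->
  kmem st' kRow p = if (p < q)%N then new@_(dec p) else acc@_(dec p).
apply: (@triple_post _ _ _ _ (I M)); last first.
  by move=> st' _ h p pM; rewrite h // pM.
apply: triple_for => //.
- by move=> st' fr; apply: env_M e fr _.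
- move=> p st' pM fr hp Ip; have [fn fk] := fr.
  have [[_ _ eM _] _ eC _ ek] := e.
  have cE : neval st' (NLoad aCode (var xT)) = code Q (ex t).
    by rewrite /= !fn // ht eC.
  have newE : new@_(dec p) = acc@_(dec p) + kc t *
      (if (code Q (ex t) <= p)%N then b@_(dec (p - code Q (ex t))) else 0).
    by rewrite mcoeffD mcoeffZ (shifted_coef homb).
  apply: triple_if => hc.
    have cep : (code Q (ex t) <= p)%N by move: hc; rewrite [beval _ _]/= -/(neval st' (NLoad aCode (var xT))) cE hp.
    apply: triple_kstore => p' p'M /=; rewrite /upd /= hp ltnS.
    have [->|ne] := eqVneq p' p; last by rewrite Ip // [in RHS]leq_eqVlt (negbTE ne).
    rewrite leqnn newE cep Ip // ltnn !fn // !fk // eM hj ht eC // ek // hb //.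
    exact: leq_ltn_trans (leq_subr _ _) pM.
  apply: triple_skip => p' p'M; rewrite Ip // ltnS [in RHS]leq_eqVlt.
  have [->|//] := eqVneq p' p; rewrite ltnn newE ifF ?mulr0 ?addr0 //.
  by move: hc; rewrite [beval _ _]/= -/(neval st' (NLoad aCode (var xT))) cE hp => /negbTE.
Qed.

Lemma multiply_spec st i j k b :
  env st -> (i < s)%N -> nmem st xI 0 = i -> nmem st xJ 0 = j ->
  row_is (fun p => kmem st kBasis (j * M + p)%N) b -> b \is k.-homog ->
  (k + delta i <= E)%N -> row_is (kmem st kRow) 0 ->
  triple st multiply (fun st' => row_is (kmem st' kRow) (b * gen i)).
Proof.
move=> e si hi hj hb homb kE h0.
pose part t := \sum_(t' < t) (if own t' == i then kc t' *: (b * 'X_[ex t']) else 0).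
pose I t st' := row_is (kmem st' kRow) (part t).
apply: (@triple_post _ _ _ _ (I T)); last first.
  move=> st' _; rewrite /I (_ : part T = b * gen i) //.
  rewrite /term_gen mulr_sumr [in RHS]big_mkcond; apply: eq_bigr => t _.
  by case: eqP => // _; rewrite scalerAr.
have [[_ eT eM _] eO _ _ _] := e.
apply: triple_for => //.
- by move=> st' [fn _]; rewrite /= fn.
- by rewrite /I /part big_ord0.
- move=> t st' tT fr ht It; have [fn fk] := fr.
  have e' : env st' by apply: dim_env_frame fr _ _ e.
  have partS : part t.+1 = part t + (if own t == i then kc t *: (b * 'X_[ex t]) else 0).
    by rewrite /part big_ord_recr.
  have oE : beval st' (BNeq (NLoad aOwn (var xT)) (var xI)) = (own t == i).
    by rewrite /= ht !fn // eO // hi.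
  rewrite /I partS; apply: triple_if; rewrite oE => ho.
    rewrite ho; apply: (add_shifted_spec (j := j) (k := k)) => //.
    + by rewrite fn.
    + by move=> p pM; rewrite fk // hb.
    + by rewrite ex_deg // (eqP ho).
  by apply: triple_skip; rewrite (negbTE ho) addr0.
Qed.

Lemma subtract_multiple_spec st q b h :
  env st -> nmem st xQ 0 = q ->
  row_is (fun p => kmem st kBasis (q * M + p)%N) b -> row_is (kmem st kRow) h ->
  triple st subtract_multiple
    (fun st' => row_is (kmem st' kRow) (h - kmem st kRatio 0 *: b)).
Proof.
move=> e hq hb hh; set new := h - _.
pose I q st' := forall p, (p < M)%N ->
  kmem st' kRow p = if (p < q)%N then new@_(dec p) else h@_(dec p).
apply: (@triple_post _ _ _ _ (I M)); last first.
  by move=> st' _ hI p pM; rewrite hI // pM.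
apply: triple_for => //.
- by move=> st' fr; apply: env_M e fr _.
- move=> p st' pM fr hp Ip; have [fn fk] := fr; have [[_ _ eM _] _ _ _ _] := e.
  apply: triple_kstore => p' p'M /=; rewrite /upd /= hp ltnS.
  have [->|ne] := eqVneq p' p; last by rewrite Ip // [in RHS]leq_eqVlt (negbTE ne).
  by rewrite leqnn Ip // ltnn !fn // !fk // eM hq hb // mcoeffB mcoeffZ.
Qed.

(** Only members of the degree of the row have a nonzero ratio, so the row
    stays homogeneous. *)
Lemma reduce_row_spec st r bs pv bd k h :
  env st -> basis_ok s T E own delta ex kc r bs pv bd ->
  stored_basis E st r bs pv bd -> (r <= M)%N -> (k <= E)%N ->
  h \is k.-homog -> W k h -> row_is (kmem st kRow) h ->
  triple st reduce_row (fun st' => exists h',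
    [/\ row_is (kmem st' kRow) h', h' \is k.-homog, W k h',
        basis_span r bs bd k (h - h')
      & forall q, (q < r)%N -> h'@_(dec (pv q)) = 0]).
Proof.
move=> e ok sb rM kE homh Wh hh; have [eR eP eB eK] := sb.
pose I q st' := exists h',
    [/\ row_is (kmem st' kRow) h', h' \is k.-homog, W k h',
        basis_span r bs bd k (h - h')
      & forall q', (q' < q)%N -> h'@_(dec (pv q')) = 0].
apply: (triple_for (I := I)) => //.
- exact: leq_trans rM MB.
- by move=> st' [fn _]; rewrite /= fn.
- by exists h; split=> //; rewrite subrr; apply: lin_span0.
- move=> q st' qr fr hq [h' [hh' homh' Wh' Sh' z']]; have [fn fk] := fr.
  have [pM qE homq Wq [nzq zq]] := ok q qr.
  have eK' p : (p < M)%N -> kmem st' kBasis (q * M + p) = (bs q)@_(dec p).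
    by move=> pM'; rewrite fk // eK.
  have [[_ _ eM _] _ _ _ _] := e.
  pose c := h'@_(dec (pv q)) / (bs q)@_(dec (pv q)).
  apply: triple_seq; apply: triple_kstore; set st1 := State _ _.
  have c1 : kmem st1 kRatio 0 = c.
    by rewrite /= /upd /= hq !fn // eP // eM hh' // eK'.
  have fr1 : frame reduce_row st st1.
    apply: frame_trans fr _; split=> //= a i ha; rewrite /upd ifF //.
    by move: ha; rewrite !inE negb_or => /andP[/negbTE->].
  have e1 : env st1 by apply: dim_env_frame fr1 _ _ e.
  apply: triple_post (subtract_multiple_spec (q := q) (b := bs q) (h := h') e1 _ _ _) _ => //.
  move=> st2 _; rewrite c1 => h2; exists (h' - c *: bs q).
  have [c0|c0] := eqVneq c 0.
    rewrite c0 scale0r subr0 in h2 *; split=> // q'; rewrite ltnS leq_eqVlt.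
    case/predU1P=> [->|/z' //]; move/eqP: c0; rewrite /c mulf_eq0 invr_eq0.
    by rewrite (negbTE nzq) orbF => /eqP.
  (* Both the row and the member have a monomial at the pivot. *)
  have dq : bd q = k.
    have h0 : h'@_(dec (pv q)) != 0 by apply: contraNneq c0 => z; rewrite /c z mul0r.
    rewrite -mcoeff_msupp in h0; rewrite -mcoeff_msupp in nzq.
    by rewrite -(dhomogP _ _ _ homq _ nzq) (dhomogP _ _ _ homh' _ h0).
  rewrite dq in homq Wq; split=> //.
  + by rewrite rpredB // rpredZ.
  + by apply: lin_spanB => //; apply: lin_spanZ.
  + rewrite opprB addrCA addrC; apply: lin_spanD => //; apply: lin_spanZ.
    by apply: lin_span_gen.
  + move=> q'; rewrite ltnS leq_eqVlt mcoeffB mcoeffZ => /predU1P[->|lt].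
      by rewrite /c divfK // subrr.
    by rewrite z' // zq // mulr0 subrr.
Qed.

Lemma find_pivot_spec st : env st ->
  triple st find_pivot (fun st' =>
    (nmem st' aFound 0 = 1%N /\ (nmem st' aPv 0 < M)%N /\
       kmem st' kRow (nmem st' aPv 0) != 0) \/
    (nmem st' aFound 0 = 0%N /\ forall p, (p < M)%N -> kmem st' kRow p = 0)).
Proof.
move=> e; apply: triple_seq; apply: triple_nstore; set st1 := State _ _.
have e1 : env st1.
  apply: (dim_env_frame (c := find_pivot)) e => //; split=> //= a i ha; rewrite /upd ifF //.
  by move: ha; rewrite !inE negb_or => /andP[/negbTE->].
pose I q st' :=
    (nmem st' aFound 0 = 1%N /\ (nmem st' aPv 0 < M)%N /\
       kmem st' kRow (nmem st' aPv 0) != 0) \/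
    (nmem st' aFound 0 = 0%N /\ forall p, (p < q)%N -> kmem st' kRow p = 0).
apply: (triple_for (I := I)) => //.
- by move=> st' fr; apply: env_M e1 fr _.
- by right.
- move=> p st' pM fr hp Ip; apply: triple_if => hc.
    apply: triple_seq; apply: triple_nstore; apply: triple_nstore; left => /=.
    by rewrite /upd /= hp; split=> //; split=> //; move: hc; rewrite /= hp.
  apply: triple_skip; case: Ip => [Ip|[f0 Ip]]; [by left|right; split=> // p'].
  rewrite ltnS leq_eqVlt => /predU1P[->|/Ip //].
  by move: hc; rewrite /= hp negbK => /eqP.
Qed.

Local Notation ok := (basis_ok s T E own delta ex kc).

Definition set_at (X : Type) (f : nat -> X) (r : nat) (x : X) : nat -> X :=
  fun q => if q == r then x else f q.

Lemma append_row_spec st r bs pv bd i j p0 h :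
  env st -> stored_basis E st r bs pv bd -> (j < r)%N -> (i < s)%N ->
  nmem st xI 0 = i -> nmem st xJ 0 = j -> nmem st aPv 0 = p0 ->
  row_is (kmem st kRow) h ->
  triple st append_row (fun st' => stored_basis E st' r.+1 (set_at bs r h)
    (set_at pv r p0) (set_at bd r (bd j + delta i)%N)).
Proof.
move=> e [eR eP eB eK] jr si hi hj hp0 hh; have [[_ _ eM _] _ _ eD _] := e.
pose I q st' := forall q' p, (p < M)%N -> (q' < r)%N || ((q' == r) && (p < q)%N) ->
  kmem st' kBasis (q' * M + p) = (set_at bs r h q')@_(dec p).
apply: triple_seq.
apply: (@triple_post _ _ _ _ (I M)).
  apply: triple_for => //.
  - by move=> st' fr; apply: env_M e fr _.
  - by move=> q p pM; rewrite andbF orbF => qr; rewrite /set_at ltn_eqF // eK.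
  - move=> p st' pM fr hp Ip; have [fn fk] := fr.
    apply: triple_kstore => q' p' p'M hq' /=; rewrite /upd /= (fn aR) // (fn aM) // eR eM hp fk //.
    have [e1|ne] := eqVneq (q' * M + p')%N (r * M + p)%N.
      have [-> ->] : q' = r /\ p' = p.
        have M0 : (0 < M)%N by apply: leq_ltn_trans pM.
        have := congr1 (divn^~ M) e1; have := congr1 (modn^~ M) e1.
        by rewrite /= !modnMDl !modn_small // !divnMDl // !divn_small // !addn0.
      by rewrite /set_at eqxx hh.
    apply: Ip => //; case/orP: hq' => [-> //|/andP[/eqP q'r]].
    rewrite ltnS leq_eqVlt => /predU1P[p'p|->]; last by rewrite q'r eqxx orbT.
    by rewrite q'r p'p eqxx in ne.
move=> st1 [fn fk] I1.
apply: triple_seq; apply: triple_nstore; apply: triple_seq; apply: triple_nstore.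
apply: triple_nstore; split=> /=.
- by rewrite /upd /= fn // eR addn1.
- move=> q qr; rewrite /upd /= !fn // eR /set_at; case: eqP => [_|ne]; first exact: hp0.
  by rewrite eP // ltn_neqAle -ltnS qr andbT; apply/eqP.
- move=> q qr; rewrite /upd /= !fn // eR /set_at; case: eqP => [_|ne].
    by rewrite hj hi eB // eD.
  by rewrite eB // ltn_neqAle -ltnS qr andbT; apply/eqP.
- move=> q qr p pM; rewrite I1 // pM andbT; move: qr; rewrite ltnS leq_eqVlt.
  by rewrite orbC.
Qed.

Lemma basis_span_mono r r' bs bs' bd bd' k h :
  (r <= r')%N -> (forall q, (q < r)%N -> bs' q = bs q /\ bd' q = bd q) ->
  basis_span r bs bd k h -> basis_span r' bs' bd' k h.
Proof.
move=> rr' agree; apply: lin_span_trans => q [qr dq]; have [<- e] := agree q qr.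
by apply: lin_span_gen; rewrite e; split=> //; apply: leq_trans rr'.
Qed.

(** The reduced product either vanishes or becomes a new member; in both cases
    the product lies in the span of the members of its degree. *)
Lemma extend_basis_spec st r bs pv bd i j :
  env st -> ok r bs pv bd -> stored_basis E st r bs pv bd ->
  (j < r)%N -> gact i -> (bd j + delta i <= E)%N ->
  nmem st xI 0 = i -> nmem st xJ 0 = j ->
  triple st extend_basis (fun st' => exists r' bs' pv' bd',
    [/\ ok r' bs' pv' bd', stored_basis E st' r' bs' pv' bd', (r <= r')%N,
        forall q, (q < r)%N -> bs' q = bs q /\ bd' q = bd q
      & basis_span r' bs' bd' (bd j + delta i) (bs j * gen i)]).
Proof.
move=> e okb sb jr gi dE hi hj; set k := (bd j + delta i)%N.
have /andP[si _] := gi; have [_ _ homj Wj _] := okb j jr.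
have homg : gen i \is (delta i).-homog.
  by apply: rpred_sum => t /eqP <-; rewrite rpredZ // dhomogX; apply/eqP/ex_deg.
have homP : bs j * gen i \is k.-homog by apply: dhomogM.
have WP : W k (bs j * gen i).
  apply: (lin_span_mul (v2 := wprod gen) (P2 := fun l => l = [:: i])) Wj _.
    move=> l _ [al dl] ->; rewrite -wprod_cat; apply: lin_span_gen.
    by rewrite all_cat al /= gi wdeg_cat /wdeg big_seq1 leq_add2r.
  have -> : gen i = wprod gen [:: i] by rewrite /wprod big_seq1.
  exact: lin_span_gen.
have [_ _ _ eK] := sb.
apply: triple_seq; apply: triple_post (clear_row_spec e) _ => st1 fr1 h1.
have e1 := dim_env_frame fr1 isT isT e; have sb1 := stored_basis_frame fr1 isT isT sb.
have [fn1 fk1] := fr1.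
apply: triple_seq; apply: (@triple_post _ _ _ _ (fun st' => row_is (kmem st' kRow) (bs j * gen i))).
  apply: (multiply_spec (j := j) (k := bd j)) => //; rewrite ?fn1 //.
  by have [_ _ _ eK1] := sb1; apply: eK1.
move=> st2 fr2 h2.
have e2 := dim_env_frame fr2 isT isT e1; have sb2 := stored_basis_frame fr2 isT isT sb1.
have [fn2 fk2] := fr2.
apply: triple_seq; apply: triple_post
  (reduce_row_spec e2 okb sb2 (basis_size okb) dE homP WP h2) _.
move=> st3 fr3 [h [h3 homh Wh Sh zh]].
have e3 := dim_env_frame fr3 isT isT e2; have sb3 := stored_basis_frame fr3 isT isT sb2.
have [fn3 fk3] := fr3.
apply: triple_seq; apply: triple_post (find_pivot_spec e3) _ => st4 fr4 h4.
have e4 := dim_env_frame fr4 isT isT e3; have sb4 := stored_basis_frame fr4 isT isT sb3.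
have [fn4 fk4] := fr4.
apply: triple_if => /= hf.
  case: h4 => [[f1 [pM nz]]|[f0 _]]; last by rewrite f0 in hf.
  set p0 := nmem st4 aPv 0 in pM nz.
  apply: triple_post (append_row_spec (i := i) (j := j) (p0 := p0) (h := h) e4 sb4 jr si _ _ _ _) _.
  - by rewrite fn4 // fn3 // fn2 // fn1.
  - by rewrite fn4 // fn3 // fn2 // fn1.
  - by [].
  - by move=> p pM'; rewrite fk4 // h3.
  move=> st5 _ sb5; exists r.+1, (set_at bs r h), (set_at pv r p0), (set_at bd r k).
  have old (X : Type) (f : nat -> X) x q : (q < r)%N -> set_at f r x q = f q.
    by move=> qr; rewrite /set_at ltn_eqF.
  have hp0 : h@_(dec p0) != 0 by rewrite -h3 // -fk4.
  split=> //.
  + move=> q; rewrite ltnS leq_eqVlt => /predU1P[->|qr].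
      rewrite /set_at eqxx; split=> //; split=> // q' q'r.
      by rewrite ltn_eqF // zh.
    rewrite !old //; have [b1 b2 b3 b4 [b5 b6]] := okb q qr; split=> //; split=> //.
    by move=> q' q'q; rewrite old ?b6 // (ltn_trans q'q).
  + by move=> q qr; rewrite !old.
  + rewrite -[bs j * gen i](subrK h); apply: lin_spanD.
      by apply: basis_span_mono Sh => // q qr; rewrite !old.
    set bs' := set_at bs r h; have <- : bs' r = h by rewrite /bs' /set_at eqxx.
    by apply: lin_span_gen; rewrite /set_at eqxx.
case: h4 => [[f1 _]|[f0 z]]; first by rewrite f1 in hf.
apply: triple_skip; exists r, bs, pv, bd; split=> //.
have h0 : h = 0.
  by apply: (homog_eq0 homh dE) => p pM; rewrite -h3 // -fk4 // z.
by move: Sh; rewrite h0 subr0.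
Qed.

(** The invariant: the products of the processed rows lie in the span of the
    current basis. It survives later extensions because spans only grow. *)
Lemma close_basis_spec st r bs pv bd :
  env st -> ok r bs pv bd -> stored_basis E st r bs pv bd -> (0 < r)%N ->
  bs 0 = 1 -> bd 0 = 0%N ->
  triple st close_basis (fun st' => has_dim (W E) (nmem st' aR 0)).
Proof.
move=> e okb sb r0 bs0 bd0.
pose closed r bs bd j i := (bd j + delta i <= E)%N ->
  basis_span r bs bd (bd j + delta i) (bs j * gen i).
pose I j st' := exists r bs pv bd,
  [/\ ok r bs pv bd, stored_basis E st' r bs pv bd,
      [/\ (0 < r)%N, bs 0 = 1 & bd 0 = 0%N]
    & forall j' i, (j' < j)%N -> (j' < r)%N -> gact i -> closed r bs bd j' i].
apply: (@triple_post _ _ _ _ (I M)); last first.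
  move=> st' _ [r' [bs' [pv' [bd' [ok' sb' [r'0 bs'0 bd'0] cl]]]]].
  have [-> _ _ _] := sb'; apply: (closed_basis_dim ok' r'0 bs'0 bd'0) => j i jr.
  by apply: cl => //; apply: leq_trans jr (basis_size ok').
apply: triple_for => //.
- by move=> st' fr; apply: env_M e fr _.
- by exists r, bs, pv, bd.
move=> j st' jM fr hj {r bs pv bd okb sb r0 bs0 bd0}.
move=> [r [bs [pv [bd [okb sb [r0 bs0 bd0] cl]]]]].
have e' := dim_env_frame fr isT isT e; have [eR _ _ _] := sb.
apply: triple_if => /=; rewrite hj eR addn1 => jr; last first.
  apply: triple_skip; exists r, bs, pv, bd; split=> // j' i lej.
  case: (ltngtP j' j) lej => [lt _|lt|-> _ h]; [exact: cl|by rewrite ltnNge lt|].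
  by rewrite h in jr.
(* Row [j] has been multiplied by the generators before [i0]. *)
pose I2 i0 st2 := exists r bs pv bd,
  [/\ ok r bs pv bd, stored_basis E st2 r bs pv bd,
      [/\ (0 < r)%N, bs 0 = 1 & bd 0 = 0%N], (j < r)%N
    & forall j' i, (j' < j)%N || ((j' == j) && (i < i0)%N) -> (j' < r)%N -> gact i ->
        closed r bs bd j' i].
apply: (@triple_post _ _ _ _ (I2 s)); last first.
  move=> st2 _ [r2 [bs2 [pv2 [bd2 [ok2 sb2 h2 _ cl2]]]]].
  exists r2, bs2, pv2, bd2; split=> // j' i jj' jr' gi; apply: cl2 => //.
  by have /andP[-> _] := gi; rewrite andbT orbC -leq_eqVlt.
have [[eS _ _ _] _ _ _ _] := e'.
apply: triple_for => //.
- by move=> st2 [fn _]; rewrite /= fn.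
- exists r, bs, pv, bd; split=> // j' i; rewrite andbF orbF; exact: cl.
move=> i st2 si fr2 hi {r bs pv bd okb sb r0 bs0 bd0 cl eR jr}.
move=> [r [bs [pv [bd [okb sb [r0 bs0 bd0] jr cl]]]]].
have e2 := dim_env_frame fr2 isT isT e'; have [fn2 _] := fr2.
have [eR _ eB _] := sb; have [[_ _ _ eE] _ _ eD _] := e2.
have step (r' : nat) bs' pv' bd' st3 :
    ok r' bs' pv' bd' -> stored_basis E st3 r' bs' pv' bd' -> (r <= r')%N ->
    (forall q, (q < r)%N -> bs' q = bs q /\ bd' q = bd q) ->
    (gact i -> closed r' bs' bd' j i) -> I2 i.+1 st3.
  move=> ok' sb' rr' agree cli; exists r', bs', pv', bd'; split=> //.
  - have [-> ->] := agree 0%N r0; split=> //; exact: leq_trans rr'.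
  - exact: leq_trans rr'.
  move=> j' i' hji jr' gi'.
  have j'r : (j' < r)%N.
    by case/orP: hji => [/ltn_trans->//|/andP[/eqP-> _]].
  have old : (j' < j)%N || ((j' == j) && (i' < i)%N) -> closed r' bs' bd' j' i'.
    rewrite /closed; have [-> ->] := agree _ j'r => h dE.
    by apply: basis_span_mono rr' agree _; apply: cl.
  case/orP: hji => [lt|/andP[ej]]; first by apply: old; rewrite lt.
  rewrite ltnS leq_eqVlt => /orP[/eqP ei|lt]; last by apply: old; rewrite ej lt orbT.
  by rewrite (eqP ej) ei; apply: cli; rewrite -ei.
have cond : beval st2 (BAnd (BNle (NConst 1) (NLoad aDeg (var xI)))
     (BNle (NAdd (NLoad aBdeg (var xJ)) (NLoad aDeg (var xI))) (var aE))) =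
   (0 < delta i)%N && (bd j + delta i <= E)%N.
  by rewrite /= hi (fn2 xJ) // hj eB // eD // eE.
apply: triple_if; rewrite cond => hc.
  have /andP[d0 dE] := hc.
  have gi : gact i by rewrite /gen_active si.
  apply: triple_post (extend_basis_spec e2 okb sb jr gi dE hi _) _; first by rewrite fn2.
  move=> st3 _ [r' [bs' [pv' [bd' [ok' sb' rr' agree span']]]]].
  apply: (step r' bs' pv' bd') => // _ _.
  by have [-> ->] := agree j jr.
apply: triple_skip; apply: (step r bs pv bd) => // gi dE.
by case/andP: gi hc => _ ->; rewrite dE.
Qed.

Lemma dimension_spec st : env st ->
  triple st dimension_cmd (fun st' => has_dim (W E) (nmem st' aR 0)).
Proof.
move=> e.
have M0 : (0 < M)%N by rewrite expn_gt0.
apply: triple_seq; apply: (@triple_post _ _ _ _ (fun st' => forall p, (p < M)%N -> kmem st' kBasis p = 0)).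
  apply: (triple_for (hv := M)
    (I := fun j st' => forall p, (p < j)%N -> kmem st' kBasis p = 0)) => //.
    by move=> st' fr; apply: env_M e fr _.
  move=> j st' jM fr hj I; apply: triple_kstore => p /=.
  rewrite /upd hj ltnS leq_eqVlt; case: eqP => //= _; exact: I.
move=> st1 fr1 h1; have e1 := dim_env_frame fr1 isT isT e.
apply: triple_seq; apply: triple_kstore; apply: triple_seq; apply: triple_nstore.
apply: triple_seq; apply: triple_nstore; apply: triple_seq; apply: triple_nstore.
have dec0 p : (p < M)%N -> (0%MM == dec p) = (p == 0%N).
  move=> pM; apply/eqP/eqP => [h|->].
    rewrite -(decodeK pM) -h /code big1 // => k _; by rewrite mnm0E mul0n.
  by apply/mnmP => k; rewrite mnm0E mnmE div0n mod0n.
apply: (close_basis_spec (r := 1) (bs := fun=> 1) (pv := fun=> 0%N) (bd := fun=> 0%N)) => //.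
- move=> [|//] _; split=> //.
  + exact: dhomog1.
  + by have := @lin_span_gen _ _ _ (wprod gen) (fun l => all gact l /\ (wdeg delta l <= 0)%N) [::];
      rewrite /wprod /wdeg !big_nil; apply.
  + by split=> //; rewrite mcoeff1 [_ == 0%MM]eq_sym dec0 // oner_eq0.
- split=> //= [[|//] _ //|[|//] _ //|[|//] _ p pM].
  rewrite mul0n add0n mcoeff1 eq_sym dec0 // /upd /=.
  by case: eqP => [//|_]; rewrite h1.
Qed.

End DimensionRun.

(** * The list of all terms *)

(** Positions in the concatenation of lists, grouped by the list they come from. *)
Lemma big_flatten_index (X R : Type) (idx : R) (op : Monoid.com_law idx)
    (x0 : X) (L : seq (seq X)) (i : nat) (Phi : X -> R) :
  i < size L ->
  \big[op/idx]_(t < size (flatten L) | reshape_index (shape L) t == i)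
     Phi (nth x0 (flatten L) t) =
  \big[op/idx]_(p <- nth [::] L i) Phi p.
Proof.
move=> si.
have nthsh : nth 0 (shape L) i = size (nth [::] L i) by rewrite (nth_map [::]).
transitivity (\big[op/idx]_(t <- [seq flatten_index (shape L) i c | c <- iota 0 (size (nth [::] L i))])
    Phi (nth x0 (flatten L) t)).
  rewrite -(big_mkord (fun t => reshape_index (shape L) t == i) (fun t => Phi (nth x0 (flatten L) t))).
  rewrite -big_filter; apply: perm_big; apply: uniq_perm.
  - by rewrite filter_uniq // iota_uniq.
  - by rewrite map_inj_uniq ?iota_uniq // => a b /addnI.
  move=> t; rewrite mem_filter mem_index_iota /=; apply/andP/mapP.
    move=> [/eqP <-]; rewrite size_flatten => ts.
    exists (reshape_offset (shape L) t); last by rewrite reshape_indexK.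
    rewrite mem_iota /= add0n -(nth_map [::] 0) ?reshape_offsetP //.
    by rewrite -(size_map size); apply: reshape_indexP.
  move=> [c]; rewrite mem_iota /= add0n -nthsh => cs ->.
  by rewrite flatten_indexKl // eqxx size_flatten flatten_indexP.
rewrite big_map [in RHS](big_nth x0) /index_iota subn0 big_seq [in RHS]big_seq.
apply: eq_bigr => c; rewrite mem_iota /= add0n -nthsh => cs.
by rewrite nth_flatten flatten_indexKl // flatten_indexKr.
Qed.

Section Input.
Local Open Scope ring_scope.
Variables (n : nat) (K : fieldType) (F : seq {mpoly K[n]}).
Variable L : seq (seq (K * 'X_{1..n})).
Hypothesis reprL : sparse_repr F L.
Hypothesis homogF : forall f, f \in F -> exists k, f \is k.-homog.

Definition terms_nb : nat := size (flatten L).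
Definition term_at (t : nat) : K * 'X_{1..n} := nth (0, 0%MM) (flatten L) t.
Definition term_coef t : K := (term_at t).1.
Definition term_mon t : 'X_{1..n} := (term_at t).2.
Definition term_owner (t : nat) : nat := reshape_index (shape L) t.

Lemma size_repr : size L = size F.
Proof.
move: reprL; rewrite /sparse_repr; elim: F L => [|f F' IH] [|l L'] //= /andP[_ /IH->].
by [].
Qed.

Lemma repr_perm i : (i < size F)%N ->
  perm_eq (nth [::] L i) [seq ((gens F i)@_u, u) | u <- msupp (gens F i)].
Proof.
move: reprL; rewrite /sparse_repr /gens.
elim: F L i => [|f F' IH] [|l L'] [|i] //= /andP[pl /IH{}IH] //.
by rewrite ltnS => /IH.
Qed.

Lemma repr_big (R : Type) (idx : R) (op : Monoid.com_law idx) i (Phi : K -> 'X_{1..n} -> R) :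
  (i < size F)%N ->
  \big[op/idx]_(t < terms_nb | term_owner t == i) Phi (term_coef t) (term_mon t) =
  \big[op/idx]_(u <- msupp (gens F i)) Phi (gens F i)@_u u.
Proof.
move=> si; rewrite (@big_flatten_index _ _ _ op (0, 0%MM) L i (fun p => Phi p.1 p.2)) ?size_repr //.
by rewrite (perm_big _ (repr_perm si)) big_map.
Qed.

Lemma term_owner_lt t : (t < terms_nb)%N -> (term_owner t < size F)%N.
Proof.
by rewrite /terms_nb size_flatten => /reshape_indexP; rewrite size_map size_repr.
Qed.

Lemma term_mon_supp t : (t < terms_nb)%N -> term_mon t \in msupp (gens F (term_owner t)).
Proof.
move=> tT; have ot := term_owner_lt tT.
have : term_at t \in nth [::] L (term_owner t).
  rewrite /term_at nth_flatten; apply: mem_nth; rewrite -(nth_map [::] 0) ?size_repr //.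
  by apply: reshape_offsetP; rewrite -size_flatten.
by rewrite (perm_mem (repr_perm ot)) => /mapP[u hu e]; rewrite /term_mon e.
Qed.

Lemma gens_homog i : (i < size F)%N -> gens F i \is (gens_deg F i).-homog.
Proof. by move=> si; have [k /dhomog_msize] := homogF (mem_nth 0 si). Qed.

Lemma term_mon_deg t : (t < terms_nb)%N -> mdeg (term_mon t) = gens_deg F (term_owner t).
Proof.
move=> tT; apply: dhomogP (gens_homog (term_owner_lt tT)) _ (term_mon_supp tT).
Qed.

Lemma active_has_term i : active F i -> exists2 t, (t < terms_nb)%N & term_owner t = i.
Proof.
move=> ai; have /andP[si _] := ai; have nz := active_nz ai.
have s0 : (0 < nth 0 (shape L) i)%N.
  rewrite (nth_map [::]) ?size_repr // (perm_size (repr_perm si)) size_map.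
  by rewrite lt0n size_eq0 msupp_eq0.
exists (flatten_index (shape L) i 0); last by rewrite /term_owner flatten_indexKl.
by rewrite /terms_nb size_flatten flatten_indexP.
Qed.

Lemma term_gen_gens i : (i < size F)%N ->
  term_gen terms_nb term_owner term_mon term_coef i = gens F i.
Proof.
move=> si; rewrite /term_gen (repr_big +%R (fun c u => c *: 'X_[u])) //.
by rewrite [RHS]mpolyE.
Qed.

Variable D : nat.
Hypothesis D0 : (0 < D)%N.
Hypothesis degF : forall f, f \in F -> ((msize f).-1 <= D)%N.
Local Notation Q := (radix n D).

Lemma gens_radix i u : (i < size F)%N -> u \in msupp (gens F i) -> forall k, (u k < Q)%N.
Proof. by move=> si hu k; apply: (supp_radix D0 degF) hu; apply: mem_nth. Qed.

(** The monomials of a polynomial have distinct codes. *)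
Lemma poly_size_bound i : (i < size F)%N -> (size (nth [::] L i) <= Q ^ n)%N.
Proof.
move=> si; rewrite (perm_size (repr_perm si)) size_map.
rewrite -(size_map (code Q)) -[leqRHS](size_iota 0); apply: uniq_leq_size.
  rewrite map_inj_in_uniq ?msupp_uniq // => u v hu hv /(congr1 (decode n Q)).
  by rewrite !codeK //; apply: (gens_radix si).
by move=> _ /mapP[u hu ->]; rewrite mem_iota /= add0n; apply: code_lt; apply: (gens_radix si).
Qed.

Lemma terms_nb_bound : (terms_nb <= size F * Q ^ n)%N.
Proof.
rewrite /terms_nb size_flatten -size_repr.
have : forall l, l \in L -> (size l <= Q ^ n)%N.
  by move=> l /(nthP [::])[i]; rewrite size_repr => si <-; apply: poly_size_bound.
elim: L => // l L' IH h /=; rewrite mulSn leq_add ?h ?mem_head // IH // => l' hl'.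
by apply: h; rewrite inE hl' orbT.
Qed.

Variable w : 'X_{1..n}.
Local Notation prio := (weight (refine Q w)).

Definition best_prio (i : nat) : nat :=
  (\max_(t < terms_nb | term_owner t == i) prio (term_mon t))%N.

Lemma best_prio_in i : (i < size F)%N -> gens F i != 0 ->
  best_prio i = prio (in_mon (weight_le (refine Q w)) (gens F i)).
Proof.
move=> si nz; rewrite /best_prio (repr_big maxn (fun _ u => prio u)) //.
have tord := weight_le_term_order (refine Q w).
apply/anti_leq/andP; split; last exact: leq_bigmax_seq (in_mon_supp tord nz) _.
apply/bigmax_leqP_seq => u hu _; have := in_mon_ge tord hu.
by case/orP=> [/ltnW//|/andP[/eqP-> _]].
Qed.

Definition leading_coef t : K :=
  if prio (term_mon t) == best_prio (term_owner t) then term_coef t else 0.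

(** Ties are broken, so exactly one term of a nonzero polynomial attains the
    best priority, and it is the leading one. *)
Lemma term_gen_initial i : (i < size F)%N ->
  term_gen terms_nb term_owner term_mon leading_coef i = initial_gens F D w i.
Proof.
move=> si; set b := best_prio i.
transitivity (\sum_(t < terms_nb | term_owner t == i)
    (if prio (term_mon t) == b then term_coef t else 0) *: 'X_[term_mon t]).
  by apply: eq_bigr => t /eqP ot; rewrite /leading_coef ot.
rewrite (repr_big +%R (fun c u => (if prio u == b then c else 0) *: 'X_[u])) //.
rewrite /initial_gens; set f := gens F i; have [f0|nz] := eqVneq f 0.
  by rewrite f0 msupp0 big_nil mcoeff0 scale0r.
have hin := in_mon_supp (weight_le_term_order (refine Q w)) nz.
rewrite (bigD1_seq _ hin) ?msupp_uniq //= [b]best_prio_in // eqxx big_seq_cond big1 ?addr0 //.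
move=> u /andP[hu ne]; rewrite ifF ?scale0r //; apply/negP => /eqP e.
case/eqP: ne; by apply: weight_refine_inj e; apply: (gens_radix si).
Qed.
End Input.

Lemma truncated_eq n (K : fieldType) (act act' : pred nat) delta
    (g g' : nat -> {mpoly K[n]}) E h :
  act =1 act' -> (forall i, act i -> g i = g' i) ->
  truncated act delta g E h <-> truncated act' delta g' E h.
Proof.
move=> ea eg.
have ew l : all act l -> wprod g l = wprod g' l.
  by rewrite /wprod; elim: l => [|i l IH /= /andP[ai al]]; rewrite ?big_nil // !big_cons eg ?IH.
split; apply: lin_span_trans => l [al dl]; have al' := al.
  by rewrite ew //; apply: lin_span_gen; rewrite -(eq_all ea).
by rewrite (eq_all (fun i => esym (ea i))) in al'; rewrite -ew //; apply: lin_span_gen.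
Qed.

(** * The detection program *)

(* Memory layout, continued. Input: [aSize], [aExp] and [kInput]. Search: [xC]
   counts the weights, [aW] is the current one, [aRank] the dimension for the
   given polynomials, [aPrio] the refined weights of the terms, [aBest] their
   maxima over each polynomial, [aAns] the answer. *)
Notation aSize := 1 (only parsing).
Notation aExp := 2 (only parsing).
Notation xC := 21 (only parsing).
Notation aRank := 22 (only parsing).
Notation aW := 23 (only parsing).
Notation aPrio := 24 (only parsing).
Notation aBest := 25 (only parsing).
Notation aAns := 26 (only parsing).
Notation aCarry := 27 (only parsing).
Notation kInput := 0 (only parsing).

Fixpoint nsum (m : nat) (f : nat -> nexp) : nexp :=
  if m is m'.+1 then NAdd (nsum m' f) (f m') else NConst 0.

Fixpoint npow (e : nexp) (m : nat) : nexp :=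
  if m is m'.+1 then NMul (npow e m') e else NConst 1.

Lemma neval_nsum (K : fieldType) (st : state K) m f :
  neval st (nsum m f) = \sum_(k < m) neval st (f k).
Proof. by elim: m => [|m IH] /=; rewrite ?big_ord0 // big_ord_recr IH. Qed.

Lemma neval_npow (K : fieldType) (st : state K) e m :
  neval st (npow e m) = neval st e ^ m.
Proof. by elim: m => //= m ->; rewrite expnSr. Qed.

Definition read_owners : cmd :=
  For xI (var aS)
    (For xJ (NLoad aSize (var xI))
       (Seq (NStore aOwn (var aT) (var xI))
            (NStore aT (NConst 0) (NAdd (var aT) (NConst 1))))).

Section Program.
Variable n : nat.

Definition expo (k : nat) : nexp :=
  NLoad aExp (NAdd (NMul (var xT) (NConst n)) (NConst k)).
Definition owner_of : nexp := NLoad aOwn (var xT).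

Definition read_degrees : cmd :=
  For xT (var aT)
    (Seq (NStore aDeg owner_of (nsum n expo))
         (If (BNle (var aD) (NLoad aDeg owner_of))
             (NStore aD (NConst 0) (NLoad aDeg owner_of)) Skip)).

Definition set_parameters : cmd :=
  Seq (NStore aD (NConst 0) (NAdd (var aD) (NConst 1)))
  (Seq (NStore aE (NConst 0) (npow (NMul (var aD) (NConst (2 * n + 1))) n.+1))
  (Seq (NStore aQ (NConst 0) (NAdd (var aE) (NConst 1)))
       (NStore aM (NConst 0) (npow (var aQ) n)))).

Definition read_terms : cmd :=
  For xT (var aT)
    (Seq (NStore aCode (var xT) (nsum n (fun k => NMul (expo k) (npow (var aQ) k))))
         (KStore kCoef (var xT) (KLoad kInput (var xT)))).

Definition clear_best : cmd :=
  For xI (var aS) (NStore aBest (var xI) (NConst 0)).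

Definition prio_exp : nexp :=
  nsum n (fun k => NMul (NAdd (NMul (NLoad aW (NConst k)) (var aM)) (npow (var aQ) k)) (expo k)).

Definition compute_prio : cmd :=
  For xT (var aT)
    (Seq (NStore aPrio (var xT) prio_exp)
         (If (BNle (NLoad aBest owner_of) (NLoad aPrio (var xT)))
             (NStore aBest owner_of (NLoad aPrio (var xT))) Skip)).

(** Setting the other coefficients to zero turns the list of terms into that of
    the leading terms. *)
Definition select_leading : cmd :=
  For xT (var aT)
    (If (BNeq (NLoad aPrio (var xT)) (NLoad aBest owner_of))
        (KStore kCoef (var xT) (KLoad kInput (var xT)))
        (KStore kCoef (var xT) KZero)).

(** Adds one to the number with base-[Q] digits [aW]; the flag [aCarry] says
    whether a carry is pending. *)
Definition increment : cmd :=
  Seq (NStore aCarry (NConst 0) (NConst 1))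
      (For xI (NConst n)
         (If (BNeq (var aCarry) (NConst 1))
             (Seq (NStore aW (var xI) (NAdd (NLoad aW (var xI)) (NConst 1)))
                  (If (BNle (var aQ) (NLoad aW (var xI)))
                      (NStore aW (var xI) (NConst 0))
                      (NStore aCarry (NConst 0) (NConst 0))))
             Skip)).

Definition try_weight : cmd :=
  Seq clear_best (Seq compute_prio (Seq select_leading (Seq dimension_cmd
  (Seq (If (BNeq (var aR) (var aRank)) (NStore aAns (NConst 0) (NConst 1)) Skip)
       increment)))).

Definition detect : cmd :=
  Seq read_owners (Seq read_degrees (Seq set_parameters (Seq read_terms
  (Seq dimension_cmd (Seq (NStore aRank (NConst 0) (var aR))
  (Seq (For xC (var aM) try_weight)
       (NStore aS (NConst 0) (var aAns)))))))).

Lemma detect_depth : loop_depth detect = 5.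
Proof. by []. Qed.
End Program.

Section Run.
Local Open Scope ring_scope.
Variables (n : nat) (K : fieldType) (B d : nat) (F : seq {mpoly K[n]}).
Variable L : seq (seq (K * 'X_{1..n})).
Hypothesis reprL : sparse_repr F L.
Hypothesis homogF : forall f, f \in F -> exists k, f \is k.-homog.
Hypothesis degF : forall f, f \in F -> ((msize f).-1 <= d)%N.

Local Notation T := (terms_nb L).
Local Notation s := (size F).
Local Notation own := (term_owner L).
Local Notation ex := (term_mon L).
Local Notation co := (term_coef L).
Local Notation delta := (gens_deg F).
Local Notation triple := (triple B).
Implicit Types (st : state K).

(** The program finds the maximal degree itself, and uses the next number as
    degree bound in order to have a positive one. *)
Definition max_deg : nat := (\max_(t < T) mdeg (ex t))%N.
Local Notation D := max_deg.+1.
Local Notation E := (trunc_deg n D).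
Local Notation Q := (radix n D).
Local Notation M := (Q ^ n)%N.

Lemma max_deg_bound f : f \in F -> ((msize f).-1 <= D)%N.
Proof.
move=> /(nthP 0)[i si <-]; rewrite -/(gens F i) -/(gens_deg F i).
have [->//|d0] := posnP (delta i).
have ai : active F i by rewrite /active si.
have [t tT <-] := active_has_term reprL ai.
rewrite -(term_mon_deg reprL homogF tT) leqW //.
exact: (leq_bigmax (Ordinal tT)).
Qed.

Lemma max_deg_le : (D <= d.+1)%N.
Proof.
rewrite ltnS; apply/bigmax_leqP => t _.
rewrite (term_mon_deg reprL homogF) //; apply: degF; apply: mem_nth.
exact: term_owner_lt.
Qed.

Hypotheses (MB : (M <= B)%N) (TB : (T <= B)%N) (sB : (s <= B)%N).

Lemma nB : (n <= B)%N.
Proof.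
apply: leq_trans MB; apply: ltnW; apply: ltn_expl.
rewrite /radix ltnS; apply: leq_trans (trunc_deg_ge n (ltn0Sn _)).
by [].
Qed.

Lemma size_poly_B i : (i < s)%N -> (size (nth [::] L i) <= B)%N.
Proof.
move=> si; apply: leq_trans MB; exact: (poly_size_bound reprL (ltn0Sn _) max_deg_bound si).
Qed.

Definition input_env st : Prop :=
  [/\ nmem st aS 0 = s, forall i, (i < s)%N -> nmem st aSize i = size (nth [::] L i),
      forall t (k : 'I_n), (t < T)%N -> nmem st aExp (t * n + k)%N = ex t k
    & forall t, (t < T)%N -> kmem st kInput t = co t].

Lemma input_env_frame c st st' :
  frame c st st' -> all (fun a => a \notin nwrites c) [:: aS; aSize; aExp] ->
  kInput \notin kwrites c -> input_env st -> input_env st'.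
Proof.
move=> [fn fk] /= /and4P[h0 h1 h2 _] k0 [e1 e2 e3 e4].
by split=> [|i si|t k tT|t tT]; rewrite ?fn ?fk //; [exact: e2|exact: e3|exact: e4].
Qed.

Lemma nth_exponents (TL : seq (K * 'X_{1..n})) t (k : 'I_n) : (t < size TL)%N ->
  nth 0%N (flatten [seq [seq p.2 k | k <- enum 'I_n] | p : K * 'X_{1..n} <- TL]) (t * n + k)
  = (nth (0, 0%MM) TL t).2 k.
Proof.
elim: TL t => //= p TL IH [|t] tT; rewrite nth_cat size_map size_enum_ord.
  by rewrite mul0n add0n ltn_ord (nth_map k) ?size_enum_ord // nth_ord_enum.
by rewrite mulSn -addnA ltnNge leq_addr /= addKn IH.
Qed.

Lemma init_input : input_env (init_state L).
Proof.
split=> /=.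
- exact: size_repr.
- by move=> i si; rewrite (nth_map [::]) ?(size_repr reprL).
- by move=> t k tT; rewrite nth_exponents.
- by move=> t tT; rewrite (nth_map (0, 0%MM)).
Qed.

Definition offset (i : nat) : nat := sumn (take i (shape L)).

Lemma offsetS i : (i < s)%N -> offset i.+1 = (offset i + size (nth [::] L i))%N.
Proof.
move=> si; rewrite /offset (take_nth 0%N) ?size_map ?(size_repr reprL) //.
by rewrite sumn_rcons (nth_map [::]) ?(size_repr reprL).
Qed.

Lemma offset_size : offset s = T.
Proof. by rewrite /offset -(size_repr reprL) -(size_map size) take_size -size_flatten. Qed.

Lemma owner_offset i c : (i < s)%N -> (c < size (nth [::] L i))%N ->
  own (offset i + c) = i.
Proof.
move=> si ci; rewrite /term_owner; apply: (flatten_indexKl (r := i)).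
by rewrite (nth_map [::]) ?(size_repr reprL).
Qed.

Lemma read_owners_spec st : input_env st -> nmem st aT 0 = 0%N ->
  triple st read_owners (fun st' =>
    nmem st' aT 0 = T /\ forall t, (t < T)%N -> nmem st' aOwn t = own t).
Proof.
move=> e t0.
pose P m st' := nmem st' aT 0 = m /\ forall t, (t < m)%N -> nmem st' aOwn t = own t.
rewrite -offset_size.
apply: (triple_for (I := fun i => P (offset i))) => //.
- by move=> st' [fn _]; rewrite /= fn //; case: e.
- by split; rewrite // /offset take0.
move=> i st1 si fr1 hi P1; have e1 := input_env_frame fr1 isT isT e.
rewrite offsetS //.
apply: (triple_for (I := fun j => P (offset i + j)%N)) => //.
- exact: size_poly_B.
- by move=> st' [fn _]; rewrite /= !fn // hi; have [_ h _ _] := e1; apply: h.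
- by rewrite addn0.
move=> j st2 jl fr2 hj [T2 O2]; have [fn2 _] := fr2.
apply: triple_seq; apply: triple_nstore; apply: triple_nstore.
split=> /=; rewrite /upd /= T2; first by rewrite addn1 addnS.
move=> t; rewrite addnS ltnS leq_eqVlt fn2 // hi.
by case: eqP => [-> _|_ /O2//]; rewrite owner_offset.
Qed.

Lemma expo_eval st t (k : 'I_n) :
  input_env st -> (t < T)%N -> nmem st xT 0 = t -> neval st (expo n k) = ex t k.
Proof. by move=> [_ _ h _] tT ht; rewrite /= ht h. Qed.

Lemma read_degrees_spec st : input_env st -> nmem st aT 0 = T ->
  (forall t, (t < T)%N -> nmem st aOwn t = own t) ->
  (forall i, nmem st aDeg i = 0%N) -> nmem st aD 0 = 0%N ->
  triple st (read_degrees n) (fun st' => nmem st' aD 0 = max_deg /\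
    forall i, (i < s)%N -> nmem st' aDeg i = delta i).
Proof.
move=> e eT eO d0 D0.
(* A polynomial without terms keeps the initial degree 0. *)
pose I t st' := nmem st' aD 0 = (\max_(t' < t) mdeg (ex t'))%N /\
  forall i, nmem st' aDeg i = 0%N /\ (forall t', (t' < t)%N -> own t' != i) \/
            nmem st' aDeg i = delta i.
apply: (@triple_post _ _ _ _ (I T)).
  apply: (triple_for (I := I)) => //.
  - by move=> st' [fn _]; rewrite /= fn.
  - by split; [rewrite big_ord0|move=> i; left; rewrite d0].
  move=> t st1 tT fr1 ht [D1 I1]; have e1 := input_env_frame fr1 isT isT e.
  have [fn1 _] := fr1.
  have dE : neval st1 (nsum n (expo n)) = mdeg (ex t).
    by rewrite neval_nsum mdegE; apply: eq_bigr => k _; apply: expo_eval.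
  have oE : nmem st1 aOwn t = own t by rewrite fn1 // eO.
  have mE : mdeg (ex t) = delta (own t) by apply: term_mon_deg.
  apply: triple_seq; apply: triple_nstore; rewrite dE /= ht oE.
  apply: triple_if => /=; rewrite /upd /= ht oE eqxx D1 => hc;
    [apply: triple_nstore|apply: triple_skip]; split=> /=; rewrite /upd /= ?ht ?oE ?eqxx.
  - by rewrite big_ord_recr /=; apply/esym/maxn_idPr.
  - move=> i; case: eqP => [->|ne]; first by right.
    case: (I1 i) => [[-> h]|->]; [left|by right]; split=> // t'.
    rewrite ltnS leq_eqVlt => /predU1P[->|/h //]; by apply/eqP => e2; case: ne.
  - by rewrite D1 big_ord_recr /=; apply/esym/maxn_idPl; rewrite leqNgt; move: hc; rewrite -ltnNge => /ltnW; rewrite leqNgt.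
  - move=> i; case: eqP => [->|ne]; first by right.
    case: (I1 i) => [[-> h]|->]; [left|by right]; split=> // t'.
    rewrite ltnS leq_eqVlt => /predU1P[->|/h //]; by apply/eqP => e2; case: ne.
move=> st' _ [D1 I1]; split=> // i si; case: (I1 i) => [[-> h]|//].
have [->//|dp] := posnP (delta i).
have ai : active F i by rewrite /active si.
by have [t tT ot] := active_has_term reprL ai; have := h t tT; rewrite ot eqxx.
Qed.

Lemma set_parameters_spec st : nmem st aD 0 = max_deg ->
  triple st (set_parameters n) (fun st' =>
    [/\ nmem st' aE 0 = E, nmem st' aQ 0 = Q & nmem st' aM 0 = M]).
Proof.
move=> hD.
apply: triple_seq; apply: triple_nstore; set st1 := State _ _.
have hD1 : neval st1 (var aD) = D by rewrite /= /upd /= hD addn1.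
apply: triple_seq; apply: triple_nstore; rewrite neval_npow.
have -> : neval st1 (NMul (var aD) (NConst (2 * n + 1))) = (D * (2 * n + 1))%N by rewrite -hD1.
rewrite -/E; set st2 := State _ _.
apply: triple_seq; apply: triple_nstore; set st3 := State _ _.
have hQ3 : neval st3 (var aQ) = Q by rewrite /= /upd /= addn1.
apply: triple_nstore; rewrite neval_npow hQ3; split=> //.
Qed.

Lemma read_terms_spec st : input_env st -> nmem st aT 0 = T -> nmem st aQ 0 = Q ->
  triple st (read_terms n) (fun st' => forall t, (t < T)%N ->
    nmem st' aCode t = code Q (ex t) /\ kmem st' kCoef t = co t).
Proof.
move=> e eT eQ.
apply: (triple_for (I := fun m st' => forall t, (t < m)%N ->
    nmem st' aCode t = code Q (ex t) /\ kmem st' kCoef t = co t)) => //.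
  by move=> st' [fn _]; rewrite /= fn.
move=> t st1 tT fr1 ht I1; have e1 := input_env_frame fr1 isT isT e.
have [fn1 fk1] := fr1; have [_ _ _ eK] := e1.
apply: triple_seq; apply: triple_nstore; apply: triple_kstore => t'.
rewrite /= /upd /= ht ltnS leq_eqVlt; case: eqP => [-> _|_ /I1//]; split; last exact: eK.
rewrite neval_nsum; apply: eq_bigr => k _.
transitivity (neval st1 (expo n k) * neval st1 (npow (var aQ) k))%N; first by [].
by rewrite (expo_eval k e1 tT ht) neval_npow /= fn1 // eQ.
Qed.

Lemma clear_best_spec st : input_env st ->
  triple st clear_best (fun st' => forall i, (i < s)%N -> nmem st' aBest i = 0%N).
Proof.
move=> e; apply: (triple_for (I := fun m st' => forall i, (i < m)%N -> nmem st' aBest i = 0%N)) => //.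
  by move=> st' [fn _]; rewrite /= fn //; case: e.
move=> i st1 si fr1 hi I1; apply: triple_nstore => i'.
by rewrite /= /upd /= hi ltnS leq_eqVlt; case: eqP => //= _ /I1.
Qed.

Lemma compute_prio_spec st (w : 'X_{1..n}) : input_env st -> nmem st aT 0 = T ->
  (forall t, (t < T)%N -> nmem st aOwn t = own t) ->
  nmem st aQ 0 = Q -> nmem st aM 0 = M ->
  (forall k : 'I_n, nmem st aW k = w k) ->
  (forall i, (i < s)%N -> nmem st aBest i = 0%N) ->
  triple st (compute_prio n) (fun st' =>
    (forall t, (t < T)%N -> nmem st' aPrio t = weight (refine Q w) (ex t)) /\
    (forall i, (i < s)%N -> nmem st' aBest i = best_prio L D w i)).
Proof.
move=> e eT eO eQ eM eW b0.
pose prio t := weight (refine Q w) (ex t).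
pose part m i := (\max_(t < m) (if own t == i then prio t else 0))%N.
apply: (@triple_post _ _ _ _ (fun st' =>
    (forall t, (t < T)%N -> nmem st' aPrio t = prio t) /\
    (forall i, (i < s)%N -> nmem st' aBest i = part T i))); last first.
  move=> st' _ [P1 B1]; split=> // i si; rewrite B1 // /best_prio [RHS]big_mkcond.
  by apply: eq_bigr.
apply: (triple_for (I := fun m st' =>
    (forall t, (t < m)%N -> nmem st' aPrio t = prio t) /\
    (forall i, (i < s)%N -> nmem st' aBest i = part m i))) => //.
- by move=> st' [fn _]; rewrite /= fn.
- by split=> // i si; rewrite /part big_ord0 b0.
move=> t st1 tT fr1 ht [P1 B1]; have e1 := input_env_frame fr1 isT isT e.
have [fn1 _] := fr1.
have pE : neval st1 (prio_exp n) = prio t.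
  rewrite neval_nsum; apply: eq_bigr => k _.
  transitivity ((nmem st1 aW k * nmem st1 aM 0 + neval st1 (npow (var aQ) k)) *
    neval st1 (expo n k))%N; first by [].
  by rewrite (expo_eval k e1 tT ht) neval_npow /= !fn1 // eQ eM eW.
have oE : nmem st1 aOwn t = own t by rewrite fn1 // eO.
have os : (own t < s)%N by apply: term_owner_lt.
have partS i : part t.+1 i = maxn (part t i) (if own t == i then prio t else 0%N).
  by rewrite /part big_ord_recr.
apply: triple_seq; apply: triple_nstore; rewrite pE /= ht; set st2 := State _ _.
have p2 t' : nmem st2 aPrio t' = if t' == t then prio t else nmem st1 aPrio t' by [].
have b2 i : nmem st2 aBest i = nmem st1 aBest i by [].
have h2 : nmem st2 xT 0 = t by [].
have o2 : nmem st2 aOwn t = own t by [].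
move: st2 p2 b2 h2 o2 => st2 p2 b2 h2 o2.
have P2 t' : (t' < t.+1)%N -> nmem st2 aPrio t' = prio t'.
  by rewrite ltnS leq_eqVlt p2; case: eqP => [->|_ /P1].
apply: triple_if => /=; rewrite h2 o2 b2 B1 // p2 eqxx => hc.
  apply: triple_nstore; split=> [t' /P2 //|i si] /=.
  rewrite /upd /= h2 o2 p2 eqxx partS; case: eqP => [->|ne].
    by rewrite eqxx; apply/esym/maxn_idPr.
  by rewrite ifF ?maxn0 ?b2 ?B1 //; apply/eqP => e2; case: ne.
apply: triple_skip; split=> // i si; rewrite b2 B1 // partS; case: eqP => [ei|_]; last by rewrite maxn0.
by apply/esym/maxn_idPl; rewrite -ei ltnW // ltnNge.
Qed.

Lemma select_leading_spec st (w : 'X_{1..n}) : input_env st -> nmem st aT 0 = T ->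
  (forall t, (t < T)%N -> nmem st aOwn t = own t) ->
  (forall t, (t < T)%N -> nmem st aPrio t = weight (refine Q w) (ex t)) ->
  (forall i, (i < s)%N -> nmem st aBest i = best_prio L D w i) ->
  triple st select_leading (fun st' =>
    forall t, (t < T)%N -> kmem st' kCoef t = leading_coef L D w t).
Proof.
move=> e eT eO eP eB.
apply: (triple_for (I := fun m st' =>
    forall t, (t < m)%N -> kmem st' kCoef t = leading_coef L D w t)) => //.
  by move=> st' [fn _]; rewrite /= fn.
move=> t st1 tT fr1 ht I1; have [_ _ _ eK] := input_env_frame fr1 isT isT e.
have [fn1 _] := fr1; have os : (own t < s)%N by apply: term_owner_lt.
have cE : beval st1 (BNeq (NLoad aPrio (var xT)) (NLoad aBest owner_of)) =
    (weight (refine Q w) (ex t) == best_prio L D w (own t)).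
  by rewrite /= ht !fn1 // eO // eP // eB.
by apply: triple_if; rewrite cE => hc; apply: triple_kstore => t';
  rewrite /= /upd /= ht ltnS leq_eqVlt; case: eqP => [-> _|_ /I1//];
  rewrite /leading_coef ?eK // ?hc // (negbTE hc).
Qed.

Lemma increment_spec st c : (c < M)%N -> nmem st aQ 0 = Q ->
  (forall k : 'I_n, nmem st aW k = decode n Q c k) ->
  triple st (increment n) (fun st' => (c.+1 < M)%N ->
    forall k : 'I_n, nmem st' aW k = decode n Q c.+1 k).
Proof.
move=> cM eQ eW; have Q0 : (0 < Q)%N by [].
pose total st' := (\sum_(k < n) nmem st' aW k * Q ^ k)%N.
(* A pending carry into digit [i] is worth [Q ^ i]. *)
pose I i st' := (forall k : 'I_n, (nmem st' aW k < Q)%N) /\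
  (nmem st' aCarry 0 = 1%N /\ (total st' + Q ^ i)%N = c.+1 \/
   nmem st' aCarry 0 = 0%N /\ total st' = c.+1).
apply: triple_seq; apply: triple_nstore; set st1 := State _ _.
have eQ1 : nmem st1 aQ 0 = Q by [].
have I0 : I 0%N st1.
  split; first by move=> k; rewrite [nmem st1 _ _](eW k) decode_lt.
  left; split=> //; rewrite expn0 addn1 -[in RHS](decodeK cM); congr S.
  by apply: eq_bigr => k _; rewrite [nmem st1 _ _](eW k).
move: st1 eQ1 I0 => st1 eQ1 I0.
apply: (@triple_post _ _ _ _ (I n)); last first.
  move=> st' _ [wQ h] c1; have tE : total st' = c.+1.
    by case: h => [[_ h]|[]//]; move: c1; rewrite -h ltnNge leq_addl.
  pose u := [multinom nmem st' aW k | k < n].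
  have uQ k : (u k < Q)%N by rewrite mnmE.
  move=> k; rewrite -tE (_ : total st' = code Q u) ?codeK ?mnmE //.
  by apply: eq_bigr => j _; rewrite mnmE.
apply: triple_for => //; first exact: nB.
move=> i st2 iN fr2 hi [wQ h]; have [fn2 _] := fr2.
have step st3 x : (forall k, nmem st3 aW k = if k == i then x else nmem st2 aW k) ->
    (total st3 + nmem st2 aW i * Q ^ i)%N = (total st2 + x * Q ^ i)%N.
  move=> h3; rewrite /total (bigD1 (Ordinal iN)) //= [in RHS](bigD1 (Ordinal iN)) //=.
  rewrite h3 eqxx (eq_bigr (fun k : 'I_n => (nmem st2 aW k * Q ^ k)%N)) => [|k ne]; first by lia.
  by rewrite h3 ifF //; apply: contraNF ne => /eqP e; apply/eqP/val_inj.
have wi := wQ (Ordinal iN); rewrite /= in wi.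
apply: triple_if => /= hc; last first.
  apply: triple_skip; split=> //; case: h => [[h1 _]|]; last by right.
  by rewrite h1 in hc.
case: h => [[_ tE]|[h0 _]]; last by rewrite h0 in hc.
apply: triple_seq; apply: triple_nstore; apply: triple_if => /=.
  rewrite /upd /= hi eqxx fn2 // eQ1 => full; apply: triple_nstore; set st3 := State _ _.
  have h3 k : nmem st3 aW k = if k == i then 0%N else nmem st2 aW k.
    by rewrite /st3 /= /upd /= hi; case: eqP.
  split; first by move=> k; rewrite h3; case: eqP.
  left; split; first exact/eqP.
  have qE : Q = (nmem st2 aW i).+1 by apply/eqP; rewrite eqn_leq wi andbT; move: full; rewrite addn1.
  have eX : (Q ^ i.+1 = Q ^ i + nmem st2 aW i * Q ^ i)%N by rewrite expnS {1}qE mulSn.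
  have := step _ _ h3; rewrite eX mul0n addn0 -tE.
  by move=> <-; rewrite -!addnA; congr addn; rewrite addnC.
rewrite /upd /= hi eqxx fn2 // eQ1 => nfull; apply: triple_nstore; set st3 := State _ _.
have h3 k : nmem st3 aW k = if k == i then (nmem st2 aW i).+1 else nmem st2 aW k.
  by rewrite /st3 /= /upd /= ?hi addn1.
split; first by move=> k; rewrite h3; case: eqP => // _; lia.
right; split; first by [].
apply/eqP; rewrite -(eqn_add2r (nmem st2 aW i * Q ^ i)) (step _ _ h3) mulSn addnA tE.
by [].
Qed.

Local Notation W g := (truncated (active F) delta g E).

Lemma dimension_of_gens kc g st :
  (forall i, (i < s)%N -> term_gen T own ex kc i = g i) ->
  dim_env s T E own delta ex kc st ->
  triple st dimension_cmd (fun st' => has_dim (W g) (nmem st' aR 0)).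
Proof.
move=> hg e.
apply: triple_post (dimension_spec (term_mon_deg reprL homogF) MB TB sB e) _ => st' _.
apply: has_dim_ext => h; apply: truncated_eq => // i /andP[si _]; exact: hg.
Qed.

(** The data that the main loop leaves unchanged. *)
Definition main_env st : Prop :=
  [/\ input_env st, [/\ nmem st aT 0 = T, nmem st aE 0 = E, nmem st aQ 0 = Q & nmem st aM 0 = M],
      forall t, (t < T)%N -> nmem st aOwn t = own t,
      forall t, (t < T)%N -> nmem st aCode t = code Q (ex t)
    & forall i, (i < s)%N -> nmem st aDeg i = delta i].

Lemma main_env_frame c st st' :
  frame c st st' ->
  all (fun a => a \notin nwrites c)
    [:: aS; aSize; aExp; aT; aE; aQ; aM; aOwn; aCode; aDeg] ->
  kInput \notin kwrites c -> main_env st -> main_env st'.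
Proof.
move=> fr /= /and5P[h1 h2 h3 h4 /and5P[h5 h6 h7 h8 /and3P[h9 h10 _]]] k0 [e1 [e2 e3 e4 e5] e6 e7 e8].
have [fn _] := fr.
split; last 3 first; [| | |by apply: input_env_frame fr _ k0 e1; rewrite /= h1 h2 h3|by rewrite !fn].
- by move=> t tT; rewrite fn // e6.
- by move=> t tT; rewrite fn // e7.
- by move=> i si; rewrite fn // e8.
Qed.

Lemma main_dim_env st kc : main_env st ->
  (forall t, (t < T)%N -> kmem st kCoef t = kc t) -> dim_env s T E own delta ex kc st.
Proof. by move=> [[eS _ _ _] [e2 e3 e4 e5] e6 e7 e8] ek. Qed.

(** The [c]-th round treats the weight whose code is [c]. *)
Lemma try_weight_spec st c rk : (c < M)%N -> main_env st ->
  nmem st aRank 0 = rk -> (forall k : 'I_n, nmem st aW k = decode n Q c k) ->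
  triple st (try_weight n) (fun st' =>
    ((c.+1 < M)%N -> forall k : 'I_n, nmem st' aW k = decode n Q c.+1 k) /\
    exists2 r, has_dim (W (initial_gens F D (decode n Q c))) r &
      nmem st' aAns 0 = if r == rk then 1%N else nmem st aAns 0).
Proof.
move=> cM e eR eW; set w := decode n Q c.
have [ein _ _ _ _] := e.
apply: triple_seq; apply: triple_post (clear_best_spec ein) _ => st1 fr1 b1.
have e1 := main_env_frame fr1 isT isT e; have [fn1 _] := fr1.
have [ein1 [eT1 eE1 eQ1 eM1] eO1 _ _] := e1.
apply: triple_seq; apply: triple_post (compute_prio_spec (w := w) ein1 eT1 eO1 eQ1 eM1 _ b1) _.
  by move=> k; rewrite fn1.
move=> st2 fr2 [p2 b2]; have e2 := main_env_frame fr2 isT isT e1; have [fn2 _] := fr2.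
have [ein2 [eT2 _ _ _] eO2 _ _] := e2.
apply: triple_seq; apply: triple_post (select_leading_spec ein2 eT2 eO2 p2 b2) _ => st3 fr3 k3.
have e3 := main_env_frame fr3 isT isT e2; have [fn3 _] := fr3.
have hg i : (i < s)%N -> term_gen T own ex (leading_coef L D w) i = initial_gens F D w i.
  by move=> si; apply: (term_gen_initial reprL (ltn0Sn _) max_deg_bound).
apply: triple_seq; apply: triple_post (dimension_of_gens hg (main_dim_env e3 k3)) _ => st4 fr4 d4.
have e4 := main_env_frame fr4 isT isT e3; have [fn4 _] := fr4.
have old a i : a \in [:: aRank; aW; aAns] -> nmem st4 a i = nmem st a i.
  by rewrite !inE => /or3P[] /eqP->; rewrite fn4 // fn3 // fn2 // fn1.
have finish st5 : frame (If (BNeq (var aR) (var aRank)) (NStore aAns (NConst 0) (NConst 1)) Skip) st4 st5 ->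
    nmem st5 aAns 0 = (if nmem st4 aR 0 == rk then 1%N else nmem st aAns 0) ->
    triple st5 (increment n) (fun st' =>
      ((c.+1 < M)%N -> forall k : 'I_n, nmem st' aW k = decode n Q c.+1 k) /\
      exists2 r, has_dim (W (initial_gens F D w)) r &
        nmem st' aAns 0 = if r == rk then 1%N else nmem st aAns 0).
  move=> fr5 a5; have [fn5 _] := fr5; have [_ [_ _ eQ4 _] _ _ _] := e4.
  apply: triple_post (increment_spec cM _ _) _.
  - by rewrite fn5.
  - by move=> k; rewrite fn5 // old.
  move=> st6 [fn6 _] w6; split=> //; exists (nmem st4 aR 0) => //.
  by rewrite fn6.
apply: triple_seq; apply: triple_if => /=; rewrite [nmem st4 aRank 0]old // eR => hc.
  apply: triple_nstore; apply: finish; last by rewrite hc.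
  by split=> //= a i; rewrite inE /upd => /negbTE->.
by apply: triple_skip; apply: finish; [apply: frame_refl|rewrite (negbTE hc) old].
Qed.

(** All weights with entries below the radix are tried, so the answer is positive
    exactly when one of them gives equal dimensions. *)
Lemma detect_spec : (0 < s)%N ->
  triple (init_state L) (detect n) (fun st' =>
    (sagbi_detectable F -> accepts st') /\ (~ sagbi_detectable F -> rejects st')).
Proof.
move=> s0; have ein := init_input; set st := init_state L in ein *.
apply: triple_seq; apply: triple_post (read_owners_spec ein erefl) _ => st1 fr1 [eT1 eO1].
have ein1 := input_env_frame fr1 isT isT ein; have [fn1 _] := fr1.
apply: triple_seq; apply: triple_post (read_degrees_spec ein1 eT1 eO1 _ _) _.
- by move=> i; rewrite fn1.
- by rewrite fn1.
move=> st2 fr2 [eD2 ed2]; have ein2 := input_env_frame fr2 isT isT ein1; have [fn2 _] := fr2.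
apply: triple_seq; apply: triple_post (set_parameters_spec eD2) _ => st3 fr3 [eE3 eQ3 eM3].
have ein3 := input_env_frame fr3 isT isT ein2; have [fn3 _] := fr3.
have eT3 : nmem st3 aT 0 = T by rewrite fn3 // fn2.
apply: triple_seq; apply: triple_post (read_terms_spec ein3 eT3 eQ3) _ => st4 fr4 ck4.
have [fn4 _] := fr4.
have e4 : main_env st4.
  split; first exact: input_env_frame fr4 isT isT ein3.
  - by rewrite !fn4.
  - by move=> t tT; rewrite fn4 // fn3 // fn2 // eO1.
  - by move=> t /ck4[].
  - by move=> i si; rewrite fn4 // fn3 // ed2.
have hg i : (i < s)%N -> term_gen T own ex co i = gens F i by apply: term_gen_gens.
apply: triple_seq; apply: triple_post
  (dimension_of_gens hg (main_dim_env e4 (fun t tT => proj2 (ck4 t tT)))) _ => st5 fr5 d5.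
have e5 := main_env_frame fr5 isT isT e4; have [fn5 _] := fr5.
apply: triple_seq; apply: triple_nstore; set rk := neval st5 (var aR); set st6 := State _ _.
have e6 : main_env st6 by apply: e5.
have r6 : nmem st6 aRank 0 = rk by [].
have w6 k : nmem st6 aW k = 0%N by rewrite [LHS]fn5 // fn4 // fn3 // fn2 // fn1.
have a6 : nmem st6 aAns 0 = 0%N by rewrite [LHS]fn5 // fn4 // fn3 // fn2 // fn1.
have {}d5 : has_dim (W (gens F)) rk by [].
move: rk st6 e6 r6 w6 a6 d5 => rk st6 e6 r6 w6 a6 drk.
pose I c st' := [/\ (c < M)%N -> forall k : 'I_n, nmem st' aW k = decode n Q c k,
  (nmem st' aAns 0 <= 1)%N,
  nmem st' aAns 0 = 1%N -> exists w : 'X_{1..n}, has_dim (W (initial_gens F D w)) rk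
  & forall c', (c' < c)%N -> exists2 r, has_dim (W (initial_gens F D (decode n Q c'))) r &
      r = rk -> nmem st' aAns 0 = 1%N].
apply: triple_seq; apply: (@triple_post _ _ _ _ (I M)); last first.
  move=> st7 fr7 [_ le1 sound complete]; apply: triple_nstore.
  have snd : nmem st7 aAns 0 = 1%N -> sagbi_detectable F.
    by case/sound => w dw; apply: (dims_detectable homogF (ltn0Sn _) max_deg_bound drk dw).
  split=> [det|ndet]; rewrite /accepts /rejects /= /upd /=; last first.
    by case: (nmem st7 aAns 0) le1 snd => // -[|//] _ h; case: ndet; apply: h.
  have [w wQ hw] := detectable_dims homogF (ltn0Sn _) max_deg_bound det drk.
  have [r dr rE] := complete _ (code_lt wQ).
  by apply: rE; apply: hw; move: dr; rewrite codeK.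
have [_ [_ _ _ eM6] _ _ _] := e6.
apply: triple_for => //.
- by move=> st' [fn _]; rewrite /= fn.
- by split; rewrite ?a6 // => _ k; rewrite w6 mnmE div0n mod0n.
move=> c st7 cM fr7 hc [w7 le7 sound7 complete7].
have e7 := main_env_frame fr7 isT isT e6; have [fn7 _] := fr7.
apply: triple_post (try_weight_spec cM e7 (rk := rk) _ (w7 cM)) _; first by rewrite fn7.
move=> st8 _ [w8 [r dr a8]]; split=> //.
- by rewrite a8; case: ifP.
- by rewrite a8; case: eqP dr => [-> dr _|_ _ /sound7//]; exists (decode n Q c).
- move=> c'; rewrite ltnS leq_eqVlt => /predU1P[->|/complete7[r' dr' h]].
    by exists r => // rE; rewrite a8 rE eqxx.
  by exists r' => // /h a7; rewrite a8 a7; case: ifP.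
Qed.
End Run.

(** * The complexity bound *)

Lemma radix_mono n D D' : D <= D' -> radix n D <= radix n D'.
Proof. by move=> h; rewrite ltnS; apply: leq_expl; rewrite leq_mul2r h orbT. Qed.

(** [Q ^ n] is of order [d ^ (n * n.+1)] for fixed [n]. *)
Definition box_const (n : nat) : nat := 2 ^ n * (2 * (2 * n + 1)) ^ (n.+1 * n).

Lemma box_bound n d : 0 < d -> radix n d.+1 ^ n <= box_const n * d ^ (n.+1 * n).
Proof.
move=> d0; rewrite /box_const -mulnA -expnMn expnM -expnMn; apply: leq_expl.
have h : trunc_deg n d.+1 <= (2 * (2 * n + 1) * d) ^ n.+1.
  by apply: leq_expl; move: (2 * n + 1) => x; nia.
have : 0 < (2 * (2 * n + 1) * d) ^ n.+1 by rewrite expn_gt0 !muln_gt0 d0 addn1.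
by rewrite /radix; lia.
Qed.

Theorem theorem3p6 (n : nat) (hn : 0 < n) :
  exists (P : cmd) (C : nat),
  forall (K : fieldType) (s m d : nat) (F : s.-tuple {mpoly K[n]})
    (L : seq (seq (K * 'X_{1..n}))),
  0 < s -> 0 < m -> 0 < d ->
  uniq F ->
  (forall f, f \in F -> exists k : nat, f \is k.-homog) ->
  (forall f, f \in F -> size (msupp f) <= m) ->
  (forall f, f \in F -> (msize f).-1 <= d) ->
  sparse_repr F L ->
  exists (st : state K) (t : nat),
    [/\ exec P (init_state L) st t,
        sagbi_detectable F -> accepts st,
        ~ sagbi_detectable F -> rejects st
      & t <= C * ('C(s + s ^ 2 * d ^ n, s)
                  * m ^ (2 * n - 1)
                  * s ^ (4 * n ^ 2 + 11 * n + 4)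
                  * d ^ (2 * n ^ 3 + 8 * n ^ 2 + 5 * n + 1))].
Proof.
have [C0 hC0] := cost_bound_poly (detect n).
exists (detect n), (C0 * (2 * box_const n) ^ 5).
move=> K s m d F L s0 m0 d0 _ homF _ degF repr.
have sF : size F = s by rewrite size_tuple.
(* This bounds the numbers of polynomials, of terms and of codes, hence the
   iterations of every loop. *)
pose B := s * radix n d.+1 ^ n.
have le_box D : D <= d.+1 -> radix n D ^ n <= radix n d.+1 ^ n.
  by move=> h; apply/leq_expl/radix_mono.
have hD : (max_deg L).+1 <= d.+1 := max_deg_le repr homF degF.
have MB : radix n (max_deg L).+1 ^ n <= B.
  by apply: leq_trans (le_box _ hD) _; rewrite leq_pmull.
have TB : terms_nb L <= B.
  have := terms_nb_bound repr (ltn0Sn _) (max_deg_bound repr homF).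
  by rewrite sF => /leq_trans; apply; rewrite leq_mul2l le_box ?orbT.
have sB : size F <= B by rewrite sF leq_pmulr // expn_gt0.
have [|st [t [ex [acc rej] cost]]] := detect_spec repr homF MB TB sB.
  by rewrite sF.
exists st, t; split=> //; apply: leq_trans cost _.
apply: leq_trans (hC0 B) _; rewrite detect_depth -mulnA leq_mul2l; apply/orP; right.
have B1 : B.+1 <= 2 * box_const n * (s * d ^ (n.+1 * n)).
  apply: (@leq_trans (2 * B)).
    by rewrite mul2n -addnn -addn1 leq_add2l muln_gt0 s0 expn_gt0.
  by rewrite -mulnA leq_mul2l /B mulnCA leq_mul2l box_bound ?orbT.
apply: leq_trans (leq_expl 5 B1) _; rewrite expnMn leq_mul2l; apply/orP; right.
rewrite expnMn -expnM.
have c1 : 0 < 'C(s + s ^ 2 * d ^ n, s) by rewrite bin_gt0 leq_addr.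
have m1 : 0 < m ^ (2 * n - 1) by rewrite expn_gt0 m0.
apply: leq_mul.
  apply: (@leq_trans (s ^ (4 * n ^ 2 + 11 * n + 4))).
    by rewrite leq_pexp2l //; lia.
  by rewrite leq_pmull // muln_gt0 c1.
by rewrite leq_pexp2l //; nia.
Qed.
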